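(* Fix an arbitrary environment $(\mathcal A,\mathcal O,\rho)$, a finite aleatoric state set $\mathcal S$, an initial aleatoric state $S_0\in\mathcal S$, an aleatoric state update function $f:\mathcal S\times\mathcal A\times\mathcal O\to\mathcal S$ and a reward function $r:\mathcal S\times\mathcal A\times\mathcal O\to[0,1]$. Let $\pi_{\rm agent}$ be the policy executed by the growing-horizon Q-learning algorithm (defined in the context), and let $\mathrm{Regret}_{\mathcal P}(T)=\sup_{\pi\in\mathcal P}\mathbb E_{\pi_{\rm agent}}\big[\sum_{t=0}^{T-1}(\lambda_\pi-R_{t+1})\big]$, i.e. the regret relative to $\lambda_*=\sup_{\pi\in\mathcal P}\lambda_\pi$. Let $\tilde{\mathcal P}$ be the set of policies whose action probabilities depend on the history only through the aleatoric state, and let $\tilde\pi\in\tilde{\mathcal P}$ be a policy with $\lambda_{\tilde\pi}=\sup_{\pi\in\tilde{\mathcal P}}\lambda_\pi$. Then for all integers $T\ge1$, $$\mathrm{Regret}_{\mathcal P}(T)\le\Big(120\sqrt{|\mathcal S||\mathcal A|\log(2T^2)}+5\tau_{\tilde\pi}\Big)T^{4/5}+4\,\overline{\Delta}_{\tau_{\tilde\pi}}T+\big(54|\mathcal S||\mathcal A|+18\log T\big)T^{1/5}+2\tau_{\tilde\pi}^5 .$$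
   Context: Environment, histories, policies. $\mathcal A,\mathcal O$ are nonempty finite sets. A history is a finite sequence $h=(a_0,o_1,\dots,a_{t-1},o_t)$ with $a_i\in\mathcal A$, $o_i\in\mathcal O$; $\mathcal H$ is the set of all histories, $H_0=()$ is the empty one, and $(h,a,o)$ denotes concatenation. The environment is given by a function $\rho$ with $\rho(\cdot|h,a)$ a probability distribution on $\mathcal O$ for each $(h,a)\in\mathcal H\times\mathcal A$ (held fixed; all expectations are conditional on the environment). A policy $\pi$ assigns to each $h\in\mathcal H$ a probability distribution $\pi(\cdot|h)$ on $\mathcal A$; $\mathcal P$ is the set of all policies. Under $\pi$, at each time $t=0,1,2,\dots$: $A_t\sim\pi(\cdot|H_t)$, $O_{t+1}\sim\rho(\cdot|H_t,A_t)$, $H_{t+1}=(H_t,A_t,O_{t+1})$; $\mathbb E_\pi$ is the corresponding expectation. Aleatoric states and rewards. $\phi:\mathcal H\to\mathcal S$ is defined by $\phi(H_0)=S_0$ and $\phi((h,a,o))=f(\phi(h),a,o)$. $S_t=\phi(H_t)$ and $R_{t+1}=r(S_t,A_t,O_{t+1})$. $\tilde{\mathcal P}$ consists of the $\pi\in\mathcal P$ for which $\pi(\cdot|h)$ depends on $h$ only through $\phi(h)$. Average reward and averaging time. $\lambda_\pi=\liminf_{T\to\infty}\mathbb E_\pi[\frac1T\sum_{t=0}^{T-1}R_{t+1}]$, starting from the empty history. $\lambda_\pi(h,T)$ is the expected average reward over $T$ timesteps when interaction starts at history $h$ (instead of $H_0$) and actions are selected by $\pi$. The reward averaging time $\tau_\pi$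 is the smallest $\tau\in[0,\infty)$ with $|\lambda_\pi(h,T)-\lambda_\pi|\le\tau/T$ for all $h\in\mathcal H$ and $T\ge1$ ($\tau_\pi=\infty$ if there is none, in which case the bound is read as trivial). Optimal discounted values and distortion. For $\gamma\in[0,1)$, $V_\pi^\gamma(h)$ is the expected discounted sum of rewards (the reward realized after $k$ timesteps being weighted by $\gamma^k$) starting at history $h$ and following $\pi$; $Q_\pi^\gamma(h,a)=\bar r_{ah}+\gamma\sum_{o}\rho(o|h,a)V_\pi^\gamma((h,a,o))$ with $\bar r_{ah}=\sum_o\rho(o|h,a)r(\phi(h),a,o)$; $V_*^\gamma=\sup_\pi V_\pi^\gamma$, $Q_*^\gamma=\sup_\pi Q_\pi^\gamma$. For $\tau\ge1$, with $\gamma=1-1/\tau$, $$\Delta_\tau=\max_{(s,a)\in\mathcal S\times\mathcal A}\Big(\sup_{h:\phi(h)=s}Q_*^\gamma(h,a)-\inf_{h:\phi(h)=s}Q_*^\gamma(h,a)\Big)$$ (only $s$ in the range of $\phi$ matter), and $\overline\Delta_\tau=\sup_{\tau'\ge\tau,\ \tau'\ge 1}\Delta_{\tau'}$. Growing-horizon Q-learning. Change points: $T_0=1$, $T_k=20\cdot2^{k-1}$ for $k\ge1$. For $t\ge1$ let $k_t=\max\{k\ge0:T_k\le t\}$, and $k_0=0$. Initialize $s\leftarrow S_0$, $Q(\cdot,\cdot)\leftarrow1$, $N(\cdot,\cdot)\leftarrow0$ (tables on $\mathcal S\times\mathcal A$). For $t=1,2,\dots$: (1) $\tau\leftarrow T_{k_t}^{1/5}$,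 $\beta\leftarrow4T_{k_t}^{3/10}\sqrt{\log(2T_{k_t}^2)}$; (2) add $T_{k_t}^{1/5}-T_{k_{t-1}}^{1/5}$ to all entries of $Q$; multiply all entries of $N$ by $\mathbf 1(T_{k_t}=T_{k_{t-1}})$; (3) sample $a$ uniformly from $\arg\max_{a'}Q(s,a')$, execute $a$ (this is action $A_{t-1}$) and register the observation $o$ (this is $O_t$); (4) $N(s,a)\leftarrow N(s,a)+1$, $\alpha\leftarrow\frac{1+2\tau}{N(s,a)+2\tau}$, $s'\leftarrow f(s,a,o)$, $\gamma\leftarrow1-1/\tau$; (5) $Q(s,a)\leftarrow Q(s,a)+\alpha\big(r(s,a,o)+\gamma\max_{a'}Q(s',a')-Q(s,a)+\beta/\sqrt{N(s,a)}\big)$, then $Q(s,a)\leftarrow\min(Q(s,a),\tau)$, then $s\leftarrow s'$. *)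

(* Defs.v *)
From mathcomp Require Export all_boot all_order all_algebra.
From mathcomp Require Export all_classical all_reals all_analysis.

Set Implicit Arguments.
Unset Strict Implicit.
Unset Printing Implicit Defensive.

Import Order.TTheory GRing.Theory Num.Theory.
Import numFieldNormedType.Exports.

Local Open Scope classical_set_scope.
Local Open Scope ring_scope.

Definition is_distribution (R : realType) (X : finType) (p : X -> R) : Prop :=
  (forall x, 0 <= p x) /\ \sum_x p x = 1.

(* A history (a_0, o_1, ..., a_{t-1}, o_t) is the sequence of the pairs
   (a_i, o_{i+1}), oldest first. *)
Definition history (A O : finType) := seq (A * O).

(* The stochastic kernels rho(. | h, a) and pi(. | h) are real-valued
   functions constrained by [is_environment] and by membership in
   [policies]. *)
Definition is_environment (R : realType) (A O : finType)
    (rho : history A O -> A -> O -> R) : Prop :=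
  forall h a, is_distribution (rho h a).

Definition policies (R : realType) (A O : finType) :
    set (history A O -> A -> R) :=
  [set pi | forall h, is_distribution (pi h)].

Section Environment.
Variables (R : realType) (A O S : finType).
Variables (rho : history A O -> A -> O -> R).
Variables (S0 : S) (f : S -> A -> O -> S) (r : S -> A -> O -> R).

Implicit Types (h w : history A O) (pi : history A O -> A -> R).

Definition aleatoric h : S := foldl (fun s ao => f s ao.1 ao.2) S0 h.

Definition aleatoric_policies : set (history A O -> A -> R) :=
  [set pi | policies pi /\
    forall h h', aleatoric h = aleatoric h' -> forall a, pi h a = pi h' a].

(* Probability that, from history h on and under pi, the interaction
   continues with w. *)
Fixpoint continuation_prob pi h w : R :=
  if w is (a, o) :: w' then
    pi h a * rho h a o * continuation_prob pi (rcons h (a, o)) w'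
  else 1.

(* Expectation, when starting at h and following pi, of a quantity F
   determined by the next n interactions. *)
Definition expectation pi h (n : nat) (F : history A O -> R) : R :=
  \sum_(w : n.-tuple (A * O)) continuation_prob pi h w * F w.

(* The rewards realized along w after h; for h = [::], the entry of index t
   is R_{t+1}. *)
Fixpoint rewards h w : seq R :=
  if w is (a, o) :: w' then
    r (aleatoric h) a o :: rewards (rcons h (a, o)) w'
  else [::].

Definition average_reward pi h (T : nat) : R :=
  expectation pi h T
    (fun w => T%:R^-1 * \sum_(0 <= t < T) (rewards h w)`_t).

Definition gain pi : R := limn_inf (average_reward pi [::]).

(* The constraints on tau are closed conditions, so the infimum is a minimum
   whenever some real tau is admissible; otherwise it is +oo. *)
Definition averaging_time pi : \bar R :=
  ereal_inf [set tau%:E | tau in [set tau : R | 0 <= tau /\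
    forall h (T : nat), (0 < T)%N ->
      `|average_reward pi h T - gain pi| <= tau / T%:R]].

Definition discounted_value (gamma : R) pi h : R :=
  limn (fun n => expectation pi h n
    (fun w => \sum_(0 <= k < n) gamma ^+ k * (rewards h w)`_k)).

Definition action_value (gamma : R) pi h (a : A) : R :=
  \sum_o rho h a o * r (aleatoric h) a o +
  gamma * \sum_o rho h a o * discounted_value gamma pi (rcons h (a, o)).

Definition optimal_action_value (gamma : R) h (a : A) : R :=
  sup [set action_value gamma pi h a | pi in @policies R A O].

Definition distortion (tau : R) : R :=
  let Qs s a := [set optimal_action_value (1 - tau^-1) h a
                | h in [set h | aleatoric h = s]] in
  sup [set sup (Qs sa.1 sa.2) - inf (Qs sa.1 sa.2)
      | sa in [set sa : S * A | range aleatoric sa.1]].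

(* Distortions are nonnegative, so adjoining 0 matters only for tau = +oo,
   where no tau' is admissible: it makes the supremum of the empty family 0
   instead of -oo. *)
Definition sup_distortion (tau : \bar R) : \bar R :=
  ereal_sup (0%E |` [set (distortion tau')%:E
                    | tau' in [set tau' : R | (tau <= tau'%:E)%E /\ 1 <= tau']]).

Definition regret (agent : history A O -> A -> R) (T : nat) : \bar R :=
  ereal_sup [set (expectation agent [::] T
      (fun w => \sum_(0 <= t < T) (gain pi - (rewards [::] w)`_t)))%:E
    | pi in @policies R A O].

End Environment.

Definition change_point (k : nat) : nat :=
  if k is k'.+1 then (20 * 2 ^ k')%N else 1%N.

(* max {k | change_point k <= t}: since change_point k >= k, restricting to
   k <= t loses nothing; for t = 0 the maximum is empty and phase 0 = 0. *)
Definition phase (t : nat) : nat :=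
  (\max_(k < t.+1 | change_point k <= t) k)%N.

Section QLearning.
Variables (R : realType) (A O S : finType).
Variables (S0 : S) (f : S -> A -> O -> S) (r : S -> A -> O -> R).

Definition phase_start (t : nat) : R := (change_point (phase t))%:R.
Definition horizon (t : nat) : R := phase_start t `^ (1 / 5).
Definition boost (t : nat) : R :=
  4 * phase_start t `^ (3 / 10) * Num.sqrt (ln (2 * phase_start t ^+ 2)).

(* The variables of the algorithm, together with the value of the loop
   counter t at the iteration about to be run. *)
Record qstate := QState {
  clock : nat;
  current : S;
  qtable : S -> A -> R;
  counts : S -> A -> nat }.

Definition qinit : qstate := QState 1 S0 (fun _ _ => 1) (fun _ _ => 0%N).

(* The adjustment of both tables made before the action is sampled: at a
   change point, optimism is raised to the new horizon and counts restart. *)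
Definition refresh (st : qstate) : qstate :=
  let t := clock st in
  QState t (current st)
    (fun s a => qtable st s a + (horizon t - horizon t.-1))
    (fun s a => counts st s a *
       (change_point (phase t) == change_point (phase t.-1)))%N.

(* The update after executing ao.1 and observing ao.2 in a refreshed state;
   the maximum over actions at s' reads the table before its assignment, also
   when s' = s. For finite nonempty A, sup (range (Q s')) is that maximum. *)
Definition learn (st : qstate) (ao : A * O) : qstate :=
  let (a, o) := ao in
  let t := clock st in
  let s := current st in
  let Q := qtable st in
  let tau := horizon t in
  let n := (counts st s a).+1 in
  let alpha := (1 + 2 * tau) / (n%:R + 2 * tau) in
  let s' := f s a o in
  let gamma := 1 - tau^-1 in
  let q := Q s a + alpha * (r s a o + gamma * sup (range (Q s')) - Q s a
                            + boost t / Num.sqrt n%:R) in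
  let here x b := (x == s) && (b == a) in
  QState t.+1 s'
    (fun x b => if here x b then Num.min q tau else Q x b)
    (fun x b => if here x b then n else counts st x b).

Definition qrun (h : history A O) : qstate :=
  foldl (fun st ao => learn (refresh st) ao) qinit h.

Definition greedy (q : A -> R) : {pred A} :=
  [pred a | [forall b, q b <= q a]].

(* The tables are a deterministic function of the history, so the algorithm
   is a history-dependent policy, uniform on the greedy actions. *)
Definition qlearning_policy (h : history A O) (a : A) : R :=
  let st := refresh (qrun h) in
  let best := greedy (qtable st (current st)) in
  (a \in best)%:R / #|best|%:R.

End QLearning.

(* Main.v *)
(* Let lambda and t be the gain and the averaging time of the reference policy,
   let D bound the distortions at horizons at least t, and let tau be the horizon
   of the current phase.

   Comparison with all policies. The values at a large horizon depend on the
   history, up to D, only through the aleatoric state, so a greedy aleatoric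
   policy loses at most 2 D of gain per step; letting the horizon tend to
   infinity, gain pi <= lambda + 2 D for every policy pi.

   Optimism. Clipping the table at tau breaks the usual comparison of the table
   with the optimal values at horizon tau. The table is compared instead with the
   optimal values at horizon tau / 2 shifted by lambda tau / 2 - t, which stay
   below the clipping level by more than the size of the noise. An exponential
   supermartingale, itself clipped, shows that the boost fails to dominate the
   noise with small probability, and each failure is charged a cost tau.

   Regret on a path. When the table is optimistic, some entry at each state is at
   least a level v = lambda tau - O(t) - tau D. A potential built from the table,
   its counts and the current state decreases at each step by at least
   v / tau minus the reward, so that the regret of a phase is at most the
   variation of the potential, of order |S||A| tau + sqrt(|S||A| log) tau^4. *)
From mathcomp Require Import all_boot all_order all_algebra.
From mathcomp Require Import all_classical all_reals all_analysis.
From mathcomp Require Import ring lra zify.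
Require Import Defs.
Import Order.TTheory GRing.Theory Num.Theory.
Import numFieldNormedType.Exports.

Set Implicit Arguments.
Unset Strict Implicit.
Unset Printing Implicit Defensive.

Local Open Scope classical_set_scope.
Local Open Scope ring_scope.

(** * Expectations along histories *)

(** Failures are not treated by conditioning. The constant [E] in the slack is chosen path by path,
    as [t + 4 * sqrt sa] plus the failure cost of the whole path, and optimism in phase [k] is
    claimed only if [t + E <= hz k]. One failure in phase [k] pushes [E] past [hz k]: the claim is
    void for this phase and the earlier ones, whose level is then negative, so that their rewards
    exceed it anyway. The regret is linear in [E], through [E / hz] per step, hence only the
    expected failure cost is needed.

    Half the horizon works because its discount factor is [1 - 2 / tau] instead of [1 - 1 / tau]:
    the missing [V / tau] is at least [(lambda tau / 2 - t) / tau], exactly what discounting removes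
    from the shift [lambda tau / 2 - t]. The shifted values therefore lie below their own backup at
    horizon [tau]. *)

Section Interaction.
Variables (R : realType) (A O : finType).
Variables (rho : history A O -> A -> O -> R).
Hypothesis hrho : is_environment rho.
Implicit Types (h w : history A O) (pi : history A O -> A -> R).

Definition next_mean h (a : A) (G : O -> R) : R := \sum_o rho h a o * G o.

Definition step_mean pi h (G : A -> O -> R) : R :=
  \sum_a pi h a * next_mean h a (G a).

Lemma next_mean_le h a (F G : O -> R) :
  (forall o, F o <= G o) -> next_mean h a F <= next_mean h a G.
Proof.
by move=> FG; apply: ler_sum => o _; apply: ler_wpM2l => //; case: (hrho h a).
Qed.

Lemma next_mean_cst h a (c : R) : next_mean h a (fun=> c) = c.
Proof. by rewrite /next_mean -mulr_suml (hrho h a).2 mul1r. Qed.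

Lemma next_meanD h a (F G : O -> R) :
  next_mean h a (fun o => F o + G o) = next_mean h a F + next_mean h a G.
Proof. by rewrite /next_mean -big_split; apply: eq_bigr => o _; rewrite mulrDr. Qed.

Lemma next_meanZ h a (c : R) (F : O -> R) :
  next_mean h a (fun o => c * F o) = c * next_mean h a F.
Proof. by rewrite /next_mean mulr_sumr; apply: eq_bigr => o _; rewrite mulrCA. Qed.

Lemma eq_next_mean h a (F G : O -> R) :
  F =1 G -> next_mean h a F = next_mean h a G.
Proof. by move=> FG; apply: eq_bigr => o _; rewrite FG. Qed.

Lemma next_mean_bound h a (G : O -> R) (l u : R) :
  (forall o, l <= G o <= u) -> l <= next_mean h a G <= u.
Proof.
move=> lGu; apply/andP; split.
  by rewrite -[leLHS](next_mean_cst h a); apply: next_mean_le => o; case/andP: (lGu o).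
by rewrite -[leRHS](next_mean_cst h a); apply: next_mean_le => o; case/andP: (lGu o).
Qed.

Section Policy.
Variable pi : history A O -> A -> R.
Hypothesis hpi : policies pi.

Lemma step_mean_le h (F G : A -> O -> R) :
  (forall a o, F a o <= G a o) -> step_mean pi h F <= step_mean pi h G.
Proof.
move=> FG; apply: ler_sum => a _; apply: ler_wpM2l; first by case: (hpi h).
exact: next_mean_le.
Qed.

Lemma step_mean_cst h (c : R) : step_mean pi h (fun _ _ => c) = c.
Proof.
rewrite /step_mean; under eq_bigr do rewrite next_mean_cst.
by rewrite -mulr_suml (hpi h).2 mul1r.
Qed.

Lemma step_mean_bound h (G : A -> O -> R) (l u : R) :
  (forall a o, l <= G a o <= u) -> l <= step_mean pi h G <= u.
Proof.
move=> lGu; apply/andP; split.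
  by rewrite -[leLHS](step_mean_cst h); apply: step_mean_le => a o; case/andP: (lGu a o).
by rewrite -[leRHS](step_mean_cst h); apply: step_mean_le => a o; case/andP: (lGu a o).
Qed.

Lemma step_meanD h (F G : A -> O -> R) :
  step_mean pi h (fun a o => F a o + G a o) = step_mean pi h F + step_mean pi h G.
Proof.
rewrite /step_mean -big_split; apply: eq_bigr => a _.
by rewrite next_meanD mulrDr.
Qed.

Lemma step_meanZ h (c : R) (F : A -> O -> R) :
  step_mean pi h (fun a o => c * F a o) = c * step_mean pi h F.
Proof.
by rewrite /step_mean mulr_sumr; apply: eq_bigr => a _; rewrite next_meanZ mulrCA.
Qed.

Lemma eq_step_mean h (F G : A -> O -> R) :
  (forall a o, F a o = G a o) -> step_mean pi h F = step_mean pi h G.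
Proof.
by move=> FG; apply: eq_bigr => a _; congr (_ * _); apply: eq_next_mean => o.
Qed.

Lemma expectation0 h F : expectation rho pi h 0 F = F [::].
Proof.
rewrite /expectation (big_pred1 [tuple]) => [|t]; first by rewrite mul1r.
by apply/esym/eqP/val_inj; case: t => -[].
Qed.

Lemma expectationS h n F :
  expectation rho pi h n.+1 F =
  step_mean pi h (fun a o =>
    expectation rho pi (rcons h (a, o)) n (fun w => F ((a, o) :: w))).
Proof.
rewrite /expectation /step_mean.
rewrite (reindex (fun p : (A * O) * n.-tuple (A * O) => [tuple of p.1 :: p.2])) /=;
  last first.
  exists (fun t => (thead t, [tuple of behead t])) => [[x t] _|t _] /=.
    by congr pair; apply: val_inj.
  by rewrite [RHS]tuple_eta.
transitivity (\sum_(p : (A * O) * n.-tuple (A * O))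
    (pi h p.1.1 * rho h p.1.1 p.1.2 *
     continuation_prob rho pi (rcons h p.1) p.2 * F (p.1 :: p.2))).
  by apply: eq_bigr => -[[a o] w] _.
rewrite -(pair_bigA _ (fun (x : A * O) (w : n.-tuple (A * O)) =>
  pi h x.1 * rho h x.1 x.2 * continuation_prob rho pi (rcons h x) w * F (x :: w))) /=.
transitivity (\sum_(x : A * O) \sum_(w : n.-tuple (A * O))
    (pi h x.1 * rho h x.1 x.2 *
     continuation_prob rho pi (rcons h (x.1, x.2)) w * F ((x.1, x.2) :: w))).
  by apply: eq_bigr => -[a o] _.
rewrite -(pair_bigA _ (fun a o => \sum_(w : n.-tuple (A * O))
  pi h a * rho h a o * continuation_prob rho pi (rcons h (a, o)) w
  * F ((a, o) :: w))) /=.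
apply: eq_bigr => a _; rewrite /next_mean mulr_sumr; apply: eq_bigr => o _.
by rewrite !mulr_sumr; apply: eq_bigr => w _; rewrite !mulrA.
Qed.

Lemma continuation_prob_ge0 h w : 0 <= continuation_prob rho pi h w.
Proof.
elim: w h => [|[a o] w IH] h //=; rewrite !mulr_ge0 //.
  by case: (hpi h).
by case: (hrho h a).
Qed.

Lemma expectation_le h n F G :
  (forall w, size w = n -> continuation_prob rho pi h w != 0 -> F w <= G w) ->
  expectation rho pi h n F <= expectation rho pi h n G.
Proof.
move=> FG; apply: ler_sum => w _.
have [->|pw0] := eqVneq (continuation_prob rho pi h w) 0; first by rewrite !mul0r.
by apply: ler_wpM2l; [exact: continuation_prob_ge0|apply: FG; rewrite ?size_tuple].
Qed.

Lemma eq_expectation h n F G :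
  (forall w, size w = n -> F w = G w) ->
  expectation rho pi h n F = expectation rho pi h n G.
Proof. by move=> FG; apply: eq_bigr => w _; rewrite FG ?size_tuple. Qed.

Lemma expectationD h n F G :
  expectation rho pi h n (fun w => F w + G w) =
  expectation rho pi h n F + expectation rho pi h n G.
Proof. by rewrite /expectation -big_split; apply: eq_bigr => w _; rewrite mulrDr. Qed.

Lemma expectationZ h n c F :
  expectation rho pi h n (fun w => c * F w) = c * expectation rho pi h n F.
Proof. by rewrite /expectation mulr_sumr; apply: eq_bigr => w _; rewrite mulrCA. Qed.

Lemma expectation_cst h n c : expectation rho pi h n (fun=> c) = c.
Proof.
elim: n h => [|n IH] h; first by rewrite expectation0.
by rewrite expectationS -[RHS](step_mean_cst h); apply: eq_step_mean => a o.
Qed.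

(** Applied with [Psi] a running sum plus a nonnegative potential, it bounds the expected final sum
    by the initial potential. *)
Lemma expectation_super (Psi : history A O -> R) :
  (forall h, step_mean pi h (fun a o => Psi (rcons h (a, o))) <= Psi h) ->
  forall n h, expectation rho pi h n (fun w => Psi (h ++ w)) <= Psi h.
Proof.
move=> Psi_le; elim=> [|n IH] h; first by rewrite expectation0 cats0.
rewrite expectationS; apply: le_trans (Psi_le h).
apply: step_mean_le => a o; apply: le_trans (IH (rcons h (a, o))).
by rewrite le_eqVlt; apply/orP; left; apply/eqP; apply: eq_expectation => w _; rewrite cat_rcons.
Qed.

End Policy.
End Interaction.

(** * Discounted values *)

(** Turns bounds with a geometrically small error, as produced by iterating a one-step estimate,
    into exact inequalities. *)
Lemma le0_geometric (R : realType) (q x C : R) :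
  0 <= q < 1 -> (forall n, x <= q ^+ n * C) -> x <= 0.
Proof.
move=> /andP[q0 q1] xq.
have cg : geometric C q @ \oo --> (0 : R).
  by apply: cvg_geometric; rewrite ger0_norm.
rewrite -(cvg_lim (@Rhausdorff R) cg); apply: limr_ge; first by apply/cvg_ex; exists 0.
by apply: nearW => n; rewrite /geometric /= mulrC.
Qed.

(* Summation by parts: the excess [D_n = S_n - n l + c] is nonnegative and
   equals [c] at [n = 0], and the discount factors decrease. *)
Lemma abel_lower (R : realType) (x : nat -> R) (q l c : R) n :
  0 <= q <= 1 -> (forall n, n%:R * l - c <= \sum_(0 <= k < n) x k) ->
  - c <= \sum_(0 <= k < n) q ^+ k * (x k - l).
Proof.
move=> /andP[q0 q1] hx.
pose D n := \sum_(0 <= k < n) x k - n%:R * l + c.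
have D0 k : 0 <= D k by rewrite /D; have := hx k; lra.
suff : q ^+ n * D n - c <= \sum_(0 <= k < n) q ^+ k * (x k - l).
  by apply: le_trans; rewrite lerDr mulr_ge0 ?exprn_ge0.
elim: n => [|n IH]; first by rewrite /D !big_nil; lra.
rewrite big_nat_recr //= exprSr.
have qn : 0 <= q ^+ n by rewrite exprn_ge0.
have -> : x n - l = D n.+1 - D n.
  by rewrite /D big_nat_recr //= -natr1; ring.
have : q ^+ n * q * D n.+1 <= q ^+ n * D n.+1.
  by rewrite ler_wpM2r // ler_piMr.
by move: IH; lra.
Qed.

(** * Maxima over the finite action set *)

Section Maximum.
Variables (R : realType) (A : finType).
Hypothesis hA : (0 < #|A|)%N.

Lemma exists_argmax (q : A -> R) : exists b, forall a, q a <= q b.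
Proof.
have /card_gt0P[a0 _] := hA.
exists [arg max_(i > a0) q i]%O => a.
by case: (@arg_maxP _ _ A a0 xpredT q isT) => b _; apply.
Qed.

Definition argmax (q : A -> R) : A := sval (cid (exists_argmax q)).

Lemma argmaxP (q : A -> R) a : q a <= q (argmax q).
Proof. by rewrite /argmax; case: cid. Qed.

Lemma sup_rangeE (q : A -> R) : sup (range q) = q (argmax q).
Proof.
apply/le_anti/andP; split.
  by apply: ge_sup => [|_ [a _ <-]]; [exists (q (argmax q)), (argmax q)|exact: argmaxP].
by apply: ub_le_sup; [exists (q (argmax q)) => _ [a _ <-]; exact: argmaxP|exists (argmax q)].
Qed.

Lemma sup_range_ge (q : A -> R) a : q a <= sup (range q).
Proof. by rewrite sup_rangeE; exact: argmaxP. Qed.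

Lemma sup_range_le (q : A -> R) c : (forall a, q a <= c) -> sup (range q) <= c.
Proof. by rewrite sup_rangeE. Qed.

End Maximum.

(** * Values of a policy and optimal values at a given horizon *)

Section Values.
Variables (R : realType) (A O S : finType).
Hypothesis hA : (0 < #|A|)%N.
Variables (rho : history A O -> A -> O -> R).
Hypothesis hrho : is_environment rho.
Variables (S0 : S) (f : S -> A -> O -> S) (r : S -> A -> O -> R).
Hypothesis hr : forall s a o, 0 <= r s a o <= 1.

Implicit Types (h w : history A O) (pi : history A O -> A -> R).
Local Notation phi := (aleatoric S0 f).
Local Notation mean := (next_mean rho).

Lemma aleatoric_rcons h a o : phi (rcons h (a, o)) = f (phi h) a o.
Proof. by rewrite /aleatoric foldl_rcons. Qed.

Definition det_policy (c : history A O -> A) : history A O -> A -> R :=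
  fun h a => (a == c h)%:R.

Lemma det_policyP c : policies (det_policy c).
Proof.
move=> h; split=> [a|]; first by rewrite ler0n.
rewrite (bigD1 (c h)) //= /det_policy eqxx big1 ?addr0 // => a /negPf ac.
by rewrite ac.

Qed.

Lemma step_mean_det c h (G : A -> O -> R) :
  step_mean rho (det_policy c) h G = mean h (c h) (G (c h)).
Proof.
rewrite /step_mean (bigD1 (c h)) //= big1 ?addr0 => [|a /negPf ac].
  by rewrite /det_policy eqxx mul1r.
by rewrite /det_policy ac mul0r.
Qed.

Section PolicyValue.
Variable pi : history A O -> A -> R.
Hypothesis hpi : policies pi.
Local Notation smean := (step_mean rho pi).

Fixpoint mean_reward (k : nat) h : R :=
  if k is k'.+1 then smean h (fun a o => mean_reward k' (rcons h (a, o)))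
  else smean h (r (phi h)).

Lemma mean_reward_bound k h : 0 <= mean_reward k h <= 1.
Proof.
elim: k h => [|k IH] h /=; exact: step_mean_bound.
Qed.

Definition discounted_sum (q : R) n h : R :=
  \sum_(0 <= k < n) q ^+ k * mean_reward k h.

Lemma discounted_sumS q n h :
  discounted_sum q n.+1 h =
  smean h (fun a o => r (phi h) a o + q * discounted_sum q n (rcons h (a, o))).
Proof.
rewrite step_meanD step_meanZ /discounted_sum big_nat_recl //= expr0 mul1r.
congr (_ + _); elim: n => [|n IH].
  rewrite big_nil; under eq_step_mean do rewrite big_nil.
  by rewrite step_mean_cst // mulr0.
rewrite big_nat_recr //= IH; under [in RHS]eq_step_mean do rewrite big_nat_recr //=.
by rewrite step_meanD step_meanZ mulrDr exprS mulrA.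
Qed.

Lemma expectation_discounted q n h :
  expectation rho pi h n (fun w => \sum_(0 <= k < n) q ^+ k * (rewards S0 f r h w)`_k) =
  discounted_sum q n h.
Proof.
elim: n h => [|n IH] h; first by rewrite expectation0 /discounted_sum !big_nil.
rewrite expectationS discounted_sumS; apply: eq_step_mean => a o.
rewrite -IH -expectationZ -[r _ _ _](expectation_cst hrho hpi (rcons h (a, o)) n).
rewrite -expectationD; apply: eq_expectation => w _.
rewrite big_nat_recl //= expr0 mul1r mulr_sumr; congr (_ + _).
by apply: eq_bigr => k _; rewrite exprS mulrA.
Qed.

Lemma average_rewardE n h :
  average_reward rho S0 f r pi h n = n%:R^-1 * \sum_(0 <= k < n) mean_reward k h.
Proof.
rewrite /average_reward expectationZ; congr (_ * _).
have := expectation_discounted 1 n h.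
under eq_expectation do under eq_bigr do rewrite expr1n mul1r.
move=> ->; rewrite /discounted_sum; apply: eq_bigr => k _.
by rewrite expr1n mul1r.
Qed.

Lemma average_reward_bound n h : 0 <= average_reward rho S0 f r pi h n <= 1.
Proof.
rewrite average_rewardE; case: n => [|n]; first by rewrite big_nil mulr0 ler01 lexx.
have n0 : 0 < n.+1%:R :> R by rewrite ltr0n.
rewrite mulrC ler_pdivlMr // mul0r ler_pdivrMr // mul1r.
rewrite sumr_ge0 /= => [|k _]; last by case/andP: (mean_reward_bound k h).
rewrite -[leRHS](_ : \sum_(0 <= k < n.+1) (1 : R) = _).
  by apply: ler_sum => k _; case/andP: (mean_reward_bound k h).
by rewrite sumr_const_nat subn0.
Qed.

Section Horizon.
Variable m : R.
Hypothesis hm : 1 <= m.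
Local Notation gam := (1 - m^-1).

Lemma discount_bound : 0 <= gam < 1.
Proof.
have m0 : 0 < m by move: hm; lra.
by rewrite subr_ge0 invf_le1 // hm ltrBlDr ltrDl invr_gt0.
Qed.

Lemma discount_fix : gam * m = m - 1.
Proof. by rewrite mulrBl mul1r mulVf //; apply/lt0r_neq0; move: hm; lra. Qed.

(** Every reward after step [n] is replaced by its maximum 1; the rest of the geometric series sums
    to [gam ^+ n * m]. *)
Let upper n h := discounted_sum gam n h + gam ^+ n * m.

Let g0 n : 0 <= gam ^+ n.
Proof. by rewrite exprn_ge0 //; case/andP: discount_bound. Qed.

Let sum_mono h : nondecreasing_seq (discounted_sum gam ^~ h).
Proof.
apply/nondecreasing_seqP => n; rewrite /discounted_sum big_nat_recr //= lerDl.
by rewrite mulr_ge0 //; case/andP: (mean_reward_bound n h).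
Qed.

Let upper_mono h : nonincreasing_seq (upper ^~ h).
Proof.
apply/nonincreasing_seqP => n; rewrite /upper /discounted_sum big_nat_recr //=.
rewrite exprSr -addrA lerD2l -mulrA discount_fix -mulrDr ler_wpM2l //.
by case/andP: (mean_reward_bound n h) => _; lra.
Qed.

Let sum_le_upper n k h : discounted_sum gam k h <= upper n h.
Proof.
have su i : discounted_sum gam i h <= upper i h.
  by rewrite lerDl mulr_ge0 //; move: hm; lra.
have [kn|/ltnW nk] := leqP k n.
  by apply: le_trans (su n); exact: sum_mono.
by apply: le_trans (su k) _; exact: upper_mono.
Qed.

Lemma discounted_value_sandwich n h :
  discounted_sum gam n h <= discounted_value rho S0 f r gam pi h <=
  discounted_sum gam n h + gam ^+ n * m.
Proof.
rewrite /discounted_value; under eq_fun do rewrite expectation_discounted.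
have cv : cvgn (discounted_sum gam ^~ h).
  apply: nondecreasing_is_cvgn; first exact: sum_mono.
  by exists (upper 0%N h) => _ [k _ <-]; exact: sum_le_upper.
apply/andP; split; first by apply: nondecreasing_cvgn_le => //; exact: sum_mono.
by apply: limr_le => //; apply: nearW => k; exact: sum_le_upper.
Qed.

Lemma discounted_value_bound h : 0 <= discounted_value rho S0 f r gam pi h <= m.
Proof.
have := discounted_value_sandwich 0 h.
by rewrite /discounted_sum big_nil expr0 mul1r add0r.
Qed.

Lemma discounted_value_step h :
  discounted_value rho S0 f r gam pi h =
  smean h (fun a o => r (phi h) a o +
    gam * discounted_value rho S0 f r gam pi (rcons h (a, o))).
Proof.
set V := discounted_value rho S0 f r gam pi.
have sw n : discounted_sum gam n.+1 h <=
    smean h (fun a o => r (phi h) a o + gam * V (rcons h (a, o))) <=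
    discounted_sum gam n.+1 h + gam ^+ n.+1 * m.
  rewrite discounted_sumS -[gam ^+ n.+1 * m](step_mean_cst hrho hpi h) -step_meanD.
  have gam0 : 0 <= gam by case/andP: discount_bound.
  apply/andP; split; apply: step_mean_le => // a o;
    have /andP[lo up] := discounted_value_sandwich n (rcons h (a, o)).
    by rewrite lerD2l ler_wpM2l.
  by rewrite -addrA lerD2l exprS -mulrA -mulrDr ler_wpM2l.
apply/eqP; rewrite -subr_eq0 -normr_le0.
apply: (@le0_geometric _ gam _ (gam * m)) => [|n]; first exact: discount_bound.
rewrite mulrA -exprSr ler_norml.
have /andP[] := sw n; have /andP[] := discounted_value_sandwich n.+1 h.
by rewrite -/V; move: (discounted_sum _ _ _) => s; set e := gam ^+ _ * m; lra.
Qed.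

Lemma action_valueE h a :
  action_value rho S0 f r gam pi h a =
  mean h a (fun o => r (phi h) a o +
    gam * discounted_value rho S0 f r gam pi (rcons h (a, o))).
Proof. by rewrite next_meanD next_meanZ. Qed.

Lemma action_value_bound h a : 0 <= action_value rho S0 f r gam pi h a <= m.
Proof.
rewrite action_valueE; apply: next_mean_bound => // o.
have /andP[v0 vm] := discounted_value_bound (rcons h (a, o)).
have /andP[q0 q1] := discount_bound; have /andP[r0 r1] := hr (phi h) a o.
rewrite addr_ge0 ?mulr_ge0 //=.
have : gam * discounted_value rho S0 f r gam pi (rcons h (a, o)) <= m - 1.
  by rewrite -discount_fix ler_wpM2l.
by lra.
Qed.

(** A constant reward [l] has discounted value [l * m], and [abel_lower] bounds by [c] what the
    deviations from [l] can take away. Truncation at [n] leaves the error [gam ^+ n * (l * m)]. *)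
Lemma discounted_value_lower (l c : R) h : 0 <= l ->
  (forall n, n%:R * l - c <= \sum_(0 <= k < n) mean_reward k h) ->
  l * m - c <= discounted_value rho S0 f r gam pi h.
Proof.
move=> l0 hl; rewrite -subr_le0; apply: (@le0_geometric _ gam _ (l * m)) => [|n].
  exact: discount_bound.
have /andP[q0 /ltW q1] := discount_bound.
have ab := @abel_lower _ (mean_reward ^~ h) gam l c n _ hl.
have /andP[+ _] := discounted_value_sandwich n h.
have := ab; rewrite q0 q1 => /(_ isT); rewrite /discounted_sum.
under eq_bigr do rewrite mulrBr; rewrite big_split /= sumrN -mulr_suml.
have -> : \sum_(0 <= k < n) gam ^+ k = m * (1 - gam ^+ n).
  elim: {ab} n => [|n IH]; first by rewrite big_nil expr0 subrr mulr0.
  rewrite big_nat_recr //= IH exprS.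
  by rewrite !mulrBr mulr1 mulrA [m * gam]mulrC discount_fix; ring.
by lra.
Qed.

End Horizon.
End PolicyValue.

Section OptimalValue.
Variable m : R.
Hypothesis hm : 1 <= m.
Local Notation gam := (1 - m^-1).
Local Notation Qs := (optimal_action_value rho S0 f r gam).

Definition optimal_value h : R := sup (range (Qs h)).
Local Notation Vs := optimal_value.

Lemma action_value_le_optimal pi h a : policies pi ->
  action_value rho S0 f r gam pi h a <= Qs h a.
Proof.
move=> hpi; apply: ub_le_sup; last by exists pi.
by exists m => _ [pi' hpi' <-]; case/andP: (action_value_bound hpi' hm h a).
Qed.

Lemma optimal_action_value_ub h a c :
  (forall pi, policies pi -> action_value rho S0 f r gam pi h a <= c) -> Qs h a <= c.
Proof.
move=> hc; apply: ge_sup => [|_ [pi hpi <-]]; last exact: hc.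
have /card_gt0P[a0 _] := hA.
by eexists; exists (det_policy (fun=> a0)) => //; exact: det_policyP.
Qed.

Lemma optimal_action_value_bound h a : 0 <= Qs h a <= m.
Proof.
have /card_gt0P[a0 _] := hA.
have d0 := @det_policyP (fun=> a0).
apply/andP; split.
  apply: le_trans (action_value_le_optimal h a d0).
  by case/andP: (action_value_bound d0 hm h a).
by apply: optimal_action_value_ub => pi hpi; case/andP: (action_value_bound hpi hm h a).
Qed.

Lemma optimal_value_bound h : 0 <= Vs h <= m.
Proof. by rewrite /Vs sup_rangeE; exact: optimal_action_value_bound. Qed.

Lemma discounted_value_le_optimal pi h : policies pi ->
  discounted_value rho S0 f r gam pi h <= Vs h.
Proof.
move=> hpi; rewrite (discounted_value_step hpi hm).
have -> : Vs h = \sum_a pi h a * Vs h by rewrite -mulr_suml (hpi h).2 mul1r.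
apply: ler_sum => a _.
apply: ler_wpM2l; first by case: (hpi h).
rewrite -action_valueE; apply: le_trans (action_value_le_optimal _ _ hpi) _.
exact: sup_range_ge.
Qed.

Let backup h a := mean h a (fun o => r (phi h) a o + gam * Vs (rcons h (a, o))).

Let gam0 : 0 <= gam. Proof. by case/andP: (@discount_bound m hm). Qed.

Let optimal_le_backup h a : Qs h a <= backup h a.
Proof.
apply: optimal_action_value_ub => pi hpi; rewrite action_valueE.
apply: next_mean_le => // o; rewrite lerD2l ler_wpM2l //.
exact: discounted_value_le_optimal.
Qed.

(* Iterating [Vs h <= backup h a] along the actions maximizing the backup shows
   that the corresponding policy attains [Vs]. *)
Lemma bellman h a :
  Qs h a = mean h a (fun o => r (phi h) a o + gam * Vs (rcons h (a, o))).
Proof.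
apply/le_anti; rewrite optimal_le_backup /=.
pose c h := argmax hA (backup h).
have cP := @det_policyP c.
have Vs_le n h' : Vs h' <= discounted_sum (det_policy c) gam n h' + gam ^+ n * m.
  elim: n h' => [|n IH] h'.
    rewrite /discounted_sum big_nil expr0 mul1r add0r.
    by case/andP: (optimal_value_bound h').
  rewrite discounted_sumS // -[gam ^+ n.+1 * m](step_mean_cst hrho cP h') -step_meanD //.
  rewrite step_mean_det; apply: (@le_trans _ _ (backup h' (c h'))).
    rewrite {1}/optimal_value sup_rangeE.
    by apply: le_trans (optimal_le_backup _ _) _; exact: argmaxP.
  apply: next_mean_le => // o; rewrite -addrA lerD2l exprS -mulrA -mulrDr.
  by rewrite ler_wpM2l.
have Vc h' : Vs h' <= discounted_value rho S0 f r gam (det_policy c) h'.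
  rewrite -subr_le0; apply: (@le0_geometric _ gam _ m) => [|n]; first exact: discount_bound.
  have /andP[+ _] := discounted_value_sandwich cP hm n h'.
  by have := Vs_le n h'; lra.
apply: le_trans (action_value_le_optimal h a cP).
by rewrite action_valueE; apply: next_mean_le => // o; rewrite lerD2l ler_wpM2l.
Qed.

End OptimalValue.

(** Replacing the larger discount factor by the smaller one costs at most
    [(1 / m1 - 1 / m2) * m2 = m2 / m1 - 1] per step, and [m2 - m1] is the fixed point of
    [x = (1 - 1 / m1) * x + (m2 / m1 - 1)]. Iterating contracts the crude initial gap [m2] to it. *)
Lemma optimal_value_mono (m1 m2 : R) h : 1 <= m1 -> m1 <= m2 ->
  optimal_value m2 h <= optimal_value m1 h + (m2 - m1).
Proof.
move=> m11 m12; have m21 : 1 <= m2 by lra.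
have q1 := discount_bound m11; have /andP[q10 _] := q1.
have step n h' : optimal_value m2 h' - optimal_value m1 h' <=
    m2 - m1 + (1 - m1^-1) ^+ n * m1.
  elim: n h' => [|n IH] h'.
    have /andP[_] := optimal_value_bound m21 h'.
    have /andP[] := optimal_value_bound m11 h'.
    by rewrite expr0 mul1r; lra.
  rewrite lerBlDr [leRHS]addrC {1}/optimal_value sup_rangeE bellman //.
  apply: (@le_trans _ _ (optimal_action_value rho S0 f r (1 - m1^-1) h'
    (argmax hA (optimal_action_value rho S0 f r (1 - m2^-1) h'))
    + (m2 - m1 + (1 - m1^-1) ^+ n.+1 * m1))); last by rewrite lerD2r sup_range_ge.
  rewrite bellman //; set a := argmax _ _.
  rewrite -[X in _ <= _ + X](next_mean_cst hrho h' a) -next_meanD.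
  apply: next_mean_le => // o; rewrite -!addrA lerD2l.
  have := IH (rcons h' (a, o)); have /andP[v0 vm] := optimal_value_bound m21 (rcons h' (a, o)).
  set v2 := optimal_value m2 _ in v0 vm *; set v1 := optimal_value m1 _ => le21.
  have e1 : (1 - m2^-1) * v2 = (1 - m1^-1) * v2 + (m1^-1 - m2^-1) * v2 by ring.
  have e2 : (m1^-1 - m2^-1) * v2 <= (m1^-1 - m2^-1) * m2.
    by rewrite ler_wpM2l // subr_ge0 lef_pV2 // posrE; lra.
  have e3 : (m1^-1 - m2^-1) * m2 = m2 / m1 - 1.
    by rewrite mulrBl mulVf; [rewrite mulrC|lra].
  have e4 : (1 - m1^-1) * (v2 - v1) <= (1 - m1^-1) * (m2 - m1 + (1 - m1^-1) ^+ n * m1).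
    by rewrite ler_wpM2l.
  have e5 : (1 - m1^-1) * (m2 - m1) = m2 - m1 - (m2 / m1 - 1).
    have m1n : m1 != 0 by lra.
    by field.
  by rewrite exprS; lra.
rewrite -subr_le0; apply: (@le0_geometric _ (1 - m1^-1) _ m1) => // n.
by have := step n h; lra.
Qed.

Lemma optimal_action_value_mono (m1 m2 : R) h a : 1 <= m1 -> m1 <= m2 ->
  optimal_action_value rho S0 f r (1 - m2^-1) h a <=
  optimal_action_value rho S0 f r (1 - m1^-1) h a + (m2 - m1).
Proof.
move=> m11 m12; have m21 : 1 <= m2 by lra.
rewrite !bellman // -[X in _ <= _ + X](next_mean_cst hrho h a) -next_meanD.
apply: next_mean_le => // o; rewrite -addrA lerD2l.
have /andP[v0 vm] := optimal_value_bound m21 (rcons h (a, o)).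
have le21 := optimal_value_mono (rcons h (a, o)) m11 m12.
set v2 := optimal_value m2 _ in v0 vm le21 *; set v1 := optimal_value m1 _ in le21 *.
have e1 : (1 - m2^-1) * v2 = (1 - m1^-1) * v2 + (m1^-1 - m2^-1) * v2 by ring.
have e2 : (m1^-1 - m2^-1) * v2 <= (m1^-1 - m2^-1) * m2.
  by rewrite ler_wpM2l // subr_ge0 lef_pV2 // posrE; lra.
have e3 : (m1^-1 - m2^-1) * m2 = m2 / m1 - 1.
  by rewrite mulrBl mulVf; [rewrite mulrC|lra].
have e4 : (1 - m1^-1) * v2 <= (1 - m1^-1) * (v1 + (m2 - m1)).
  by rewrite ler_wpM2l //; case/andP: (discount_bound m11).
have e5 : (1 - m1^-1) * (m2 - m1) = m2 - m1 - (m2 / m1 - 1).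
  have m1n : m1 != 0 by lra.
  by field.
by lra.
Qed.

Lemma optimal_action_value_distortion (m : R) h h' a : 1 <= m -> phi h = phi h' ->
  optimal_action_value rho S0 f r (1 - m^-1) h a <=
  optimal_action_value rho S0 f r (1 - m^-1) h' a + distortion rho S0 f r m.
Proof.
move=> hm hh'; rewrite -lerBlDl.
pose Q s b := [set optimal_action_value rho S0 f r (1 - m^-1) g b | g in [set g | phi g = s]].
have Qub s b : has_ubound (Q s b).
  by exists m => _ [g _ <-]; case/andP: (optimal_action_value_bound hm g b).
have Qlb s b : has_lbound (Q s b).
  by exists 0 => _ [g _ <-]; case/andP: (optimal_action_value_bound hm g b).
apply: (@le_trans _ _ (sup (Q (phi h) a) - inf (Q (phi h) a))).
  apply: lerB; first by apply: ub_le_sup => //; exists h.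
  by apply: ge_inf => //; exists h'.
apply: ub_le_sup; last by exists (phi h, a) => //=; exists h.
exists m => _ [[s b] /= [g _ gs] <-]; rewrite -[leRHS]subr0; apply: lerB.
  apply: ge_sup => [|_ [g' _ <-]]; last by case/andP: (optimal_action_value_bound hm g' b).
  by eexists; exists g.
apply: lb_le_inf => [|_ [g' _ <-]]; last by case/andP: (optimal_action_value_bound hm g' b).
by eexists; exists g.
Qed.

End Values.

(** * Gain of aleatoric policies *)

Section LimInf.
Variables (R : realType) (u : nat -> R).
Hypothesis hu : forall n, 0 <= u n <= 1.

Let limn_infE01 : limn_inf u = sup (range (infs u)).
Proof.
apply: limn_infE; exists 1; split; first exact: num_real.
move=> x x1 n _; have /andP[u0 u1] := hu n.
by rewrite /= ger0_norm //; exact: le_trans u1 (ltW x1).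
Qed.

Let infs_le n k : (n <= k)%N -> infs u n <= u k.
Proof.
move=> nk; apply: ge_inf; last by exists k.
by exists 0 => _ [i _ <-]; case/andP: (hu i).
Qed.

Let infs_ub : has_ubound (range (infs u)).
Proof.
exists 1 => _ [n _ <-]; apply: le_trans (infs_le (leqnn n)) _.
by case/andP: (hu n).
Qed.

Lemma limn_inf_near (e : R) : 0 < e ->
  exists N, forall n, (N <= n)%N -> limn_inf u - e <= u n.
Proof.
move=> e0; rewrite limn_infE01.
have [|_ [N _ <-] sN] := @sup_adherent _ (range (infs u)) e e0.
  by split; [exists (infs u 0%N), 0%N|exact: infs_ub].
by exists N => n Nn; apply: le_trans (ltW sN) (infs_le Nn).
Qed.

Lemma limn_inf_ge (c : R) :
  (forall e, 0 < e -> exists N, forall n, (N <= n)%N -> c - e <= u n) -> c <= limn_inf u.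
Proof.
move=> hc; apply/ler_addgt0Pr => e e0; rewrite -lerBlDr.
have [N hN] := hc e e0; rewrite limn_infE01.
apply: (@le_trans _ _ (infs u N)); last by apply: ub_le_sup => //; exists N.
apply: lb_le_inf => [|_ [k /= Nk <-]]; last exact: hN.
by exists (u N), N => /=.
Qed.

Lemma limn_inf_bound : 0 <= limn_inf u <= 1.
Proof.
apply/andP; split.
  apply: limn_inf_ge => e e0; exists 0%N => n _.
  by have /andP[] := hu n; lra.
apply/ler_addgt0Pr => e e0; have [N hN] := limn_inf_near e0.
by have := hN N (leqnn N); have /andP[] := hu N; lra.
Qed.

End LimInf.

(** * Limits along an ultrafilter *)

Section UltraLimits.
Variable (U : set_system nat).
Hypothesis UU : UltraFilter U.

(** If no fibre of [u] were in [U], the finite intersection of their complements would be, and it is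
    empty. *)
Lemma ultra_const (T : finType) (u : nat -> T) : exists c, U [set n | u n = c].
Proof.
apply: contrapT => /forallNP nU.
have : U [set n | forall c, u n <> c].
  apply: filter_forall => c; have [Uc|//] := in_ultra_setVsetC [set n | u n = c] UU.
  by case: (nU c).
by move=> /filter_ex[n /= /(_ (u n))].
Qed.

(** Compactness gives a cluster point, and a cluster point along an ultrafilter is a limit. *)
Lemma ultra_limit (R : realType) (u : nat -> R) : (forall n, 0 <= u n <= 1) ->
  exists l : R, forall e : R, 0 < e -> U [set n | `|u n - l| <= e].
Proof.
move=> hu; have := @segment_compact R 0 1 => /(_ (u @ U)).
have uF : ProperFilter (u @ U) by exact: fmap_proper_filter.
case.
  suff -> : (u @ U) `[0, 1]%classic = U setT by exact: filterT.
  by congr U; apply/seteqP; split=> n //= _; rewrite in_itv /= hu.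
move=> l [_ cl]; exists l => e e0.
have [//|nU] := in_ultra_setVsetC [set n | `|u n - l| <= e] UU.
have lb : nbhs (l : R) (ball (l : R) e) by exact: nbhsx_ballx.
have [x [/= xA xB]] := cl [set x | ~ `|x - l| <= e] (ball (l : R) e) nU lb.
by case: xA; rewrite distrC; exact: ltW.
Qed.

End UltraLimits.

(** * Gain of an arbitrary policy against that of aleatoric policies *)

Section Gain.
Variables (R : realType) (A O S : finType).
Hypothesis hA : (0 < #|A|)%N.
Variables (rho : history A O -> A -> O -> R).
Hypothesis hrho : is_environment rho.
Variables (S0 : S) (f : S -> A -> O -> S) (r : S -> A -> O -> R).
Hypothesis hr : forall s a o, 0 <= r s a o <= 1.

Implicit Types (h w : history A O) (pi : history A O -> A -> R).
Local Notation phi := (aleatoric S0 f).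
Local Notation mean := (next_mean rho).
Local Notation Qs m := (optimal_action_value rho S0 f r (1 - m^-1)).
Local Notation Vs m := (optimal_value rho S0 f r m).
Local Notation gain := (gain rho S0 f r).

Lemma gain_bound pi : policies pi -> 0 <= gain pi <= 1.
Proof. by move=> hpi; apply: limn_inf_bound => n; exact: average_reward_bound. Qed.

Lemma sum_mean_rewardE pi n h : policies pi ->
  \sum_(0 <= k < n) mean_reward rho S0 f r pi k h =
  n%:R * average_reward rho S0 f r pi h n.
Proof.
move=> hpi; rewrite average_rewardE //; case: n => [|n].
  by rewrite big_nil mul0r.
by rewrite mulrA mulfV ?mul1r // pnatr_eq0.
Qed.

Lemma optimal_value_ge_averaging pi (t m : R) h : policies pi -> 1 <= m ->
  (forall h n, (0 < n)%N -> `|average_reward rho S0 f r pi h n - gain pi| <= t / n%:R) ->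
  gain pi * m - t <= Vs m h.
Proof.
move=> hpi hm ht; apply: le_trans (discounted_value_le_optimal hA hrho S0 f hr hm h hpi).
apply: discounted_value_lower => //; first by case/andP: (gain_bound hpi).
have t0 : 0 <= t by have := ht [::] 1%N isT; rewrite divr1; apply: le_trans.
case=> [|n]; first by rewrite big_nil mul0r sub0r oppr_le0.
rewrite sum_mean_rewardE //.
have n0 : 0 < n.+1%:R :> R by rewrite ltr0n.
have := ht h n.+1 isT; rewrite ler_norml => /andP[+ _].
rewrite -(ler_pM2l n0) mulrBr mulrN mulrCA mulfV ?mulr1 ?gt_eqF //.
by lra.
Qed.

Section VanishingDiscount.
Variables (t D : R) (hor : nat -> R) (g : nat -> S -> R) (mu : nat -> {ffun S -> A}).
Hypothesis t0 : 0 <= t.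
Hypothesis horE : forall n, hor n = t + 1 + n%:R.
Hypothesis g01 : forall s n, 0 <= g n s <= 1.
Hypothesis Vs_g : forall n h, Vs (hor n) h <= hor n * g n (phi h) + D /\
  hor n * g n (phi h) - D <= Vs (hor n) h.
Hypothesis Vs_greedy : forall n h,
  Vs (hor n) h <= mean h (mu n (phi h)) (fun o => r (phi h) (mu n (phi h)) o +
    (1 - (hor n)^-1) * Vs (hor n) (rcons h (mu n (phi h), o))) + D + D.

Let hor1 n : 1 <= hor n.
Proof. by rewrite horE -addrA addrCA lerDl addr_ge0. Qed.
Let hor0 n : 0 < hor n.
Proof. exact: lt_le_trans ltr01 (hor1 n). Qed.

Let phi0 : phi [::] = S0. Proof. by []. Qed.

Local Opaque optimal_value mean_reward average_reward aleatoric next_mean step_mean.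

(* For a fixed discount factor the greedy aleatoric policy is only known to be
   good over one horizon. As the horizon grows the normalized values become
   functions [gl] of the aleatoric state, the greedy policy is constant along an
   ultrafilter, and [gl] is a submartingale under that policy, which makes it
   good over all times. *)
Lemma gain_le_limit pi (c : R) : policies pi ->
  (forall pi', aleatoric_policies S0 f pi' -> gain pi' <= c) ->
  gain pi <= c + 2 * D.
Proof.
move=> hpi hc.
have [U [UU sU]] := @ultraFilterLemma nat \oo _.
have [m Um] := ultra_const UU mu.
have /choice[gl hgl] : forall s, exists l : R, forall e : R, 0 < e -> U [set n | `|g n s - l| <= e].
  by move=> s; apply: ultra_limit => n; exact: g01.
have good (e : R) K : 0 < e -> exists n,
    [/\ mu n = m, forall s, `|g n s - gl s| <= e & (K <= n)%N].
  move=> e0; have /filter_ex[n [[/= ? ?] ?]] : U ([set n | mu n = m] `&`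
      [set n | forall s, `|g n s - gl s| <= e] `&` [set n | (K <= n)%N]).
    apply: filterI; last by apply: sU; exists K.
    by apply: filterI => //; apply: filter_forall => s; exact: hgl.
  by exists n.
have large x : exists K, forall n, (K <= n)%N -> x <= hor n.
  exists (Num.bound `|x|) => n Kn; rewrite horE.
  have : `|x| < n%:R.
    by apply: lt_le_trans (archi_boundP (normr_ge0 x)) _; rewrite ler_nat.
  by have := ler_norm x; move: t0; lra.
pose nu : history A O -> A -> R := det_policy R (fun h => m (phi h)).
have nuP : policies nu by exact: det_policyP.
have nuA : aleatoric_policies S0 f nu.
  by split=> // h h' hh' a; rewrite /nu /det_policy hh'.
have sub h : gl (phi h) <= mean h (m (phi h)) (fun o => gl (f (phi h) (m (phi h)) o)).
  apply/ler_addgt0Pr => e e0.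
  (* Divided by the horizon, bounded errors vanish. They are the reward, at most 1, the two [D] of
     the greedy inequality, and one [D] for each of two comparisons of [Vs] with [g]. *)
  have [K hK] := large ((1 + 4 * D) / (e / 3)).
  have e3 : 0 < e / 3 by lra.
  have [n [mn gn Kn]] := good (e / 3) K e3.
  have hn : (1 + 4 * D) <= (e / 3) * hor n.
    by have := hK n Kn; rewrite ler_pdivrMr // [leRHS]mulrC.
  have := Vs_greedy n h; rewrite mn => Vn.
  have : Vs (hor n) h <= hor n * (mean h (m (phi h))
      (fun o => gl (f (phi h) (m (phi h)) o)) + e / 3) + 1 + 3 * D.
    apply: (le_trans Vn).
    have -> : forall x, x + 1 + 3 * D = x + (1 + D) + D + D by move=> x; ring.
    rewrite !lerD2r -[X in _ * (_ + X)](next_mean_cst hrho h (m (phi h))) -next_meanD //.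
    rewrite -next_meanZ -[X in _ <= _ + X](next_mean_cst hrho h (m (phi h))) -next_meanD //.
    apply: next_mean_le => // o; have /andP[_ r1] := hr (phi h) (m (phi h)) o.
    set h' := rcons h _; have [Vg _] := Vs_g n h'.
    have /andP[V0 _] := optimal_value_bound hA hrho S0 f hr (hor1 n) h'.
    have : (1 - (hor n)^-1) * Vs (hor n) h' <= Vs (hor n) h'.
      by rewrite ler_piMl // lerBlDr lerDl invr_ge0 ltW.
    have : hor n * g n (phi h') <= hor n * (gl (f (phi h) (m (phi h)) o) + e / 3).
      rewrite ler_pM2l // /h' aleatoric_rcons.
      by have := gn (f (phi h) (m (phi h)) o); rewrite ler_norml; lra.
    by lra.
  have [_ Vg] := Vs_g n h => VU.
  have : hor n * g n (phi h) <= hor n * (mean h (m (phi h))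
      (fun o => gl (f (phi h) (m (phi h)) o)) + e / 3 + e / 3).
    by rewrite [X in _ <= X]mulrDr; move: VU Vg hn; lra.
  rewrite ler_pM2l //; have := gn (phi h); rewrite ler_norml.
  by lra.
(* At a fixed horizon the greedy inequality bounds each mean reward below by the drop of [Vs] plus
   [Vs / hor n], up to [2 * D]. The drops telescope inside [[0, hor n]], [Vs / hor n] is close to
   [gl], and by [sub] the mean of [gl] never falls below its initial value. *)
have low (e : R) n (k : nat) h : 0 < e -> mu n = m -> (forall s, `|g n s - gl s| <= e) ->
    Vs (hor n) h - hor n + k%:R * (gl (phi h) - (2 * D + e + D / hor n)) <=
    \sum_(0 <= i < k) mean_reward rho S0 f r nu i h.
  move=> e0 mn gn; elim: k h => [|k IH] h.
    rewrite big_nil mul0r addr0 subr_le0.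
    by case/andP: (optimal_value_bound hA hrho S0 f hr (hor1 n) h).
  have := discounted_sumS hrho S0 f r nuP 1 k h; rewrite /discounted_sum.
  under eq_bigr do rewrite expr1n mul1r.
  move=> ->; set a := m (phi h); rewrite step_mean_det -/a.
  set c' := 2 * D + e + D / hor n.
  have := Vs_greedy n h; rewrite mn -/a => Vn.
  pose X o := r (phi h) a o + (1 - (hor n)^-1) * Vs (hor n) (rcons h (a, o)).
  pose Y o := (gl (phi (rcons h (a, o))) - e - D / hor n) - hor n
     + k%:R * (gl (phi (rcons h (a, o))) - c').
  apply: (@le_trans _ _ (mean h a (fun o => X o + Y o))); last first.
    apply: next_mean_le => // o; rewrite /X /Y -addrA lerD2l.
    under eq_bigr do rewrite expr1n mul1r.
    rewrite mul1r; set h' := rcons h (a, o); have := IH h'.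
    have [_ Vg] := Vs_g n h'; have := gn (phi h'); rewrite ler_norml => /andP[gn1 _].
    have : gl (phi h') - e - D / hor n <= (hor n)^-1 * Vs (hor n) h'.
      rewrite -(ler_pM2l (hor0 n)) mulrA mulfV ?gt_eqF // mul1r !mulrBr.
      rewrite [_ * (D / _)]mulrCA mulfV ?gt_eqF // mulr1; apply: le_trans Vg.
      rewrite lerD2r -mulrBr ler_pM2l //; lra.
    rewrite -/c'; lra.
  rewrite next_meanD //.
  have YE : mean h a Y = (1 + k%:R) * mean h a (fun o => gl (f (phi h) a o))
     - e - D / hor n - hor n - k%:R * c'.
    have -> : forall x y z w v : R, x - y - z - w - v = x + (- y - z - w - v).
      by move=> *; ring.
    rewrite -next_meanZ -[X in _ = _ + X](next_mean_cst hrho h a).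
    rewrite -next_meanD //; apply: eq_next_mean => o.
    by rewrite /Y aleatoric_rcons; ring.
  have kg : (1 + k%:R) * gl (phi h) <= (1 + k%:R) * mean h a (fun o => gl (f (phi h) a o)).
    by rewrite ler_wpM2l ?addr_ge0 //; exact: sub.
  rewrite YE -natr1; move: Vn kg; rewrite -/X /c'; set MX := mean h a X.
  set MG := mean h a _ => Vn kg; lra.
have up (e : R) : 0 < e -> gain pi <= gl S0 + 3 * e.
  move=> e0.
  have hb n : 0 <= average_reward rho S0 f r pi [::] n <= 1.
    exact: average_reward_bound.
  have [N hN] := limn_inf_near hb e0.
  (* Truncated at 0 because [discounted_value_lower] asks for a nonnegative rate. The time [N]
     before the averages settle costs at most [N]. *)
  pose l := Num.max 0 (gain pi - e).
  have [K hK] := large ((N%:R + D) / e).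
  have [n [mn gn Kn]] := good e K e0.
  have hn : N%:R + D <= e * hor n by have := hK n Kn; rewrite ler_pdivrMr // [leRHS]mulrC.
  have : l * hor n - N%:R <= Vs (hor n) [::].
    apply: le_trans (discounted_value_le_optimal hA hrho S0 f hr (hor1 n) [::] hpi).
    apply: discounted_value_lower => //; first by rewrite le_max lexx.
    move=> k; rewrite sum_mean_rewardE //; have /andP[u0 u1] := hb k.
    have l1 : l <= 1.
      rewrite ge_max ler01 /=; have /andP[_] := gain_bound hpi; lra.
    have [Nk|/ltnW kN] := leqP N k.
      have : l <= average_reward rho S0 f r pi [::] k by rewrite ge_max u0 hN.
      move=> /(ler_wpM2l (ler0n R k)); have := ler0n R N; lra.
    have : k%:R * l <= k%:R * 1 by rewrite ler_wpM2l.
    have : 0 <= k%:R * average_reward rho S0 f r pi [::] k by rewrite mulr_ge0.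
    by move: kN; rewrite -(ler_nat R); lra.
  have [Vg _] := Vs_g n [::] => lV.
  have : hor n * l <= hor n * (g n S0 + e).
    by move: Vg; rewrite phi0; move: lV hn; lra.
  rewrite ler_pM2l //; have := gn S0; rewrite ler_norml.
  have : gain pi - e <= l by rewrite le_max lexx orbT.
  by lra.
apply/ler_addgt0Pr => e' e'0; pose e : R := e'; have e0 : 0 < e by [].
have e6 : 0 < e / 6 by lra.
have := up _ e6; rewrite -/e; suff : gl S0 - 2 * D - 3 * (e / 6) <= c by lra.
apply: le_trans (hc nu nuA); apply: limn_inf_ge => [k|e1 e10].
  exact: average_reward_bound.
have [K hK] := large (D / (e / 6)).
have [n [mn gn Kn]] := good _ K e6.
have hn : D / hor n <= e / 6.
  by have := hK n Kn; rewrite !ler_pdivrMr // [hor n * _]mulrC.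
pose N := Num.bound (hor n / e1).
exists N.+1 => k Nk; have k0 : 0 < k%:R :> R by rewrite ltr0n (leq_trans _ Nk).
have hk : hor n <= e1 * k%:R.
  rewrite mulrC -ler_pdivrMr //; apply: ltW; apply: (lt_trans (archi_boundP _)).
    by rewrite divr_ge0 // ltW.
  by rewrite ltr_nat.
have := low _ n k [::] e6 mn gn; rewrite sum_mean_rewardE // phi0.
have /andP[v0 _] := optimal_value_bound hA hrho S0 f hr (hor1 n) [::].
have : k%:R * (gl S0 - (2 * D + e / 6 + e / 6)) <=
       k%:R * (gl S0 - (2 * D + e / 6 + D / hor n)) by rewrite ler_pM2l //; lra.
have ke : 0 <= k%:R * e by rewrite mulr_ge0 // ltW.
rewrite -[gl S0 - 2 * D - _ - _ <= _](ler_pM2l k0).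
by move: hk v0; lra.
Qed.

End VanishingDiscount.

Section Comparison.
Variables (t D : R).
Hypothesis t0 : 0 <= t.
Hypothesis hD : forall m, t <= m -> 1 <= m -> distortion rho S0 f r m <= D.

Let Qs_close m h h' a : t <= m -> 1 <= m -> phi h = phi h' ->
  Qs m h a <= Qs m h' a + D.
Proof.
move=> tm m1 hh'.
apply: le_trans (optimal_action_value_distortion hA hrho hr a m1 hh') _.
by rewrite lerD2l hD.
Qed.

Let Vs_close m h h' : t <= m -> 1 <= m -> phi h = phi h' -> Vs m h <= Vs m h' + D.
Proof.
move=> tm m1 hh'; apply: sup_range_le => // a; apply: le_trans (Qs_close a tm m1 hh') _.
by rewrite lerD2r; exact: sup_range_ge.
Qed.

(** Unreached states get the default [[::]]; the estimates [Vs_g] and [Vs_greedy] only meet states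
    of the form [phi h]. *)
Let rep (s : S) : history A O := xget [::] [set h | phi h = s].

Let phi_rep h : phi (rep (phi h)) = phi h.
Proof. by rewrite /rep; case: xgetP => [g _ //|/(_ h) /(_ erefl)]. Qed.

Let hor (n : nat) : R := t + 1 + n%:R.
Let hor1 n : 1 <= hor n.
Proof. by rewrite /hor -addrA addrCA lerDl addr_ge0. Qed.
Let hort n : t <= hor n.
Proof. by rewrite /hor -addrA lerDl addr_ge0. Qed.
Let hor0 n : 0 < hor n.
Proof. exact: lt_le_trans ltr01 (hor1 n). Qed.

Let mu n : {ffun S -> A} := [ffun s => argmax hA (Qs (hor n) (rep s))].
Let g n s : R := Vs (hor n) (rep s) / hor n.

Let g01 s n : 0 <= g n s <= 1.
Proof.
have /andP[v0 vm] := optimal_value_bound hA hrho S0 f hr (hor1 n) (rep s).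
rewrite /g; apply/andP; split; first by apply: divr_ge0 => //; exact: ltW.
by rewrite ler_pdivrMr // mul1r.
Qed.

Let Vs_g n h : Vs (hor n) h <= hor n * g n (phi h) + D /\
  hor n * g n (phi h) - D <= Vs (hor n) h.
Proof.
have gE : hor n * g n (phi h) = Vs (hor n) (rep (phi h)).
  by rewrite /g mulrCA mulfV ?mulr1 ?gt_eqF.
rewrite gE; split; first by apply: Vs_close => //; rewrite phi_rep.
by rewrite lerBlDr; apply: Vs_close => //; rewrite phi_rep.
Qed.

(** One [D] is lost in passing from [h] to the representative of its state, where [mu] is greedy,
    and one in coming back. *)
Let Vs_greedy n h :
  Vs (hor n) h <= mean h (mu n (phi h)) (fun o => r (phi h) (mu n (phi h)) o +
    (1 - (hor n)^-1) * Vs (hor n) (rcons h (mu n (phi h), o))) + D + D.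
Proof.
rewrite -bellman // {1}/optimal_value (sup_rangeE hA); set b := argmax _ _.
have bm := argmaxP hA (Qs (hor n) (rep (phi h))) b.
apply: le_trans (Qs_close b (hort n) (hor1 n) (esym (phi_rep h))) _.
rewrite lerD2r; apply: le_trans bm _.
have := Qs_close (mu n (phi h)) (hort n) (hor1 n) (phi_rep h).
by apply: le_trans; rewrite /mu ffunE.
Qed.

Lemma gain_le_aleatoric pi (c : R) : policies pi ->
  (forall pi', aleatoric_policies S0 f pi' -> gain pi' <= c) ->
  gain pi <= c + 2 * D.
Proof. exact: (gain_le_limit t0 (fun n => erefl (hor n)) g01 Vs_g Vs_greedy). Qed.

End Comparison.
End Gain.

(** * Change points and learning rates *)

Lemma change_pointS k : (0 < k)%N -> change_point k.+1 = (2 * change_point k)%N.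
Proof. by case: k => // k _; rewrite /change_point expnS mulnCA. Qed.

Lemma change_point_gt0 k : (0 < change_point k)%N.
Proof. by case: k => // k; rewrite /change_point muln_gt0 expn_gt0. Qed.

Lemma change_point_double k : (2 * change_point k <= change_point k.+1)%N.
Proof. by case: k => [//|k]; rewrite (@change_pointS k.+1). Qed.

Lemma change_point_ltS k : (change_point k < change_point k.+1)%N.
Proof. by have := change_point_double k; have := change_point_gt0 k; lia. Qed.

Lemma change_point_ltn j k : (j < k)%N -> (change_point j < change_point k)%N.
Proof.
elim: k => // k IH; rewrite ltnS leq_eqVlt => /predU1P[->|/IH jk].
  exact: change_point_ltS.
exact: ltn_trans jk (change_point_ltS k).
Qed.

Lemma change_point_leq j k : (j <= k)%N -> (change_point j <= change_point k)%N.
Proof. by rewrite leq_eqVlt => /predU1P[->//|/change_point_ltn/ltnW]. Qed.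

Lemma change_point_exp k : (2 ^ k <= change_point k)%N.
Proof.
elim: k => // k IH; apply: leq_trans (change_point_double k).
by rewrite expnS leq_mul2l.
Qed.

Lemma leq_change_point k : (k <= change_point k)%N.
Proof. by apply: leq_trans (change_point_exp k); rewrite ltnW // ltn_expl. Qed.

Lemma phase_unique k t : (change_point k <= t < change_point k.+1)%N -> phase t = k.
Proof.
move=> /andP[kt tk]; apply/eqP; rewrite eqn_leq; apply/andP; split.
  apply/bigmax_leqP => j jt; rewrite -ltnS; apply: contraTT tk; rewrite -!leqNgt => kj.
  exact: leq_trans (change_point_leq kj) jt.
have kt1 : (k < t.+1)%N by rewrite ltnS (leq_trans (leq_change_point k)).
exact: (@leq_bigmax_cond _ (fun j : 'I_t.+1 => change_point j <= t)%N val (Ordinal kt1)).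
Qed.

Lemma phaseP t : (0 < t)%N ->
  (change_point (phase t) <= t < change_point (phase t).+1)%N.
Proof.
move=> t0; suff [k kt] : exists k, (change_point k <= t < change_point k.+1)%N.
  by rewrite (phase_unique kt).
elim: t t0 => // -[_ _|t /(_ isT)[k /andP[kt tk]] _]; first by exists 0%N.
have [t1|t1] := ltnP t.+2 (change_point k.+1).
  by exists k; rewrite t1 (leq_trans kt).
by exists k.+1; rewrite t1 (leq_ltn_trans _ (change_point_ltS k.+1)).
Qed.

Lemma phase0 : phase 0 = 0%N.
Proof.
apply/eqP; rewrite -leqn0; apply/bigmax_leqP => j.
by rewrite leqNgt change_point_gt0.
Qed.

Lemma phase1 : phase 1 = 0%N.
Proof. exact: phase_unique. Qed.

Variant phase_spec (t : nat) : nat -> bool -> Type :=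
| PhaseSame of (t.+1 < change_point (phase t).+1)%N : phase_spec t (phase t) true
| PhaseNext of t.+1 = change_point (phase t).+1 : phase_spec t (phase t).+1 false.

Lemma phaseSP t : (0 < t)%N ->
  phase_spec t (phase t.+1) (change_point (phase t.+1) == change_point (phase t)).
Proof.
move=> t0; have /andP[kt tk] := phaseP t0.
have [t1|t1] := ltnP t.+1 (change_point (phase t).+1).
  have -> : phase t.+1 = phase t by apply: phase_unique; rewrite t1 (leq_trans kt).
  by rewrite eqxx; constructor.
have e : t.+1 = change_point (phase t).+1 by apply/eqP; rewrite eqn_leq tk t1.
have -> : phase t.+1 = (phase t).+1.
  by apply: phase_unique; rewrite t1 /= e change_point_ltS.
by rewrite gtn_eqF ?change_point_ltS //; constructor.
Qed.

(** * Horizon, boost and learning rate of a phase *)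

Section Schedule.
Variable R : realType.

(** Since [exp (- x / 4) >= 1 - x / 4], it suffices that [1 <= (1 + x + x^2) * (1 - x / 4)^4], a
    polynomial inequality. *)
Lemma expR_le_quadratic (x : R) : `|x| <= 1 / 2 -> expR x <= 1 + x + x ^+ 2.
Proof.
rewrite ler_norml => /andP[x1 x2].
have -> : expR x = expR (x / 4) ^+ 4.
  by rewrite -expRM_natl; congr expR; field.
have e1 : expR (x / 4) * (1 - x / 4) <= 1.
  rewrite -[leRHS](expRxMexpNx_1 (x / 4)) ler_pM2l ?expR_gt0 //.
  exact: expR_ge1Dx.
have p1 : 0 < 1 - x / 4 by lra.
have e4 : expR (x / 4) ^+ 4 * (1 - x / 4) ^+ 4 <= 1.
  by rewrite -exprMn exprn_ile1 // mulr_ge0 ?expR_ge0 // ltW.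
rewrite -(ler_pM2r (exprn_gt0 4 p1)); apply: le_trans e4 _.
have -> : (1 + x + x ^+ 2) * (1 - x / 4) ^+ 4 =
  1 + x ^+ 2 * (96 - 176 * x + 81 * x ^+ 2 - 15 * x ^+ 3 + x ^+ 4) / 256 by field.
rewrite lerDl divr_ge0 // mulr_ge0 ?sqr_ge0 //.
have : 0 <= x ^+ 2 by exact: sqr_ge0.
have : 0 <= x ^+ 2 * (15 * (1 / 2 - x)).
  by rewrite mulr_ge0 ?sqr_ge0 // mulr_ge0 //; lra.
have : 0 <= x ^+ 4 by rewrite exprn_even_ge0.
have -> : x ^+ 3 = x ^+ 2 * x by ring.
by lra.
Qed.

Lemma ln2_ge : 1 / 2 <= ln 2 :> R.
Proof.
rewrite -ler_expR lnK ?posrE //; apply: le_trans (expR_le_quadratic _) _.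
  by rewrite ger0_norm //; lra.
by lra.
Qed.

(* [hz k], [bo k] and [rate k n] are the algorithm's tau, beta and alpha in phase
   [k], and [lg k] is the logarithm in beta. *)
Definition hz (k : nat) : R := (change_point k)%:R `^ (1 / 5).
Definition lg (k : nat) : R := ln (2 * (change_point k)%:R ^+ 2).
Definition bo (k : nat) : R :=
  4 * (change_point k)%:R `^ (3 / 10) * Num.sqrt (lg k).

Lemma hz5 k : hz k ^+ 5 = (change_point k)%:R.
Proof.
by rewrite -powR_mulrn ?powR_ge0 // /hz -powRrM div1r mulVf // powRr1.
Qed.

Lemma hz_ge1 k : 1 <= hz k.
Proof.
rewrite -(powRr0 (change_point k)%:R) /hz; apply: ler_powR; last by lra.
by rewrite ler1n change_point_gt0.
Qed.

Lemma hz_gt0 k : 0 < hz k.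
Proof. exact: lt_le_trans ltr01 (hz_ge1 k). Qed.

Lemma hz_ge0 k : 0 <= hz k.
Proof. exact: ltW (hz_gt0 k). Qed.

(** Horizons are fifth roots of change points, which at least double, and [(8 / 7)^5 <= 2]. *)
Lemma hz_leS k : 8 / 7 * hz k <= hz k.+1.
Proof.
rewrite -(@ler_pXn2r _ 5) ?nnegrE ?mulr_ge0 ?hz_ge0 //.
rewrite exprMn !hz5; apply: (@le_trans _ _ (2 * (change_point k)%:R)).
  by rewrite ler_wpM2r //; lra.
by rewrite -natrM ler_nat change_point_double.
Qed.

Lemma hz_le j k : (j <= k)%N -> hz j <= hz k.
Proof.
move=> jk; rewrite -(@ler_pXn2r _ 5) ?nnegrE ?hz_ge0 //.
by rewrite !hz5 ler_nat change_point_leq.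
Qed.

Lemma hz_le_change_point k : hz k <= (change_point k)%:R.
Proof. by rewrite -hz5 exprS ler_peMr ?hz_ge0 // exprn_ege1 ?hz_ge1. Qed.

Lemma lg_ge k : 1 / 2 <= lg k.
Proof.
apply: le_trans ln2_ge _; rewrite ler_ln ?posrE ?mulr_gt0 ?exprn_gt0 ?ltr0n ?change_point_gt0 //.
by rewrite ler_peMr // exprn_ege1 // ler1n change_point_gt0.
Qed.

Lemma lg_le k (t : nat) : (change_point k <= t)%N -> lg k <= ln (2 * t%:R ^+ 2).
Proof.
move=> kt; have c0 := change_point_gt0 k; have t0 := leq_trans c0 kt.
rewrite ler_ln ?posrE ?mulr_gt0 ?exprn_gt0 ?ltr0n //.
by rewrite ler_pM2l // lerXn2r ?nnegrE ?ler0n ?ler_nat.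
Qed.

Lemma bo_sqr k : bo k ^+ 2 = 16 * hz k ^+ 3 * lg k.
Proof.
rewrite /bo !exprMn sqr_sqrtr; last by apply: le_trans (lg_ge k); lra.
congr (_ * _ * _); first by ring.
rewrite /hz; move: (change_point k)%:R => x.
rewrite -(powR_mulrn 2 (powR_ge0 x _)) -(powR_mulrn 3 (powR_ge0 x _)) -!powRrM.
by congr powR; lra.
Qed.

Lemma bo_gt0 k : 0 < bo k.
Proof.
rewrite /bo !mulr_gt0 ?powR_gt0 ?ltr0n ?change_point_gt0 // sqrtr_gt0.
by apply: lt_le_trans (lg_ge k); lra.
Qed.

Lemma bo_ge0 k : 0 <= bo k.
Proof. exact: ltW (bo_gt0 k). Qed.

Definition rate (k n : nat) : R := (1 + 2 * hz k) / (n%:R + 2 * hz k).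

Lemma rate1 k : rate k 1 = 1.
Proof. by rewrite /rate divff // gt_eqF // ltr_wpDl // mulr_gt0 // hz_gt0. Qed.

Lemma rate_gt0 k n : 0 < rate k n.
Proof.
have h0 := hz_gt0 k; rewrite divr_gt0 //; first lra.
by rewrite ltr_wpDl // mulr_gt0.
Qed.

Lemma rate_ge0 k n : 0 <= rate k n.
Proof. exact: ltW (rate_gt0 k n). Qed.

Lemma rate_le1 k n : (0 < n)%N -> rate k n <= 1.
Proof.
move=> n0; have h0 := hz_gt0 k.
rewrite /rate ler_pdivrMr; last by rewrite ltr_wpDl // mulr_gt0.
by rewrite mul1r lerD2r ler1n.
Qed.

Lemma rateM k n : n%:R * rate k n <= 1 + 2 * hz k.
Proof.
have h0 := hz_gt0 k; rewrite mulrA ler_pdivrMr; last by rewrite ltr_wpDl // mulr_gt0.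
by rewrite mulrC ler_wpM2l; nra.
Qed.

Lemma rate_mono k n : (0 < n)%N -> (1 - rate k n.+1) * rate k n <= rate k n.+1.
Proof.
move=> n0; have h0 := hz_gt0 k; rewrite /rate -[n.+1%:R]natr1.
have n1 : 0 < n%:R :> R by rewrite ltr0n.
have d1 : 0 < n%:R + 2 * hz k by lra.
have d2 : 0 < n%:R + 1 + 2 * hz k by lra.
have -> : 1 - (1 + 2 * hz k) / (n%:R + 1 + 2 * hz k) = n%:R / (n%:R + 1 + 2 * hz k).
  by field; rewrite gt_eqF.
have -> : forall a b c d : R, a * b * (c * d) = c * b * (a * d) by move=> *; ring.
rewrite ler_piMr ?divr_ge0 //; try lra.
by rewrite ler_pdivrMr // mul1r; lra.
Qed.

(* One update lowers a table entry by at most [rate k n * hz k], hence by less than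
   the boost. *)
Lemma rate_drop k n : (0 < n)%N -> rate k n * hz k <= bo k / Num.sqrt n%:R.
Proof.
move=> n0; have n1 : 0 < n%:R :> R by rewrite ltr0n.
have h0 := hz_gt0 k; have h1 := hz_ge1 k.
have s0 : 0 < Num.sqrt n%:R :> R by rewrite sqrtr_gt0.
have nn : 0 <= rate k n * hz k * Num.sqrt n%:R.
  exact: mulr_ge0 (mulr_ge0 (rate_ge0 k n) (hz_ge0 k)) (sqrtr_ge0 _).
rewrite ler_pdivlMr // -(@ler_pXn2r _ 2) ?nnegrE ?nn ?bo_ge0 //.
have -> : (rate k n * hz k * Num.sqrt n%:R) ^+ 2 = rate k n ^+ 2 * hz k ^+ 2 * n%:R.
  by rewrite !exprMn sqr_sqrtr ?ler0n.
rewrite bo_sqr /rate expr_div_n.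
have d0 : 0 < n%:R + 2 * hz k by lra.
have -> : forall a b c d : R, a / b * c * d = a * d * c / b by move=> *; ring.
rewrite ler_pdivrMr ?exprn_gt0 //.
have hh : (1 + 2 * hz k) ^+ 2 <= 9 * hz k ^+ 2 by nra.
have dd : 8 * (hz k * n%:R) <= (n%:R + 2 * hz k) ^+ 2.
  have : 0 <= (n%:R - 2 * hz k) ^+ 2 by exact: sqr_ge0.
  by lra.
have l1 := lg_ge k.
apply: (@le_trans _ _ (9 * hz k ^+ 2 * n%:R * hz k ^+ 2)).
  by rewrite ler_wpM2r ?exprn_ge0 ?hz_ge0 // ler_wpM2r // ltW.
apply: (@le_trans _ _ (16 * hz k ^+ 3 * (1 / 2) * (8 * (hz k * n%:R)))).
  have -> : 16 * hz k ^+ 3 * (1 / 2) * (8 * (hz k * n%:R)) =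
    64 * (hz k ^+ 2 * n%:R * hz k ^+ 2) by field.
  have -> : 9 * hz k ^+ 2 * n%:R * hz k ^+ 2 = 9 * (hz k ^+ 2 * n%:R * hz k ^+ 2) by ring.
  have : 0 <= hz k ^+ 2 * n%:R * hz k ^+ 2 by rewrite !mulr_ge0 ?exprn_ge0 ?hz_ge0.
  by lra.
apply: ler_pM => //; rewrite ?mulr_ge0 ?exprn_ge0 ?hz_ge0 ?ler0n //; try lra.
by rewrite ler_wpM2l // mulr_ge0 ?exprn_ge0 ?hz_ge0.
Qed.

End Schedule.

(** * The run of the algorithm *)

Section PathSums.
Variables (R : realType) (A O : finType).
Implicit Types (h : history A O) (G : history A O -> A -> O -> R).

(** Recursion runs on the reversed history because each summand is evaluated at the prefix that
    precedes the step. *)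
Fixpoint path_sum_rev G (l : history A O) : R :=
  if l is x :: l' then path_sum_rev G l' + G (rev l') x.1 x.2 else 0.

Definition path_sum G h : R := path_sum_rev G (rev h).

Lemma path_sum_nil G : path_sum G [::] = 0.
Proof. by []. Qed.

Lemma path_sum_rcons G h a o : path_sum G (rcons h (a, o)) = path_sum G h + G h a o.
Proof. by rewrite /path_sum rev_rcons /= revK. Qed.

Lemma path_sum_ge0 G h : (forall h a o, 0 <= G h a o) -> 0 <= path_sum G h.
Proof.
move=> G0; elim/last_ind: h => [|h [a o] IH]; first by rewrite path_sum_nil.
by rewrite path_sum_rcons addr_ge0.
Qed.

Lemma path_sum_cat_rewards (S : finType) (S0 : S) f (r : S -> A -> O -> R) h w :
  path_sum (fun h => r (aleatoric S0 f h)) (h ++ w) =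
  path_sum (fun h => r (aleatoric S0 f h)) h +
  \sum_(0 <= t < size w) (rewards S0 f r h w)`_t.
Proof.
elim: w h => [|[a o] w IH] h; first by rewrite cats0 big_nil addr0.
rewrite -cat_rcons IH path_sum_rcons -addrA; congr (_ + _).
by rewrite [RHS]big_nat_recl.
Qed.

End PathSums.

(** * Tables and counts along a history *)

Section QState.
Variables (R : realType) (A O S : finType).
Variables (S0 : S) (f : S -> A -> O -> S) (r : S -> A -> O -> R).
Implicit Types h : history A O.
Local Notation phi := (aleatoric S0 f).

(** [qrun h] is the state left by the last update, [qnow h] the one in which the next action is
    sampled; their tables and counts can differ only at a change point. *)
Definition qnow h := refresh (qrun S0 f r h).
(** The loop counter is one more than the number of past interactions. *)
Definition kphase h := phase (size h).+1.

Lemma qrun_rcons h a o : qrun S0 f r (rcons h (a, o)) = learn f r (qnow h) (a, o).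
Proof. by rewrite /qrun foldl_rcons. Qed.

Lemma clock_qrun h : clock (qrun S0 f r h) = (size h).+1.
Proof.
elim/last_ind: h => [//|h [a o] IH].
by rewrite qrun_rcons size_rcons /= IH.
Qed.

Lemma current_qrun h : current (qrun S0 f r h) = phi h.
Proof.
elim/last_ind: h => [//|h [a o] IH].
by rewrite qrun_rcons aleatoric_rcons /= IH.
Qed.

Lemma current_qnow h : current (qnow h) = phi h.
Proof. exact: current_qrun. Qed.

Lemma kphase_le h : (change_point (kphase h) <= (size h).+1)%N.
Proof. by case/andP: (phaseP (ltn0Sn (size h))). Qed.

Lemma kphase_gt h : ((size h).+1 < change_point (kphase h).+1)%N.
Proof. by case/andP: (phaseP (ltn0Sn (size h))). Qed.

Lemma kphase0 : kphase [::] = 0%N.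
Proof. exact: phase1. Qed.

Lemma kphase_rcons h x : kphase (rcons h x) = kphase h \/
  kphase (rcons h x) = (kphase h).+1 /\ (size h).+2 = change_point (kphase h).+1.
Proof.
rewrite /kphase size_rcons; case: phaseSP => // [?|e]; first by left.
by right.
Qed.

Lemma qtable_qnow_rcons h x s a :
  qtable (qnow (rcons h x)) s a = qtable (qrun S0 f r (rcons h x)) s a +
    (hz R (kphase (rcons h x)) - hz R (kphase h)).
Proof. by rewrite /qnow /= clock_qrun /kphase size_rcons. Qed.

Lemma counts_qnow_rcons h x s a : kphase (rcons h x) = kphase h ->
  counts (qnow (rcons h x)) s a = counts (qrun S0 f r (rcons h x)) s a.
Proof.
move=> e; rewrite /qnow /= clock_qrun size_rcons /=.
by move: e; rewrite /kphase size_rcons => ->; rewrite eqxx muln1.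
Qed.

Lemma counts_qnow_change h x s a : kphase (rcons h x) = (kphase h).+1 ->
  counts (qnow (rcons h x)) s a = 0%N.
Proof.
move=> e; rewrite /qnow /= clock_qrun size_rcons /=.
move: e; rewrite /kphase size_rcons => ->.
by rewrite gtn_eqF ?muln0 // change_point_ltS.
Qed.

Lemma qtable_qnow0 s a : qtable (qnow [::]) s a = 1.
Proof. by rewrite /qnow /= /horizon /phase_start phase0 phase1 subrr addr0. Qed.

Definition ncount h (s : S) (a : A) : nat := counts (qnow h) s a.

Lemma counts_qrun_rcons h a o x b :
  counts (qrun S0 f r (rcons h (a, o))) x b =
  if (x == phi h) && (b == a) then (ncount h (phi h) a).+1 else ncount h x b.
Proof. by rewrite qrun_rcons /= current_qrun. Qed.

Lemma ncount_same h a o x b : kphase (rcons h (a, o)) = kphase h ->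
  ncount (rcons h (a, o)) x b =
  if (x == phi h) && (b == a) then (ncount h (phi h) a).+1 else ncount h x b.
Proof. by move=> e; rewrite /ncount counts_qnow_rcons // counts_qrun_rcons. Qed.

Lemma ncount_change h x s a : kphase (rcons h x) = (kphase h).+1 ->
  ncount (rcons h x) s a = 0%N.
Proof. exact: counts_qnow_change. Qed.

Lemma sum_counts_qrun h a o :
  (\sum_x \sum_b counts (qrun S0 f r (rcons h (a, o))) x b =
   (\sum_x \sum_b ncount h x b).+1)%N.
Proof.
under eq_bigr do under eq_bigr do rewrite counts_qrun_rcons.
rewrite (bigD1 (phi h)) //= (bigD1 a) //= !eqxx /=.
rewrite [in RHS](bigD1 (phi h)) //= [in RHS](bigD1 a) //= -!addSn.
congr (_ + _ + _)%N.
  by apply: eq_bigr => b /negPf ->.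
by apply: eq_bigr => x /negPf ->.
Qed.

Lemma sum_ncount h :
  (\sum_x \sum_b ncount h x b + change_point (kphase h) = (size h).+1)%N.
Proof.
elim/last_ind: h => [|h [a o] IH].
  by rewrite kphase0 big1 // => x _; rewrite big1.
have [e|[e sz]] := kphase_rcons h (a, o).
  rewrite e size_rcons -IH -addSn -(sum_counts_qrun h a o); congr (_ + _)%N.
  by apply: eq_bigr => x _; apply: eq_bigr => b _; rewrite -counts_qnow_rcons.
rewrite e size_rcons big1 ?sz // => x _; rewrite big1 // => b _.
exact: ncount_change.
Qed.

Lemma ncount_le h s a : (0 < kphase h)%N -> (ncount h s a < change_point (kphase h))%N.
Proof.
move=> k0; have := sum_ncount h; have := kphase_gt h; rewrite change_pointS //.
have : (ncount h s a <= \sum_x \sum_b ncount h x b)%N.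
  by rewrite (bigD1 s) //= (bigD1 a) //= -addnA leq_addr.
by lia.
Qed.

Definition qval h := qtable (qnow h).
Definition qmax h (s : S) : R := sup (range (qval h s)).

(** With this target the update rule reads as a convex combination of the old entry and the target,
    followed by clipping. *)
Definition qtarget h (a : A) (o : O) : R :=
  r (phi h) a o + (1 - (hz R (kphase h))^-1) * qmax h (phi (rcons h (a, o)))
  + bo R (kphase h) / Num.sqrt (ncount h (phi h) a).+1%:R.

Lemma qtable_qrun_rcons h a o x b :
  qtable (qrun S0 f r (rcons h (a, o))) x b =
  if (x == phi h) && (b == a) then
    let al := rate R (kphase h) (ncount h (phi h) a).+1 in
    Num.min ((1 - al) * qval h (phi h) a + al * qtarget h a o) (hz R (kphase h))
  else qval h x b.
Proof.
have E (q al y B : R) : q + al * (y - q + B) = (1 - al) * q + al * (y + B) by ring.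
rewrite qrun_rcons [learn _ _ _ _]/= /qtarget aleatoric_rcons /=.
rewrite !clock_qrun !current_qrun; case: ifP => _; last first.
  by rewrite /qval /qnow /= clock_qrun.
rewrite /qval /ncount /qmax /qval /rate /qnow /= clock_qrun.
by congr Num.min; exact: E.
Qed.

End QState.

(** * Concentration of the noise *)

Section Weights.
Variables (R : realType) (k n : nat).

(* The weight left at count [n] to the value that an entry has at count [i]. *)
Definition weight (i : nat) : R := \prod_(i <= j < n) (1 - rate R k j.+1).

Lemma weight_last : weight n = 1.
Proof. by rewrite /weight big_geq. Qed.

Lemma weight_step i : (i < n)%N -> weight i = (1 - rate R k i.+1) * weight i.+1.
Proof. by move=> ni; rewrite /weight big_ltn. Qed.

Lemma weight_first : (0 < n)%N -> weight 0 = 0.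
Proof. by move=> n0; rewrite weight_step // rate1 subrr mul0r. Qed.

Lemma weight_bound i : 0 <= weight i <= 1.
Proof.
rewrite /weight; apply: (big_ind (fun x : R => 0 <= x <= 1)).
- by rewrite ler01 lexx.
- by move=> x y /andP[x0 x1] /andP[y0 y1]; rewrite mulr_ge0 // mulr_ile1.
- by move=> j _; have := rate_gt0 R k j.+1; have := rate_le1 R k (ltn0Sn j); lra.
Qed.

(** The left side is the share that the sample received at count [i.+1] keeps at count [n]. By
    [rate_mono] older samples never have a larger share, so the newest one has the largest. *)
Lemma weight_rate i : (i < n)%N -> weight i.+1 * rate R k i.+1 <= rate R k n.
Proof.
move=> ni; have [d] : exists d, (i.+1 + d = n)%N by exists (n - i.+1)%N; rewrite subnKC.
elim: d i {ni} => [|d IH] i e; first by rewrite -e addn0 -{1}(addn0 i.+1) e weight_last mul1r.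
have ni : (i.+1 < n)%N by rewrite -e addnS ltnS leq_addr.
rewrite weight_step // mulrAC; apply: le_trans (IH i.+1 _); last by rewrite addSnnS.
rewrite [leRHS]mulrC ler_wpM2r ?rate_mono //; by case/andP: (weight_bound i.+2).
Qed.

End Weights.

Section ExponentialMoment.
Variables (R : realType) (A O : finType).
Variables (rho : history A O -> A -> O -> R).
Hypothesis hrho : is_environment rho.
Local Notation mean := (next_mean rho).

(** A crude form of Hoeffding's lemma: in the mean of [1 + x + x^2] the linear term vanishes. *)
Lemma next_mean_expR h a (X : O -> R) (u c : R) :
  mean h a X = 0 -> (forall o, `|X o| <= c) -> `|u| * c <= 1 / 2 ->
  mean h a (fun o => expR (u * X o)) <= expR ((u * c) ^+ 2).
Proof.
move=> X0 Xc uc; apply: le_trans (expR_ge1Dx _).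
have -> : 1 + (u * c) ^+ 2 = mean h a (fun o => (1 + (u * c) ^+ 2) + u * X o).
  by rewrite next_meanD next_mean_cst // next_meanZ X0 mulr0 addr0.
apply: next_mean_le => // o.
have uX : `|u * X o| <= `|u| * c by rewrite normrM ler_wpM2l.
apply: le_trans (expR_le_quadratic (le_trans uX uc)) _.
rewrite addrAC lerD2r lerD2l -(real_normK (num_real (u * X o))).
rewrite -(real_normK (num_real (u * c))) lerXn2r ?nnegrE ?normr_ge0 //.
by apply: (le_trans uX); rewrite normrM ler_wpM2l // ler_norm.
Qed.

(* One step of the clipped noise process [M], with [W] the weight that its new
   value will have at the count under consideration and [b] the bonus there.
   Clipping costs at most [expR (- L)]. *)
Lemma clipped_noise_step h a (X : O -> R) (c W al an b bj th L M : R) :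
  mean h a X = 0 -> (forall o, `|X o| <= c) -> 0 < c -> 0 <= W <= 1 ->
  0 <= al -> W * al <= an -> 0 < an -> 0 < b -> b <= c -> b <= bj ->
  th = b / (2 * c ^+ 2 * an) -> L = b ^+ 2 / (4 * c ^+ 2 * an) ->
  mean h a (fun o => expR (- (W * th * Num.min c ((1 - al) * M + al * (X o + bj))
                              + (1 - W) * L))) <=
  expR (- ((1 - al) * W * th * M + (1 - (1 - al) * W) * L)) + expR (- L).
Proof.
move=> X0 Xc c0 /andP[W0 W1] al0 Wal an0 b0 bc bbj thE LE.
have cn : c != 0 by rewrite gt_eqF.
have ann : an != 0 by rewrite gt_eqF.
have th0 : 0 < th by rewrite thE divr_gt0 // !mulr_gt0 ?exprn_gt0.
have L0 : 0 < L by rewrite LE divr_gt0 ?exprn_gt0 // !mulr_gt0 ?exprn_gt0.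
have thb : th * b = 2 * L by rewrite thE LE; field; rewrite cn ann.
have thc : th * c * an = b / c / 2 by rewrite thE; field; rewrite cn ann.
have bc1 : b / c <= 1 by rewrite ler_pdivrMr // mul1r.
have thL : L <= th * c.
  have : th * b <= th * c by rewrite ler_wpM2l // ltW.
  by rewrite thb; lra.
have Lan : L = th ^+ 2 * c ^+ 2 * an by rewrite thE LE; field; rewrite cn ann.
set E := expR (- ((1 - al) * W * th * M + (1 - (1 - al) * W) * L)).
(* If the clipping is active, [L <= th * c] makes the exponent at least [L]. Otherwise the bonus
   contributes [W * al * (th * b)], that is [2 * (W * al * L)]: one half moves the interpolation
   towards [L], the other pays for the quadratic term of the exponential moment. *)
have key o : expR (- (W * th * Num.min c ((1 - al) * M + al * (X o + bj)) + (1 - W) * L))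
    <= E * expR (- (W * al * L)) * expR (- (W * th * al) * X o) + expR (- L).
  have pos x : 0 <= expR x :> R by exact: expR_ge0.
  rewrite /Num.min; case: ifP => _.
    apply: (@le_trans _ _ (expR (- L))); last first.
      by rewrite lerDr; exact: mulr_ge0 (mulr_ge0 (pos _) (pos _)) (pos _).
    rewrite ler_expR lerN2.
    have : W * L <= W * (th * c) by rewrite ler_wpM2l.
    by lra.
  apply: (@le_trans _ _ (E * expR (- (W * al * L)) * expR (- (W * th * al) * X o)));
    last by rewrite lerDl pos.
  rewrite /E -!expRD ler_expR.
  have : W * al * (th * b) <= W * al * (th * bj).
    by rewrite ler_wpM2l ?mulr_ge0 // ler_wpM2l // ltW.
  by rewrite thb; lra.
apply: le_trans (next_mean_le hrho h a key) _.
rewrite next_meanD next_mean_cst // lerD2r next_meanZ -[leRHS]mulr1 -mulrA.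
rewrite ler_wpM2l ?expR_ge0 // -(expRxMexpNx_1 (W * al * L)) mulrC ler_wpM2r ?expR_ge0 //.
have Wt : W * th * al * c <= th * c * an.
  have -> : W * th * al * c = (th * c) * (W * al) by ring.
  by rewrite ler_wpM2l // mulr_ge0 // ltW.
apply: (@le_trans _ _ (expR ((- (W * th * al) * c) ^+ 2))).
  apply: next_mean_expR => //; rewrite normrN ger0_norm; last first.
    by rewrite !mulr_ge0 // ltW.
  by apply: (le_trans Wt); rewrite thc; lra.
rewrite ler_expR Lan.
have -> : (- (W * th * al) * c) ^+ 2 = (th ^+ 2 * c ^+ 2 * (W * al)) * (W * al) by ring.
have -> : W * al * (th ^+ 2 * c ^+ 2 * an) = (th ^+ 2 * c ^+ 2 * (W * al)) * an by ring.
by rewrite ler_wpM2l // !mulr_ge0 ?exprn_ge0 // ltW.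
Qed.

End ExponentialMoment.

(** * The clipped noise process and the cost of its failures *)

Section Noise.
Variables (R : realType) (A O S : finType).
Hypothesis hA : (0 < #|A|)%N.
Variables (rho : history A O -> A -> O -> R).
Hypothesis hrho : is_environment rho.
Variables (S0 : S) (f : S -> A -> O -> S) (r : S -> A -> O -> R).
Hypothesis hr : forall s a o, 0 <= r s a o <= 1.
Variables (lam t : R).
Hypothesis lam01 : 0 <= lam <= 1.
Hypothesis t0 : 0 <= t.

Implicit Types (h w : history A O) (pi : history A O -> A -> R).
Local Notation phi := (aleatoric S0 f).
Local Notation mean := (next_mean rho).
Local Notation Vs := (optimal_value rho S0 f r).
Local Notation hz := (hz R).
Local Notation bo := (bo R).
Local Notation rate := (rate R).
Local Notation kphase := (@kphase A O).
Local Notation ncount := (ncount S0 f r).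

Hypothesis hV : forall m h, t <= m -> 1 <= m -> lam * m - t <= Vs m h.

Definition sa : R := #|S|%:R * #|A|%:R.
(** In such phases [t <= hz k / 2], so that [hV] applies at half the horizon, and
    [16 * sa <= hz k ^+ 2], which absorbs the union bound over the entries of the table. *)
Definition active (k : nat) : bool := 2 * t + 4 * Num.sqrt sa <= hz k.
(* The first bound is on the size of one noise term, the second is the room between
   the clipping level [hz k] and the value that the table is compared with. *)
Definition cap (k : nat) : R :=
  Num.min ((hz k + 1) / 2) (1 + (1 - lam) * hz k / 2 + t).

Lemma sa_ge1 : 1 <= sa.
Proof.
have S1 : (0 < #|S|)%N by apply/card_gt0P; exists S0.
by rewrite /sa -natrM ler1n muln_gt0 S1.
Qed.

Lemma sqrt_sa_ge1 : 1 <= Num.sqrt sa.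
Proof. by rewrite -(sqrtr1 R) ler_wsqrtr // sa_ge1. Qed.

Lemma active_bound k : active k -> [/\ 4 <= hz k, t <= hz k / 2 & 16 * sa <= hz k ^+ 2].
Proof.
rewrite /active => ak; have s1 := sqrt_sa_ge1; split.
- by move: ak t0; lra.
- by move: ak t0; lra.
- have -> : 16 * sa = (4 * Num.sqrt sa) ^+ 2.
    rewrite exprMn sqr_sqrtr ?(le_trans ler01 sa_ge1) //; ring.
  rewrite lerXn2r ?nnegrE ?hz_ge0 ?mulr_ge0 ?sqrtr_ge0 //.
  by move: ak t0; lra.
Qed.

Lemma active_gt0 k : active k -> (0 < k)%N.
Proof.
case: k => // /active_bound[+ _ _].
have := hz_le_change_point R 0; rewrite /change_point; lra.
Qed.

Lemma cap_gt0 k : 0 < cap k.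
Proof.
rewrite /cap lt_min; have h0 := hz_gt0 R k; apply/andP; split; first lra.
have : 0 <= (1 - lam) * hz k by rewrite mulr_ge0 ?(ltW h0) //; move: lam01; lra.
by move: t0; lra.
Qed.

(** The target without its bonus, the maximum of the table being replaced by the optimal value at
    half the horizon; the discount factor remains that of the algorithm. *)
Let sample h a o : R :=
  r (phi h) a o + (1 - (hz (kphase h))^-1) * Vs (hz (kphase h) / 2) (rcons h (a, o)).

Definition noise_step h a o : R := sample h a o - mean h a (sample h a).

Lemma noise_step_mean h a : mean h a (noise_step h a) = 0.
Proof.
have -> : mean h a (noise_step h a) =
    mean h a (fun o => sample h a o + - mean h a (sample h a)) by [].
by rewrite next_meanD next_mean_cst // subrr.
Qed.

(** A variable is within the width of its range from its mean. The range [[0, (hz k + 1) / 2]] gives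
    one argument of the minimum in [cap], the lower end provided by [hV] gives the other. *)
Lemma noise_step_bound h a o : active (kphase h) -> `|noise_step h a o| <= cap (kphase h).
Proof.
set k := kphase h => /active_bound[h4 th _]; have h0 := hz_gt0 R k.
have m1 : 1 <= hz k / 2 by lra.
have hk : (hz k)^-1 * hz k = 1 by rewrite mulVf // gt_eqF.
have i0 : 0 < (hz k)^-1 by rewrite invr_gt0.
have i1 : (hz k)^-1 <= 1 by rewrite invf_le1 //; lra.
have g1 : 0 <= 1 - (hz k)^-1 <= 1 by move: i0 i1; lra.
have B1 o' : 0 <= sample h a o' <= (hz k + 1) / 2.
  rewrite /sample -/k; have /andP[V0 V1] := optimal_value_bound hA hrho S0 f hr m1 (rcons h (a, o')).
  have /andP[r0 r1] := hr (phi h) a o'; case/andP: g1 => g0 g1.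
  rewrite addr_ge0 ?mulr_ge0 //=.
  have : (1 - (hz k)^-1) * Vs (hz k / 2) (rcons h (a, o')) <= (1 - (hz k)^-1) * (hz k / 2).
    by rewrite ler_wpM2l.
  by move: hk; set V := _ * Vs _ _; lra.
have B2 o' : (1 - (hz k)^-1) * (lam * (hz k / 2) - t) <= sample h a o' <=
    1 + (1 - (hz k)^-1) * (hz k / 2).
  rewrite /sample -/k; have /andP[V0 V1] := optimal_value_bound hA hrho S0 f hr m1 (rcons h (a, o')).
  have /andP[r0 r1] := hr (phi h) a o'; case/andP: g1 => g0 g1.
  have V2 := hV (rcons h (a, o')) th m1.
  by apply/andP; split; [rewrite -[leLHS]add0r|]; apply: lerD => //; rewrite ler_wpM2l.
have /andP[M1l M1u] := next_mean_bound hrho h a B1.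
have /andP[M2l M2u] := next_mean_bound hrho h a B2.
have /andP[S1l S1u] := B1 o; have /andP[S2l S2u] := B2 o.
rewrite /noise_step; move: M1l M1u M2l M2u S1l S1u S2l S2u.
move: (mean h a _) (sample h a o) => Mm Sm M1l M1u M2l M2u S1l S1u S2l S2u.
rewrite /cap le_min; apply/andP; split; first by rewrite ler_norml; lra.
apply: (@le_trans _ _ (1 + (1 - (hz k)^-1) * ((1 - lam) * hz k / 2 + t))).
  by rewrite ler_norml; lra.
rewrite -addrA lerD2l ler_piMl //; last by case/andP: g1.
rewrite addr_ge0 //; first by rewrite !mulr_ge0 ?hz_ge0 //; move: lam01; lra.
Qed.

Fixpoint noise_rev (l : history A O) (s : S) (b : A) : R :=
  if l is x :: l' then
    let h := rev l' in
    if (s == phi h) && (b == x.1) then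
      let n := (ncount h s b).+1 in
      let al := rate (kphase h) n in
      Num.min (cap (kphase h)) ((1 - al) * noise_rev l' s b +
        al * (noise_step h x.1 x.2 + bo (kphase h) / Num.sqrt n%:R))
    else noise_rev l' s b
  else 0.

(* The bonus plus the weighted average of the deviations of the samples used to
   compute the entry [(s, b)]; clipping from above mirrors the clipping of the
   table. *)
Definition noise h s b := noise_rev (rev h) s b.

Lemma noise_rcons h a o s b : noise (rcons h (a, o)) s b =
  if (s == phi h) && (b == a) then
    let n := (ncount h s b).+1 in
    let al := rate (kphase h) n in
    Num.min (cap (kphase h)) ((1 - al) * noise h s b +
      al * (noise_step h a o + bo (kphase h) / Num.sqrt n%:R))
  else noise h s b.
Proof. by rewrite /noise rev_rcons /= revK. Qed.

Section Target.
Variables (k n : nat) (s : S) (b : A).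
Hypothesis ak : active k.
Hypothesis n0 : (0 < n)%N.
Let bn : R := bo k / Num.sqrt n%:R.
Hypothesis bcap : bn < cap k.

(** The Chernoff exponent: the maximum over [th] of [th * bn - th^2 * cap^2 * rate], attained at the
    [th] below. *)
Definition deviation_exponent : R := bn ^+ 2 / (4 * cap k ^+ 2 * rate k n).
Local Notation L := deviation_exponent.
Let th : R := bn / (2 * cap k ^+ 2 * rate k n).

Definition deviation h (a : A) (o : O) : R :=
  ([&& kphase h == k, s == phi h, b == a, (ncount h s b).+1 == n
     & noise (rcons h (a, o)) s b < 0])%:R.

(** Bounds the expected number of deviations still to come. The exponential interpolates, by the
    weight, between the current noise and [L]; each remaining update adds one [exp (- L)], the price
    of clipping. At count 0 the weight vanishes, which gives [n + 1] such terms before phase [k]. *)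
Let pot h : R :=
  if (kphase h < k)%N then n.+1%:R * expR (- L)
  else if (kphase h == k) && (ncount h s b < n)%N then
    expR (- (weight R k n (ncount h s b) * th * noise h s b
             + (1 - weight R k n (ncount h s b)) * L))
    + (n - ncount h s b)%:R * expR (- L)
  else 0.

Let bn0 : 0 < bn.
Proof. by rewrite divr_gt0 ?bo_gt0 // sqrtr_gt0 ltr0n. Qed.

Let th0 : 0 <= th.
Proof.
apply/ltW/divr_gt0 => //; apply: mulr_gt0; last exact: rate_gt0.
by apply: mulr_gt0 => //; apply: exprn_gt0; exact: cap_gt0.
Qed.

Let pot_ge0 h : 0 <= pot h.
Proof.
rewrite /pot; case: ifP => _; first by rewrite mulr_ge0 ?expR_ge0.
by case: ifP => // _; rewrite addr_ge0 ?mulr_ge0 ?expR_ge0.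
Qed.

Let pot_step h a :
  mean h a (fun o => deviation h a o + pot (rcons h (a, o))) <= pot h.
Proof.
have le_cst c : (forall o, deviation h a o + pot (rcons h (a, o)) <= c) ->
    mean h a (fun o => deviation h a o + pot (rcons h (a, o))) <= c.
  by move=> hc; rewrite -[leRHS](next_mean_cst hrho h a); exact: next_mean_le.
have [kl|kg|ke] := ltngtP (kphase h) k.
- apply: le_cst => o; rewrite /deviation ltn_eqF //= add0r {2}/pot kl.
  rewrite /pot; have [->|[e _]] := kphase_rcons h (a, o); first by rewrite kl.
  rewrite e; case: ifP => // _; rewrite ncount_change // n0 andbT.
  case: ifP => _; last by rewrite mulr_ge0 ?expR_ge0.
  (* The noise is not reset at a change of phase; as the first rate is 1, its old value has weight
     zero. *)
  rewrite weight_first // subn0 !mul0r add0r subr0 mul1r.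
  by rewrite -natr1 mulrDl mul1r addrC.
- apply: le_cst => o; rewrite /deviation gtn_eqF //= add0r.
  have -> : pot (rcons h (a, o)) = 0; last exact: pot_ge0.
  rewrite /pot; have [->|[-> _]] := kphase_rcons h (a, o).
    by rewrite ltnNge (ltnW kg) /= gtn_eqF.
  by rewrite ltnNge (leq_trans (ltnW kg)) //= gtn_eqF // ltnS ltnW.
have kS o : kphase (rcons h (a, o)) = k \/ kphase (rcons h (a, o)) = k.+1.
  by have := kphase_rcons h (a, o); rewrite ke => -[->|[-> _]]; [left|right].
have potS o : kphase (rcons h (a, o)) = k.+1 -> pot (rcons h (a, o)) = 0.
  by rewrite /pot => ->; rewrite ltnNge leqnSn /= gtn_eqF.
have [sb|nsb] := boolP ((s == phi h) && (b == a)); last first.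
  apply: le_cst => o; rewrite /deviation ke eqxx /= andbA (negPf nsb) /= add0r.
  case: (kS o) => e; last by rewrite potS // pot_ge0.
  by rewrite /pot e ke ltnn eqxx /= ncount_same ?ke // (negPf nsb) noise_rcons (negPf nsb).
have [nl|nl] := ltnP (ncount h s b) n; last first.
  have nn : ((ncount h s b).+1 == n) = false by rewrite gtn_eqF // ltnS.
  apply: le_cst => o; rewrite /deviation nn /= !andbF /= add0r.
  case: (kS o) => e; last by rewrite potS // pot_ge0.
  rewrite /pot e ke ltnn eqxx /= ncount_same ?ke // sb.
  by case/andP: sb => /eqP <- /eqP <-; rewrite !ltnNge nl ltnW.
set i := ncount h s b in nl *; set W := weight R k n i.+1.
set al := rate k i.+1; set bj := bo k / Num.sqrt i.+1%:R.
pose X o := expR (- (W * th * Num.min (cap k) ((1 - al) * noise h s b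
  + al * (noise_step h a o + bj)) + (1 - W) * L)).
apply: (@le_trans _ _ (mean h a (fun o => X o + (n - i.+1)%:R * expR (- L)))).
  apply: next_mean_le => // o; rewrite /deviation ke eqxx /= andbA sb /= -/i.
  have nE : noise (rcons h (a, o)) s b = Num.min (cap k) ((1 - al) * noise h s b
      + al * (noise_step h a o + bj)) by rewrite noise_rcons sb ke.
  have [e|ne] := eqVneq i.+1 n.
    have -> : pot (rcons h (a, o)) = 0.
      case: (kS o) => e'; last exact: potS.
      rewrite /pot e' ltnn eqxx /= ncount_same ?ke // sb.
      by case/andP: sb => /eqP <- /eqP <-; rewrite -/i e ltnn.
    (* At the last update the weight is 1, and the exponential dominates the indicator of a negative
       noise. *)
    rewrite /X /W e weight_last subrr mul0r !addr0 mul1r subnn mul0r addr0 -nE /=.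
    have [neg|_] := ltP; last by rewrite expR_ge0.
    rewrite -(@expR0 R) ler_expR oppr_ge0 mulr_ge0_le0 ?(ltW neg) //.
  rewrite /= add0r; case: (kS o) => e'; last first.
    by rewrite potS // addr_ge0 ?mulr_ge0 ?expR_ge0.
  rewrite /pot e' ltnn eqxx /= ncount_same ?ke // sb.
  have -> : (ncount h (phi h) a).+1 = i.+1 by case/andP: sb => /eqP <- /eqP <-.
  by rewrite ltn_neqAle ne nl nE.
rewrite next_meanD next_mean_cst // /pot ke ltnn eqxx nl /=.
have st := @clipped_noise_step _ _ _ rho hrho h a (noise_step h a) (cap k) W al
  (rate k n) bn bj th L (noise h s b) (noise_step_mean h a).
rewrite -/i.
have -> : (n - i)%:R = (n - i.+1)%:R + 1 :> R.
  by rewrite -[1]/(1%:R) -natrD addn1 subnSK.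
have -> : forall x y z : R, x + (y + 1) * z = x + z + y * z by move=> *; ring.
rewrite lerD2r.
rewrite weight_step //; apply: st.
- by move=> o; rewrite -ke; apply: noise_step_bound; rewrite ke.
- exact: cap_gt0.
- exact: weight_bound.
- exact: rate_ge0.
- exact: weight_rate.
- exact: rate_gt0.
- exact: bn0.
- exact: ltW.
- rewrite /bn /bj ler_wpM2l ?bo_ge0 // lef_pV2 ?posrE ?sqrtr_gt0 ?ltr0n //.
  by rewrite ler_wsqrtr // ler_nat.
- by [].
- by [].
Qed.

Lemma expectation_deviation pi T : policies pi ->
  expectation rho pi [::] T (path_sum deviation) <= n.+1%:R * expR (- L).
Proof.
move=> hpi; pose Psi h := path_sum deviation h + pot h.
have sup h : step_mean rho pi h (fun a o => Psi (rcons h (a, o))) <= Psi h.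
  rewrite /Psi -[leRHS]mul1r -(hpi h).2 mulr_suml; apply: ler_sum => a _.
  apply: ler_wpM2l; first by case: (hpi h).
  have -> : mean h a (fun o => path_sum deviation (rcons h (a, o)) + pot (rcons h (a, o))) =
    mean h a (fun o => path_sum deviation h + (deviation h a o + pot (rcons h (a, o)))).
    by apply: eq_next_mean => o; rewrite path_sum_rcons addrA.
  by rewrite next_meanD next_mean_cst // lerD2l pot_step.
have := expectation_super hrho hpi sup T [::].
have -> : Psi [::] = n.+1%:R * expR (- L).
  by rewrite /Psi path_sum_nil add0r /pot kphase0 active_gt0.
apply: le_trans; apply: expectation_le => // w _ _.
by rewrite /Psi lerDl pot_ge0.
Qed.

(** The boost was chosen for this: with [h] the horizon, [L >= 16 h^3 * lg / ((h + 1)^2 * (1 + 2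
    h))], which is at least [3 * lg] once [h >= 4]. *)
Lemma deviation_exponent_ge : 3 * lg R k <= L.
Proof.
have [h4 _ _] := active_bound ak; have l0 := lg_ge R k.
have c0 := cap_gt0 k; have a0 := rate_gt0 R k n; have nR : 0 < n%:R :> R by rewrite ltr0n.
have d0 : 0 < 4 * cap k ^+ 2 * rate k n.
  by apply: mulr_gt0 => //; apply: mulr_gt0 => //; exact: exprn_gt0.
rewrite /deviation_exponent ler_pdivlMr //.
rewrite /bn expr_div_n bo_sqr sqr_sqrtr ?ler0n // ler_pdivlMr //.
have cc : cap k ^+ 2 <= ((hz k + 1) / 2) ^+ 2.
  rewrite lerXn2r ?nnegrE ?(ltW c0) //; first by lra.
  by rewrite /cap ge_min lexx.
have rr := rateM R k n.
have -> : 3 * lg R k * (4 * cap k ^+ 2 * rate k n) * n%:R =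
  12 * lg R k * (cap k ^+ 2 * (n%:R * rate k n)) by ring.
have : cap k ^+ 2 * (n%:R * rate k n) <= ((hz k + 1) / 2) ^+ 2 * (1 + 2 * hz k).
  by apply: ler_pM => //; [rewrite exprn_ge0 // ltW|rewrite mulr_ge0 // ltW].
move=> cr; apply: (@le_trans _ _
  (12 * lg R k * (((hz k + 1) / 2) ^+ 2 * (1 + 2 * hz k)))).
  by rewrite ler_wpM2l //; lra.
have -> : 16 * hz k ^+ 3 * lg R k = lg R k * (16 * hz k ^+ 3) by ring.
have -> : 12 * lg R k * (((hz k + 1) / 2) ^+ 2 * (1 + 2 * hz k)) =
  lg R k * (3 * (hz k + 1) ^+ 2 * (1 + 2 * hz k)) by field.
rewrite ler_wpM2l //; first lra.
move: h4; generalize (hz k) => x x4; nra.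
Qed.

End Target.

Lemma path_sum_sum (I : Type) (l : seq I) (G : I -> history A O -> A -> O -> R) h :
  path_sum (fun h a o => \sum_(i <- l) G i h a o) h = \sum_(i <- l) path_sum (G i) h.
Proof.
elim/last_ind: h => [|h [a o] IH].
  by rewrite path_sum_nil big1.
by rewrite path_sum_rcons IH -big_split; apply: eq_bigr => i _; rewrite path_sum_rcons.
Qed.

Lemma path_sumZ c (G : history A O -> A -> O -> R) h :
  path_sum (fun h a o => c * G h a o) h = c * path_sum G h.
Proof.
elim/last_ind: h => [|h [a o] IH]; first by rewrite !path_sum_nil mulr0.
by rewrite !path_sum_rcons IH mulrDr.
Qed.

Lemma path_sum_le n (F G : history A O -> A -> O -> R) h :
  (forall h a o, (size h < n)%N -> F h a o <= G h a o) -> (size h <= n)%N ->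
  path_sum F h <= path_sum G h.
Proof.
move=> FG; elim/last_ind: h => [|h [a o] IH]; first by rewrite !path_sum_nil.
by rewrite size_rcons => hn; rewrite !path_sum_rcons lerD ?FG ?IH // ltnW.
Qed.

(** A bonus of size at least [cap] outweighs any single noise term, so negative noise is counted
    only for smaller bonuses. *)
Definition failure h a o : bool :=
  let n := (ncount h (phi h) a).+1 in
  [&& active (kphase h), bo (kphase h) / Num.sqrt n%:R < cap (kphase h)
    & noise (rcons h (a, o)) (phi h) a < 0].

Definition failure_cost h a o : R := (failure h a o)%:R * hz (kphase h).

Section ExpectedFailure.
Variables (pi : history A O -> A -> R) (T : nat).
Hypothesis hpi : policies pi.

Let J G : R := expectation rho pi [::] T (path_sum G).

Let J_sum (I : Type) (l : seq I) (G : I -> history A O -> A -> O -> R) :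
  J (fun h a o => \sum_(i <- l) G i h a o) = \sum_(i <- l) J (G i).
Proof.
rewrite /J /expectation exchange_big; apply: eq_bigr => w _.
by rewrite path_sum_sum mulr_sumr.
Qed.

Let JZ c G : J (fun h a o => c * G h a o) = c * J G.
Proof.
by rewrite /J -expectationZ; apply: eq_bigr => w _; rewrite path_sumZ.
Qed.

Let bad k n := active k && (bo k / Num.sqrt n.+1%:R < cap k).
Let F k s b n h a o : R := (bad k n)%:R * hz k * deviation k n.+1 s b h a o.

Let F_ge0 k s b n h a o : 0 <= F k s b n h a o.
Proof. by rewrite /F !mulr_ge0 ?hz_ge0. Qed.

(** A union bound: each failure is the deviation of one phase, one entry and one count, and counts
    in phase [k] stay below [change_point k]. *)
Let failure_cost_le h a o : (size h < T)%N -> failure_cost h a o <=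
  \sum_(k < T.+1) \sum_s \sum_b \sum_(n < change_point k) F k s b n h a o.
Proof.
move=> hT; rewrite /failure_cost; have [fl|_] := boolP (failure h a o); last first.
  by rewrite mul0r; do 4! (apply: sumr_ge0 => ? _).
have kT : (kphase h < T.+1)%N.
  rewrite ltnS; apply: leq_trans (leq_change_point _) _.
  exact: leq_trans (kphase_le h) hT.
have /and3P[ak bk nk] := fl.
have nT := ncount_le S0 f r (phi h) a (active_gt0 ak).
rewrite (bigD1 (Ordinal kT)) //= (bigD1 (phi h)) //= (bigD1 a) //= (bigD1 (Ordinal nT)) //=.
rewrite -!addrA {1}/F /bad ak bk /deviation !eqxx nk /= mul1r mulr1 lerDl.
by rewrite !addr_ge0 //; repeat (apply: sumr_ge0 => ? _); exact: F_ge0.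
Qed.

(** With [x] the change point, [exp (- L) <= 1 / (8 x^6)] bounds the sum by [sa * hz k / (4 x^4)].
    Then [16 sa <= hz k ^+ 2] and [hz k <= x] bring it below [1 / x], and [2^k <= x]. *)
Let cost_bound k : \sum_s \sum_b \sum_(n < change_point k) J (F k s b n) <= (1 / 2) ^+ k.
Proof.
pose x : R := (change_point k)%:R.
have x1 : 1 <= x by rewrite ler1n change_point_gt0.
have xk : x^-1 <= (1 / 2) ^+ k.
  rewrite div1r exprVn lef_pV2 ?posrE ?exprn_gt0 //; last by lra.
  by rewrite -natrX ler_nat change_point_exp.
have FE s b n : J (F k s b n) = (bad k n)%:R * hz k * J (deviation k n.+1 s b).
  by rewrite -JZ.
have [ak|nak] := boolP (active k); last first.
  rewrite big1 => [|s _]; first by rewrite exprn_ge0.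
  rewrite big1 // => b _; rewrite big1 // => n _.
  by rewrite FE /bad (negPf nak) !mul0r.
have [h4 _ hs] := active_bound ak; have h0 := hz_gt0 R k.
have Fle s b (n : 'I_(change_point k)) : J (F k s b n) <= hz k * (2 * x) * (8 * x ^+ 6)^-1.
  rewrite FE /bad ak /=; case: ltP => bc; last first.
    by rewrite !mul0r !mulr_ge0 ?invr_ge0 ?mulr_ge0 ?exprn_ge0 ?hz_ge0 //; lra.
  rewrite mul1r -mulrA ler_wpM2l ?hz_ge0 //.
  apply: le_trans (expectation_deviation s b ak (ltn0Sn n) bc T hpi) _.
  apply: ler_pM; rewrite ?expR_ge0 //.
    rewrite -natrM ler_nat; have := ltn_ord n; lia.
  have -> : (8 * x ^+ 6)^-1 = expR (- (3 * lg R k)).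
    rewrite expRN expRM_natl /lg lnK ?posrE ?mulr_gt0 ?exprn_gt0 ?ltr0n ?change_point_gt0 //.
    by congr (_^-1); rewrite -/x; ring.
  by rewrite ler_expR lerN2 deviation_exponent_ge.
apply: (@le_trans _ _ (\sum_(s : S) \sum_(b : A) \sum_(n < change_point k)
    hz k * (2 * x) * (8 * x ^+ 6)^-1)).
  by do 3! (apply: ler_sum => ? _).
have x0 : x != 0 by rewrite gt_eqF //; lra.
apply: le_trans xk.
set e0 := _ / _.
have -> : \sum_(s : S) \sum_(b : A) \sum_(n < change_point k) e0 =
    #|S|%:R * (#|A|%:R * (x * e0)).
  by rewrite !sumr_const card_ord /x !mulr_natl.
have -> : #|S|%:R * (#|A|%:R * (x * e0)) = (16 * sa * hz k) / (64 * x ^+ 4).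
  by rewrite /e0 /sa; field.
have xp : 0 < x by lra.
rewrite ler_pdivrMr ?mulr_gt0 ?exprn_gt0 //.
have -> : x^-1 * (64 * x ^+ 4) = 64 * x ^+ 3 by field.
have hx : hz k <= x by exact: hz_le_change_point.
have h3 : hz k ^+ 3 <= x ^+ 3 by rewrite lerXn2r ?nnegrE ?hz_ge0 //; lra.
have : 16 * sa * hz k <= hz k ^+ 2 * hz k by rewrite ler_wpM2r ?hz_ge0.
have -> : hz k ^+ 2 * hz k = hz k ^+ 3 by ring.
have : 0 <= x ^+ 3 by rewrite exprn_ge0 //; lra.
by lra.
Qed.

Lemma expectation_failure : expectation rho pi [::] T (path_sum failure_cost) <= 2.
Proof.
apply: (@le_trans _ _ (J (fun h a o =>
    \sum_(k < T.+1) \sum_s \sum_b \sum_(n < change_point k) F k s b n h a o))).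
  apply: expectation_le => // w wT _; apply: (@path_sum_le T); last by rewrite wT.
  exact: failure_cost_le.
rewrite J_sum; under eq_bigr do rewrite J_sum.
under eq_bigr do under eq_bigr do rewrite J_sum.
under eq_bigr do under eq_bigr do under eq_bigr do rewrite J_sum.
apply: (@le_trans _ _ (\sum_(k < T.+1) (1 / 2 : R) ^+ k)).
  by apply: ler_sum => k _; exact: cost_bound.
suff -> : \sum_(k < T.+1) (1 / 2 : R) ^+ k = 2 - 2 * (1 / 2) ^+ T.+1.
  by have e0 : 0 <= (1 / 2 : R) ^+ T.+1; [rewrite exprn_ge0|lra].
elim: T.+1 => [|n IH]; first by rewrite big_ord0 expr0; lra.
by rewrite big_ord_recr /= IH exprS; field.
Qed.

End ExpectedFailure.
End Noise.

(** * Optimism of the table *)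

Section Optimism.
Variables (R : realType) (A O S : finType).
Hypothesis hA : (0 < #|A|)%N.
Variables (rho : history A O -> A -> O -> R).
Hypothesis hrho : is_environment rho.
Variables (S0 : S) (f : S -> A -> O -> S) (r : S -> A -> O -> R).
Hypothesis hr : forall s a o, 0 <= r s a o <= 1.
Variables (lam t D E : R).
Hypothesis lam01 : 0 <= lam <= 1.
Hypothesis t0 : 0 <= t.
Hypothesis D0 : 0 <= D.

Implicit Types (h g : history A O) (s : S) (a b : A) (o : O).
Local Notation phi := (aleatoric S0 f).
Local Notation mean := (next_mean rho).
Local Notation Vs := (optimal_value rho S0 f r).
Local Notation Qs m := (optimal_action_value rho S0 f r (1 - m^-1)).
Local Notation hz := (hz R).
Local Notation bo := (bo R).
Local Notation rate := (rate R).
Local Notation kphase := (@kphase A O).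
Local Notation ncount := (ncount S0 f r).
Local Notation qval := (qval S0 f r).
Local Notation qmax := (qmax S0 f r).
Local Notation qrun := (qrun S0 f r).
Local Notation sa := (sa R A S).
Local Notation noise := (noise rho S0 f r lam t).
Local Notation noise_step := (noise_step rho S0 f r).
Local Notation failure_cost := (failure_cost rho S0 f r lam t).
Local Notation cap := (cap lam t).

Hypothesis hV : forall m h, t <= m -> 1 <= m -> lam * m - t <= Vs m h.
Hypothesis hD : forall m h g a, t <= m -> 1 <= m -> phi h = phi g ->
  Qs m h a <= Qs m g a + D.

(* A lower bound for the optimal values at horizon [hz k] through those at half
   that horizon. Values at half the horizon stay away from the clipping level
   [hz k] by at least the size [cap k] of the noise, so that the clipping of the
   table is harmless. *)
Definition reference (k : nat) h a : R := Qs (hz k / 2) h a + (lam * hz k / 2 - t).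
Definition slack (k : nat) : R := hz k * D + E.

(** The lower bound carries the noise because the noise follows the same recursion as the table. It
    is left out for entries not yet visited in the phase, whose noise dates from an earlier
    phase. *)
Definition optimistic (k : nat) h (Q : S -> A -> R) (N : S -> A -> nat) : Prop :=
  (forall s b, 0 <= Q s b <= hz k) /\
  (t + E <= hz k -> forall s b, (0 < N s b)%N -> 0 <= noise h s b) /\
  (t + E <= hz k -> forall g b, reference k g b - slack k +
     (if (0 < N (phi g) b)%N then noise h (phi g) b else 0) <= Q (phi g) b).

Hypothesis hE : t + 4 * Num.sqrt sa <= E.

Let s1 : 1 <= Num.sqrt sa. Proof. by apply: sqrt_sa_ge1. Qed.

Let E4 : 4 <= E. Proof. by move: hE s1 t0; lra. Qed.

Lemma large_half k : t + E <= hz k -> t <= hz k / 2 /\ 1 <= hz k / 2.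
Proof. by move: hE s1 t0; lra. Qed.

Lemma optimistic_ge k h Q N g b : optimistic k h Q N -> t + E <= hz k ->
  reference k g b - slack k <= Q (phi g) b.
Proof.
move=> [_ [N0 Qr]] tE; apply: le_trans (Qr tE g b); rewrite lerDl.
by case: ifP => // /(N0 tE).
Qed.

Lemma optimistic_max_ge k h Q N g : optimistic k h Q N -> t + E <= hz k ->
  Vs (hz k / 2) g + (lam * hz k / 2 - t) - slack k <= sup (range (Q (phi g))).
Proof.
move=> opt tE; rewrite /optimal_value (sup_rangeE hA).
apply: le_trans (sup_range_ge hA _ (argmax hA (Qs (hz k / 2) g))).
exact: (optimistic_ge g _ opt tE).
Qed.

Lemma reference_le k h a : t + E <= hz k ->
  reference k h a <= hz k / 2 + (lam * hz k / 2 - t).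
Proof.
move=> tE; have [_ m1] := large_half tE; rewrite lerD2r.
by case/andP: (optimal_action_value_bound hA hrho S0 f hr m1 h a).
Qed.

(** The two discount factors differ by [1 / hz], and [hV] makes [Vs / hz] cover what the shift loses
    by discounting. Discounting the slack releases [slack / hz = D + E / hz], whence the spare
    [D]. *)
Lemma reference_backup h a o : t + E <= hz (kphase h) ->
  reference (kphase h) h a + noise_step h a o - slack (kphase h) + D <=
  r (phi h) a o + (1 - (hz (kphase h))^-1) *
    (Vs (hz (kphase h) / 2) (rcons h (a, o)) + (lam * hz (kphase h) / 2 - t)
     - slack (kphase h)).
Proof.
set k := kphase h => tE; have [tm m1] := large_half tE.
have h0 := hz_gt0 R k; have hn : hz k != 0 by rewrite gt_eqF.
rewrite /reference /noise_step -/k bellman //.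
set MS := mean h a (fun o => r _ _ _ + (1 - (hz k)^-1) * _).
set MQ := mean h a _.
have MSQ : MQ + (hz k)^-1 * (lam * hz k / 2 - t) <= MS.
  rewrite -[X in _ + X](next_mean_cst hrho h a) -next_meanD.
  apply: next_mean_le => // o'; have V := hV (rcons h (a, o')) tm m1.
  have : (hz k)^-1 * (lam * (hz k / 2) - t) <= (hz k)^-1 * Vs (hz k / 2) (rcons h (a, o')).
    by rewrite ler_pM2l // invr_gt0.
  have -> : (hz k / 2)^-1 = (hz k)^-1 + (hz k)^-1 by field.
  by rewrite !mulrA; lra.
have -> : slack k = hz k * (D + E / hz k) by rewrite /slack; field.
have : (hz k)^-1 * (hz k * (D + E / hz k)) = D + E / hz k by rewrite mulrA mulVf // mul1r.
have : 0 <= E / hz k by rewrite divr_ge0 ?hz_ge0 //; move: E4; lra.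
move: MSQ; set v := Vs _ _; set e := hz k * _; set ih := (hz k)^-1; lra.
Qed.

(** The first rate is 1, so the old values need no comparison at the first update. *)
Lemma rate_split k n (x y x' y' : R) : (0 < n)%N -> ((1 < n)%N -> x <= x') -> y <= y' ->
  (1 - rate k n) * x + rate k n * y <= (1 - rate k n) * x' + rate k n * y'.
Proof.
move=> n0 xx yy; have a0 := rate_ge0 R k n; have a1 := rate_le1 R k n0.
apply: lerD; last by rewrite ler_wpM2l.
case: n n0 xx a0 a1 => [//|[_ _ _ _|n _ xx _ a1]]; first by rewrite rate1 subrr !mul0r.
by rewrite ler_wpM2l ?xx //; lra.
Qed.

Lemma qtarget_ge0 h a o : (forall s b, 0 <= qval h s b) -> 0 <= qtarget S0 f r h a o.
Proof.
move=> Q0; have h1 := hz_ge1 R (kphase h); have h0 := hz_gt0 R (kphase h).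
rewrite /qtarget !addr_ge0 //; first by case/andP: (hr (phi h) a o).
  rewrite mulr_ge0 //; first by rewrite subr_ge0 invf_le1.
  by rewrite /qmax (sup_rangeE hA).
by rewrite divr_ge0 ?bo_ge0 ?sqrtr_ge0.
Qed.

Lemma optimistic_learn h a o :
  t + 4 * Num.sqrt sa + path_sum failure_cost (rcons h (a, o)) <= E ->
  optimistic (kphase h) h (qval h) (ncount h) ->
  optimistic (kphase h) (rcons h (a, o)) (qtable (qrun (rcons h (a, o))))
    (counts (qrun (rcons h (a, o)))).
Proof.
move=> hF opt; have [Q01 [N0 Qr]] := opt; set k := kphase h in opt Q01 N0 Qr *.
set n := (ncount h (phi h) a).+1; set al := rate k n.
have n0 : (0 < n)%N by [].
have al0 : 0 <= al by exact: rate_ge0.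
have al1 : al <= 1 by exact: rate_le1.
have fc0 h' : 0 <= path_sum failure_cost h'.
  by apply: path_sum_ge0 => *; rewrite mulr_ge0 ?hz_ge0.
pose X := noise_step h a o + bo k / Num.sqrt n%:R.
have noiseE s b : noise (rcons h (a, o)) s b =
    if (s == phi h) && (b == a) then
      Num.min (cap k) ((1 - al) * noise h (phi h) a + al * X) else noise h s b.
  rewrite noise_rcons; case: ifP => // /andP[/eqP -> /eqP ->] //.
have M0 : t + E <= hz k -> 0 <= noise (rcons h (a, o)) (phi h) a.
  move=> tE; rewrite leNgt; apply/negP => neg.
  have ak : active A S t k by rewrite /active; move: hE tE; lra.
  have [bc|cb] := ltP (bo k / Num.sqrt n%:R) (cap k).
    (* The cost [hz k] of this failure is part of [E], against [t + E <= hz k]. *)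
    have fl : failure rho S0 f r lam t h a o by rewrite /failure -/k -/n ak bc.
    move: hF; rewrite path_sum_rcons /failure_cost fl mul1r -/k.
    by have := fc0 h; move: tE t0 s1; lra.
  move: neg; rewrite noiseE !eqxx /= ltNge => /negP; apply.
  rewrite le_min (ltW (cap_gt0 lam01 t0 k)) /=.
  have -> : 0 = (1 - al) * 0 + al * 0 by rewrite !mulr0 addr0.
  apply: rate_split => //; first by rewrite ltnS => /(N0 tE).
  have := noise_step_bound hA hrho hr lam01 t0 hV a o ak; rewrite ler_norml -/k.
  by rewrite /X; move: cb; lra.
have count_pos s b : (0 < counts (qrun (rcons h (a, o))) s b)%N =
    ((s == phi h) && (b == a)) || (0 < ncount h s b)%N.
  by rewrite counts_qrun_rcons; case: ifP.
split=> [s b|].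
  rewrite qtable_qrun_rcons; case: ifP => // _; rewrite -/k -/n -/al /=.
  rewrite le_min ge_min lexx orbT andbT hz_ge0 andbT.
  have /andP[Q0 _] := Q01 (phi h) a.
  have y0 : 0 <= qtarget S0 f r h a o.
    by apply: qtarget_ge0 => s' b'; case/andP: (Q01 s' b').
  by rewrite addr_ge0 // mulr_ge0 //; lra.
split=> tE.
  move=> s b; rewrite count_pos.
  have [/andP[/eqP -> /eqP ->] _|ne /= Nb] := boolP ((s == phi h) && (b == a)).
    exact: M0.
  by rewrite noiseE (negPf ne); exact: N0.
move=> g b; rewrite count_pos qtable_qrun_rcons noiseE -/k -/n -/al.
have [/andP[/eqP gs /eqP ->]|_] := boolP ((phi g == phi h) && (b == a));
  last exact: Qr.
rewrite /=.
(* Against the clipping level: the reference is at most [(1 + lam) * hz k / 2 - t], the noise at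
   most [1 + (1 - lam) * hz k / 2 + t], and the slack absorbs the excess 1. *)
rewrite le_min; apply/andP; split; last first.
  have mc : Num.min (cap k) ((1 - al) * noise h (phi h) a + al * X) <= cap k.
    by rewrite ge_min lexx.
  have cl : cap k <= 1 + (1 - lam) * hz k / 2 + t by rewrite /cap ge_min lexx orbT.
  have := reference_le g a tE.
  have : 0 <= hz k * D by rewrite mulr_ge0 ?hz_ge0.
  by rewrite /slack; move: mc cl E4; lra.
apply: (@le_trans _ _ ((1 - al) * (reference k g a - slack k + noise h (phi h) a) +
    al * (reference k g a - slack k + X))).
  have mc : Num.min (cap k) ((1 - al) * noise h (phi h) a + al * X) <=
      (1 - al) * noise h (phi h) a + al * X by rewrite ge_min lexx orbT.
  by move: mc; set m := Num.min _ _; lra.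
apply: rate_split => // [n1|].
  have := Qr tE g a; rewrite gs; suff -> : (0 < ncount h (phi h) a)%N by [].
  by [].
rewrite /qtarget -/k -/n /X.
have [tm m1] := large_half tE.
have gh : reference k g a <= reference k h a + D.
  by rewrite /reference; have := hD a tm m1 gs; lra.
have := reference_backup a o tE; rewrite -/k.
have Vq := optimistic_max_ge (rcons h (a, o)) opt tE.
have : (1 - (hz k)^-1) * (Vs (hz k / 2) (rcons h (a, o)) + (lam * hz k / 2 - t) - slack k)
    <= (1 - (hz k)^-1) * qmax h (phi (rcons h (a, o))).
  by rewrite ler_wpM2l // subr_ge0 invf_le1 ?hz_gt0 ?hz_ge1.
by move: gh; set B := _ / Num.sqrt _; lra.
Qed.

(** Half of the growth of the horizon goes into the optimal value and, as [lam <= 1], at most the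
    other half into the shift. The sum is what the refresh adds to the table. *)
Lemma reference_mono k h a : t + E <= hz k ->
  reference k.+1 h a <= reference k h a + (hz k.+1 - hz k).
Proof.
move=> tE; have [_ m1] := large_half tE; have hk := hz_le R (leqnSn k).
have m12 : hz k / 2 <= hz k.+1 / 2 by lra.
have := optimal_action_value_mono hA hrho S0 f hr h a m1 m12.
have : lam * (hz k.+1 - hz k) <= hz k.+1 - hz k.
  by rewrite ler_piMl ?subr_ge0 //; case/andP: lam01.
have step (x y c d : R) : lam * (d - c) <= d - c -> y <= x + (d / 2 - c / 2) ->
    y + (lam * d / 2 - t) <= x + (lam * c / 2 - t) + (d - c) by lra.
exact: step.
Qed.

Lemma optimistic_now h a o :
  optimistic (kphase h) (rcons h (a, o)) (qtable (qrun (rcons h (a, o))))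
    (counts (qrun (rcons h (a, o)))) ->
  optimistic (kphase (rcons h (a, o))) (rcons h (a, o)) (qval (rcons h (a, o)))
    (ncount (rcons h (a, o))).
Proof.
move=> opt; set h' := rcons h (a, o) in opt *.
have Qe s b : qval h' s b = qtable (qrun h') s b + (hz (kphase h') - hz (kphase h)).
  exact: qtable_qnow_rcons.
have [e|[e _]] := kphase_rcons h (a, o); rewrite -/h' in e.
  have -> : qval h' = qtable (qrun h').
    by apply/funext => s; apply/funext => b; rewrite Qe e subrr addr0.
  suff -> : ncount h' = counts (qrun h') by rewrite e.
  by apply/funext => s; apply/funext => b; exact: counts_qnow_rcons.
have Nz s b : ncount h' s b = 0%N by exact: ncount_change.
have hk := hz_le R (leqnSn (kphase h)).
have [Q01 _] := opt; rewrite e in Qe *; split=> [s b|].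
  by rewrite Qe; case/andP: (Q01 s b); lra.
split=> tE; first by move=> s b; rewrite Nz.
move=> g b; rewrite Nz addr0 Qe.
have [tk|kt] := leP (t + E) (hz (kphase h)).
  have := optimistic_ge g b opt tk; have := reference_mono g b tk.
  have : hz (kphase h) * D <= hz (kphase h).+1 * D by rewrite ler_wpM2r.
  by rewrite /slack; lra.
(* Nothing is known from the previous phase but nonnegativity of the table. It suffices: as
   [hz < t + E] there, the added [hz.+1 - hz] exceeds [hz.+1 - t - E], with [hz.+1] the new
   horizon. *)
have /andP[Q0 _] := Q01 (phi g) b; have := reference_le g b tE.
have : lam * hz (kphase h).+1 <= hz (kphase h).+1.
  by rewrite ler_piMl ?hz_ge0 //; case/andP: lam01.
have : 0 <= hz (kphase h).+1 * D by rewrite mulr_ge0 ?hz_ge0.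
by rewrite /slack; move: kt Q0; lra.
Qed.

Lemma optimistic_qnow h : t + 4 * Num.sqrt sa + path_sum failure_cost h <= E ->
  optimistic (kphase h) h (qval h) (ncount h).
Proof.
elim/last_ind: h => [|h [a o] IH] hF.
  have h1 : hz 0 = 1 by rewrite /hz /change_point powR1.
  have nE : ~ t + E <= 1 by move: t0 E4; lra.
  split=> [s b|]; first by rewrite /qval qtable_qnow0 kphase0 h1 ler01 lexx.
  by split; rewrite kphase0 h1 => /nE.
apply/optimistic_now/optimistic_learn => //; apply: IH.
move: hF; rewrite path_sum_rcons.
have : 0 <= failure_cost h a o by rewrite mulr_ge0 ?hz_ge0.
by lra.
Qed.

End Optimism.

(** * Regret on a path *)

(** Cauchy-Schwarz, through [2 * q * sqrt n <= n + q^2] with the balancing choice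
    [q = sqrt (M / c)]. *)
Lemma sum_sqrt_le (R : realType) (I : finType) (N : I -> nat) (c M : R) :
  0 < c -> #|I|%:R <= c -> 0 < M -> \sum_i (N i)%:R <= M ->
  \sum_i Num.sqrt (N i)%:R <= Num.sqrt c * Num.sqrt M :> R.
Proof.
move=> c0 Ic M0 NM.
have x0 : 0 < Num.sqrt c by rewrite sqrtr_gt0.
have y0 : 0 < Num.sqrt M by rewrite sqrtr_gt0.
have xx := sqr_sqrtr (ltW c0); have yy := sqr_sqrtr (ltW M0).
set x := Num.sqrt c in x0 xx *; set y := Num.sqrt M in y0 yy *.
have q0 : 0 < y / x by rewrite divr_gt0.
have amgm (n : nat) : Num.sqrt n%:R * (2 * (y / x)) <= n%:R + (y / x) ^+ 2.
  have := sqr_ge0 (Num.sqrt n%:R - y / x); rewrite sqrrB sqr_sqrtr ?ler0n //.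
  by move: (Num.sqrt _) (y / x) => u q; lra.
rewrite -(ler_pM2r (_ : 0 < 2 * (y / x))); last by rewrite mulr_gt0.
rewrite mulr_suml; apply: le_trans (ler_sum _ (fun i _ => amgm (N i))) _.
rewrite big_split /= sumr_const -[_ *+ #|_|]mulr_natl.
have -> : x * y * (2 * (y / x)) = 2 * y ^+ 2 by field; rewrite gt_eqF.
have : #|I|%:R * (y / x) ^+ 2 <= c * (y / x) ^+ 2 by rewrite ler_wpM2r ?sqr_ge0.
have -> : c * (y / x) ^+ 2 = y ^+ 2 by rewrite -xx; field; rewrite gt_eqF.
by rewrite [#|_|]/= yy; move: NM; lra.
Qed.

(** * The potential of one phase *)

Section Potential.
Variables (R : realType) (A S : finType) (k : nat) (v : R).
Hypothesis hA : (0 < #|A|)%N.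
Local Notation hz := (hz R).
Local Notation bo := (bo R).
Local Notation rate := (rate R).
Implicit Types (Q : S -> A -> R) (N : S -> A -> nat).

(* The weight [2 hz k + N s b] of an entry is, up to a factor, inverse to its
   next learning rate, so that the sum telescopes through the update rule; the
   term in [sup] converts values along the path into values of the table. *)
Definition potential Q N (s : S) : R :=
  (\sum_(p : S * A) (2 * hz k + (N p.1 p.2)%:R) * (Q p.1 p.2 - v)) / (2 * hz k + 1)
  - 4 * bo k * (\sum_(p : S * A) Num.sqrt (N p.1 p.2)%:R)
  - 2 * hz k / (2 * hz k + 1) * (sup (range (Q s)) - v).

Let H : R := 2 * hz k.
Let H2 : 2 <= H. Proof. by rewrite /H; have := hz_ge1 R k; lra. Qed.
Let c1 : 0 <= H / (H + 1) <= 1.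
Proof.
have := H2; move: H => x x2; rewrite divr_ge0 ?ler_pdivrMr ?mul1r; lra.
Qed.

(** An entry visited [n >= 1] times lies at most [bo k / sqrt n] below [v], and
    [(H + n) / (H + 1) <= n], so it contributes at least [- bo k * sqrt n]; an unvisited one
    contributes at least [- hz k]. The constant 5 includes the 4 in the potential itself. *)
Lemma potential_lower Q N s : 0 <= v <= hz k ->
  (forall x b, 0 <= Q x b <= hz k) ->
  (forall x b, (0 < N x b)%N -> v - bo k / Num.sqrt (N x b)%:R <= Q x b) ->
  (\sum_x \sum_b N x b <= change_point k)%N -> 0 < sa R A S ->
  - (sa R A S + 1) * hz k - 5 * bo k * (Num.sqrt (sa R A S) * Num.sqrt (change_point k)%:R)
  <= potential Q N s.
Proof.
move=> /andP[v0 vh] Q01 QN NM SA0; rewrite /potential -/H.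
have h0 := hz_ge0 R k; have b0 := bo_ge0 R k; have h2 := H2.
have d0 : 0 < H + 1 by lra.
have sq : \sum_(p : S * A) Num.sqrt (N p.1 p.2)%:R <=
    Num.sqrt (sa R A S) * Num.sqrt (change_point k)%:R.
  apply: sum_sqrt_le => //; first by rewrite card_prod natrM.
    by rewrite ltr0n change_point_gt0.
  by rewrite -natr_sum ler_nat -(pair_bigA _ (fun x b => N x b)).
have entry (p : S * A) : - (hz k + bo k * Num.sqrt (N p.1 p.2)%:R) * (H + 1) <=
    (H + (N p.1 p.2)%:R) * (Q p.1 p.2 - v).
  case: p => x b /=; have /andP[Q0 _] := Q01 x b.
  have [N0|N0] := posnP (N x b).
    rewrite N0 sqrtr0 mulr0 !addr0.
    have : H * (- hz k) <= H * (Q x b - v) by rewrite ler_wpM2l; lra.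
    by lra.
  have n1 : 1 <= (N x b)%:R :> R by rewrite ler1n.
  have s0 : 0 < Num.sqrt (N x b)%:R :> R by rewrite sqrtr_gt0; lra.
  have q : - (bo k / Num.sqrt (N x b)%:R) <= Q x b - v by have := QN _ _ N0; lra.
  apply: le_trans (ler_wpM2l _ q); last by lra.
  have e : bo k * Num.sqrt (N x b)%:R = (N x b)%:R * (bo k / Num.sqrt (N x b)%:R).
    by rewrite -{2}(sqr_sqrtr (ler0n R (N x b))); field; rewrite gt_eqF.
  rewrite e; have : 0 <= bo k / Num.sqrt (N x b)%:R by rewrite divr_ge0 // ltW.
  set w := bo k / _; set n := (N x b)%:R in n1 * => w0.
  have : 0 <= w * (H * (n - 1)) by rewrite mulr_ge0 // mulr_ge0; lra.
  have : 0 <= hz k * H by rewrite mulr_ge0 //; lra.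
  by lra.
have sum : - (sa R A S * hz k + bo k * \sum_(p : S * A) Num.sqrt (N p.1 p.2)%:R) <=
    (\sum_(p : S * A) (H + (N p.1 p.2)%:R) * (Q p.1 p.2 - v)) / (H + 1).
  rewrite ler_pdivlMr //; apply: le_trans (ler_sum _ (fun p _ => entry p)).
  rewrite -mulr_suml sumrN big_split /= -mulr_sumr sumr_const card_prod -mulr_natl natrM.
  exact: lexx.
have top : H / (H + 1) * (sup (range (Q s)) - v) <= hz k.
  case/andP: c1 => c10 c11; have V : sup (range (Q s)) - v <= hz k.
    have : sup (range (Q s)) <= hz k.
      by apply: (sup_range_le hA) => b; case/andP: (Q01 s b).
    by lra.
  apply: le_trans (ler_wpM2l c10 V) _; exact: ler_piMl.
move: sum sq top; rewrite mulNr; set X := \sum_(p : _) Num.sqrt _.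
set Y := Num.sqrt _ * _; set Z := _ / _; set W := _ * (sup _ - v) => sum sq top.
have : bo k * X <= bo k * Y by rewrite ler_wpM2l.
by move: sum top; lra.
Qed.

Lemma potential_start Q N s : 0 <= v -> (forall x b, N x b = 0%N) ->
  (forall x b, 0 <= Q x b <= hz k) -> v <= sup (range (Q s)) ->
  potential Q N s <= sa R A S * hz k.
Proof.
move=> v0 N0 Q01 vQ; rewrite /potential -/H.
have h2 := H2; have d0 : 0 < H + 1 by lra.
have -> : \sum_(p : S * A) Num.sqrt (N p.1 p.2)%:R = 0 :> R.
  by rewrite big1 // => p _; rewrite N0 sqrtr0.
have : (\sum_(p : S * A) (H + (N p.1 p.2)%:R) * (Q p.1 p.2 - v)) / (H + 1) <=
    sa R A S * hz k.
  rewrite ler_pdivrMr //.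
  have -> : sa R A S * hz k * (H + 1) = \sum_(p : S * A) (hz k * (H + 1)).
    by rewrite sumr_const card_prod -mulr_natl natrM mulrA.
  apply: ler_sum => -[x b] _ /=; rewrite N0 addr0; have /andP[Q0 Q1] := Q01 x b.
  have : H * (Q x b - v) <= H * hz k by rewrite ler_wpM2l; lra.
  by have := hz_ge0 R k; lra.
have /andP[c10 _] := c1.
have : 0 <= H / (H + 1) * (sup (range (Q s)) - v) by rewrite mulr_ge0 //; lra.
by lra.
Qed.

Lemma sqrt_gap (n : nat) : (0 < n)%N ->
  1 / Num.sqrt n%:R <= 2 * (Num.sqrt n%:R - Num.sqrt n.-1%:R) :> R.
Proof.
case: n => // n _; rewrite -[n.+1.-1]/n.
have x0 : 0 < Num.sqrt n.+1%:R :> R by rewrite sqrtr_gt0 ltr0n.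
have := sqr_ge0 (Num.sqrt n.+1%:R - Num.sqrt n%:R : R).
rewrite sqrrB !sqr_sqrtr ?ler0n // ler_pdivrMr //.
have : Num.sqrt n.+1%:R ^+ 2 = n.+1%:R :> R by rewrite sqr_sqrtr.
rewrite -[n.+1%:R]natr1.
set x := Num.sqrt (_ + 1); set y := Num.sqrt n%:R; set m := n%:R.
by rewrite expr2; lra.
Qed.

(** As [(H + n) * rate k n = H + 1], the weighted entry falls by at least
    [H / (H + 1) * (Q s a - v) - (y - v)]. The first term cancels the old [sup] term by greediness;
    the maximum in [y] is absorbed by the new one, as [1 - 1 / hz k <= H / (H + 1)]. The growth of
    the square root pays for two bonuses: the one in [y], and the possible drop of the maximum at
    [s'] when [s' = s]. *)
Lemma potential_step Q N Q' N' s a s' (rew : R) :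
  let n := (N s a).+1 in
  let y := rew + (1 - (hz k)^-1) * sup (range (Q s')) + bo k / Num.sqrt n%:R in
  (forall x b, N' x b = if (x == s) && (b == a) then n else N x b) ->
  (forall x b, Q' x b = if (x == s) && (b == a) then
     Num.min ((1 - rate k n) * Q s a + rate k n * y) (hz k) else Q x b) ->
  (forall b, Q s b <= Q s a) -> 0 <= Q s a <= hz k -> 0 <= y ->
  v <= sup (range (Q' s')) ->
  v / hz k - rew <= potential Q N s - potential Q' N' s'.
Proof.
move=> n y N'E Q'E gr /andP[Qa0 Qa1] y0 V'0.
have h0 := hz_gt0 R k; have h1 := hz_ge1 R k; have h2 := H2.
have d0 : 0 < H + 1 by lra.
have hn : H + 1 != 0 by rewrite gt_eqF.
have n1 : 1 <= n%:R :> R by rewrite ler1n.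
have s0 : 0 < Num.sqrt n%:R :> R by rewrite sqrtr_gt0; lra.
have al0 := rate_ge0 R k n; have al1 : rate k n <= 1 by exact: rate_le1.
set al := rate k n in Q'E al0 al1 *; pose B := bo k / Num.sqrt n%:R.
have alh : al * hz k <= B by exact: rate_drop.
have alE : (H + n%:R) * al = H + 1.
  by rewrite /al /rate -/H mulrC [n%:R + _]addrC [1 + H]addrC divfK // gt_eqF //; lra.
have supQ : sup (range (Q s)) = Q s a.
  by apply/le_anti; rewrite (sup_range_ge hA) (sup_range_le hA).
have drop : sup (range (Q s')) <= sup (range (Q' s')) + B.
  apply: (sup_range_le hA) => b.
  have B0 : 0 <= B by rewrite divr_ge0 ?bo_ge0 // ltW.
  have : Q s' b <= Q' s' b + B.
    rewrite Q'E; case: ifP => [/andP[/eqP -> /eqP ->]|_]; last by rewrite lerDl.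
    rewrite -lerBlDr le_min; apply/andP; split; last lra.
    have : al * Q s a <= al * hz k by rewrite ler_wpM2l.
    have : 0 <= al * y by rewrite mulr_ge0.
    by lra.
  by have := sup_range_ge hA (Q' s') b; lra.
have Qle : Q' s a <= (1 - al) * Q s a + al * y by rewrite Q'E !eqxx /= ge_min lexx.
rewrite /potential -/H supQ.
have sumB (F F' : S * A -> R) : (forall p, p != (s, a) -> F' p = F p) ->
    \sum_p F p - \sum_p F' p = F (s, a) - F' (s, a).
  move=> FF; rewrite (bigD1 (s, a)) //= [X in _ - X](bigD1 (s, a)) //=.
  by rewrite (eq_bigr _ FF); ring.
have ne (p : S * A) : p != (s, a) -> (p.1 == s) && (p.2 == a) = false.
  by case: p => x b; rewrite xpair_eqE => /negPf.
have -> : forall a1 a2 b1 b2 c1 c2 : R, a1 - b1 - c1 - (a2 - b2 - c2) =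
   (a1 - a2) + (b2 - b1) + (c2 - c1) by move=> *; ring.
rewrite -mulrBl -!mulrBr -[b2 in _ + _ * b2 + _]opprB.
rewrite !sumB; try by move=> p /ne e; rewrite ?N'E ?Q'E e.
rewrite /= [N' s a]N'E !eqxx /= opprB.
have nN : (N s a)%:R = n%:R - 1 :> R by rewrite /n -natr1; ring.
have gap := @sqrt_gap n isT; rewrite -[n.-1]/(N s a) in gap.
have gapB : 2 * B <= 4 * bo k * (Num.sqrt n%:R - Num.sqrt (N s a)%:R).
  have := ler_wpM2l (bo_ge0 R k) gap; rewrite /B.
  by lra.
set V' := sup (range (Q' s')) in drop V'0 *.
have gam : (1 - (hz k)^-1) * (V' - v) <= H / (H + 1) * (V' - v).
  rewrite ler_wpM2r //; first by rewrite subr_ge0.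
  have : (H + 1)^-1 <= (hz k)^-1 by rewrite lef_pV2 ?posrE // /H; lra.
  have -> : H / (H + 1) = 1 - (H + 1)^-1 by field.
  by lra.
have main : (H + n%:R) * (Q' s a - v) <= (n%:R - 1) * (Q s a - v) +
    (H + 1) * (rew - v / hz k + H / (H + 1) * (V' - v) + 2 * B).
  have step1 : (H + n%:R) * (Q' s a - v) <= (H + n%:R) * ((1 - al) * Q s a + al * y - v).
    by rewrite ler_wpM2l; lra.
  apply: le_trans step1 _.
  have -> : (H + n%:R) * ((1 - al) * Q s a + al * y - v) =
     (H + n%:R - (H + n%:R) * al) * (Q s a - v) + (H + n%:R) * al * (y - v) by ring.
  rewrite alE; have -> : H + n%:R - (H + 1) = n%:R - 1 by ring.
  rewrite lerD2l; apply: ler_wpM2l; first by lra.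
  rewrite /y -/B; have : (1 - (hz k)^-1) * sup (range (Q s')) <= (1 - (hz k)^-1) * (V' + B).
    by rewrite ler_wpM2l // subr_ge0 invf_le1.
  have : 0 <= (hz k)^-1 * B by rewrite mulr_ge0 ?invr_ge0 ?divr_ge0 ?bo_ge0 // ltW.
  by move: gam; lra.
rewrite nN.
have low : (H * (Q s a - v) - (H + 1) * (rew - v / hz k + H / (H + 1) * (V' - v) + 2 * B))
   / (H + 1) <= ((H + (n%:R - 1)) * (Q s a - v) - (H + n%:R) * (Q' s a - v)) / (H + 1).
  by rewrite ler_pM2r ?invr_gt0 //; lra.
have e : (H * (Q s a - v) - (H + 1) * (rew - v / hz k + H / (H + 1) * (V' - v) + 2 * B))
   / (H + 1) = H / (H + 1) * (Q s a - v) - (rew - v / hz k + H / (H + 1) * (V' - v) + 2 * B).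
  by field; rewrite hn gt_eqF.
rewrite e in low; rewrite nN in gapB; move: low gapB.
set x1 := (_ - _) / (H + 1); set x2 := 4 * bo k * _.
by move: (H / (H + 1)) => x3; lra.
Qed.

End Potential.

Lemma sum_ncount_lt (R : realType) (A O S : finType) (S0 : S) f
    (r : S -> A -> O -> R) (h : history A O) : (0 < kphase h)%N ->
  (\sum_x \sum_b ncount S0 f r h x b < change_point (kphase h))%N.
Proof.
move=> k0; have := sum_ncount S0 f r h; have := kphase_gt h.
by rewrite change_pointS //; lia.
Qed.

(** * Accumulating the potential over the phases *)

Section PathRegret.
Variables (R : realType) (A O S : finType).
Hypothesis hA : (0 < #|A|)%N.
Variables (rho : history A O -> A -> O -> R).
Hypothesis hrho : is_environment rho.
Variables (S0 : S) (f : S -> A -> O -> S) (r : S -> A -> O -> R).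
Hypothesis hr : forall s a o, 0 <= r s a o <= 1.
Variables (lam t D E : R).
Hypothesis lam01 : 0 <= lam <= 1.
Hypothesis t0 : 0 <= t.
Hypothesis D0 : 0 <= D.

Implicit Types (h g : history A O) (s : S) (a b : A) (o : O).
Local Notation phi := (aleatoric S0 f).
Local Notation Vs := (optimal_value rho S0 f r).
Local Notation Qs m := (optimal_action_value rho S0 f r (1 - m^-1)).
Local Notation hz := (hz R).
Local Notation bo := (bo R).
Local Notation rate := (rate R).
Local Notation kphase := (@kphase A O).
Local Notation ncount := (ncount S0 f r).
Local Notation qval := (qval S0 f r).
Local Notation qrun := (qrun S0 f r).
Local Notation sa := (sa R A S).
Local Notation failure_cost := (failure_cost rho S0 f r lam t).
Local Notation optimistic := (optimistic rho S0 f r lam t D E).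
Local Notation slack := (slack D E).

Hypothesis hV : forall m h, t <= m -> 1 <= m -> lam * m - t <= Vs m h.
Hypothesis hD : forall m h g a, t <= m -> 1 <= m -> phi h = phi g ->
  Qs m h a <= Qs m g a + D.
Hypothesis hE : t + 4 * Num.sqrt sa <= E.

(** The bound that optimism gives for the table maxima: the value at half the horizon and the shift
    each contribute [lam * hz k / 2 - t]. *)
Definition level (k : nat) : R := lam * hz k - 2 * t - slack k.
Definition phase_regret (k : nat) : R :=
  (2 * sa + 1) * hz k + 5 * bo k * (Num.sqrt sa * Num.sqrt (change_point k)%:R).
Definition greedy_path h : Prop := forall g a o w, h = rcons g (a, o) ++ w ->
  forall b, qval g (phi g) b <= qval g (phi g) a.

Local Notation P k := (potential k (level k)).

Let s1 : 1 <= Num.sqrt sa. Proof. by apply: sqrt_sa_ge1. Qed.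
Let E0 : 0 <= E. Proof. by move: hE s1 t0; lra. Qed.

Lemma phase_regret_ge0 k : 0 <= phase_regret k.
Proof.
have sa1 : 1 <= sa by apply: sa_ge1.
apply: addr_ge0; first by apply: mulr_ge0; [lra|exact: hz_ge0].
by apply: mulr_ge0; [apply: mulr_ge0 => //; exact: bo_ge0|apply: mulr_ge0; exact: sqrtr_ge0].
Qed.

Lemma level_le_hz k : level k <= hz k.
Proof.
have h0 := hz_ge0 R k; have : lam * hz k <= hz k.
  by rewrite ler_piMl //; case/andP: lam01.
have : 0 <= hz k * D by rewrite mulr_ge0.
by rewrite /level /slack; move: t0 E0; lra.
Qed.

Lemma level_large k : 0 <= level k -> t + E <= hz k.
Proof.
have h0 := hz_ge0 R k; have : lam * hz k <= hz k.
  by rewrite ler_piMl //; case/andP: lam01.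
have : 0 <= hz k * D by rewrite mulr_ge0.
by rewrite /level /slack; move: t0; lra.
Qed.

Lemma level0 : level 0 < 0.
Proof.
rewrite ltNge; apply/negP => /level_large; rewrite /hz /change_point powR1.
by move: hE s1 t0; lra.
Qed.

Lemma level_le_max k h Q N g : optimistic k h Q N -> 0 <= level k ->
  level k <= sup (range (Q (phi g))).
Proof.
move=> opt v0; have tE := level_large v0.
apply: le_trans (optimistic_max_ge hA g opt tE).
have [tm m1] := large_half hA S0 t0 hE tE.
have := hV g tm m1; rewrite /level; move: (hz k) (Vs _ _) => x y; lra.
Qed.

Definition sound_entries k (Q : S -> A -> R) (N : S -> A -> nat) : Prop :=
  0 <= level k -> forall s b, (0 < N s b)%N ->
    level k - bo k / Num.sqrt (N s b)%:R <= Q s b.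

(** The updated entry was the maximum at its state, hence at least the level, and by [rate_drop] one
    update lowers it by at most the bonus. *)
Lemma sound_learn h a o : (forall b, qval h (phi h) b <= qval h (phi h) a) ->
  optimistic (kphase h) h (qval h) (ncount h) ->
  sound_entries (kphase h) (qval h) (ncount h) ->
  sound_entries (kphase h) (qtable (qrun (rcons h (a, o))))
    (counts (qrun (rcons h (a, o)))).
Proof.
move=> gr opt sound v0 s b; rewrite counts_qrun_rcons qtable_qrun_rcons.
case: ifP => [/andP[_ _] _|_ Nb]; last exact: sound.
have [Q01 _] := opt; have /andP[Qa0 Qa1] := Q01 (phi h) a.
set n := (ncount h (phi h) a).+1; rewrite /=; set al := rate _ n.
have B0 : 0 <= bo (kphase h) / Num.sqrt n%:R by rewrite divr_ge0 ?bo_ge0 ?sqrtr_ge0.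
have := level_le_hz (kphase h); rewrite le_min => vh; apply/andP; split; last lra.
have : al * hz (kphase h) <= bo (kphase h) / Num.sqrt n%:R by exact: rate_drop.
have : al * qval h (phi h) a <= al * hz (kphase h).
  by rewrite ler_wpM2l // rate_ge0.
have : 0 <= al * qtarget S0 f r h a o.
  rewrite mulr_ge0 ?rate_ge0 // (qtarget_ge0 hA hr) // => s' b'.
  by case/andP: (Q01 s' b').
have : level (kphase h) <= qval h (phi h) a.
  apply: le_trans (level_le_max h opt v0) _; exact: (sup_range_le hA).
by lra.
Qed.

(** The potential with reversed sign, shifted to be nonnegative at a change of phase. Phases of
    negative level are left out, since their excess is nonpositive. *)
Definition path_pot h : R :=
  if 0 <= level (kphase h) then
    sa * hz (kphase h) - P (kphase h) (qval h) (ncount h) (phi h)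
  else 0.

Definition excess h a o : R := level (kphase h) / hz (kphase h) - r (phi h) a o.

Let within h := t + 4 * Num.sqrt sa + path_sum failure_cost h <= E.

Let within_prefix h a o : within (rcons h (a, o)) -> within h.
Proof.
rewrite /within path_sum_rcons => hF.
have : 0 <= failure_cost h a o by rewrite mulr_ge0 ?hz_ge0.
by lra.
Qed.

Let opt_now h : within h -> optimistic (kphase h) h (qval h) (ncount h).
Proof. exact: optimistic_qnow. Qed.

Let opt_learn h a o : within (rcons h (a, o)) ->
  optimistic (kphase h) (rcons h (a, o)) (qtable (qrun (rcons h (a, o))))
    (counts (qrun (rcons h (a, o)))).
Proof.
by move=> hF; apply: optimistic_learn => //; apply: opt_now; exact: within_prefix hF.
Qed.

Lemma learn_excess h a o : within (rcons h (a, o)) ->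
  (forall b, qval h (phi h) b <= qval h (phi h) a) -> 0 <= level (kphase h) ->
  excess h a o <= P (kphase h) (qval h) (ncount h) (phi h) -
    P (kphase h) (qtable (qrun (rcons h (a, o)))) (counts (qrun (rcons h (a, o))))
      (phi (rcons h (a, o))).
Proof.
move=> hF gr v0; have [Q01 _] := opt_now (within_prefix hF).
apply: (@potential_step _ _ _ _ _ hA _ _ _ _ _ a) => //.
- by move=> x b; exact: counts_qrun_rcons.
- by move=> x b; rewrite qtable_qrun_rcons.
- by apply: (qtarget_ge0 hA hr) => s b; case/andP: (Q01 s b).
- exact: level_le_max (opt_learn hF) v0.
Qed.

Lemma potential_cost k h (Q : S -> A -> R) (N : S -> A -> nat) s :
  optimistic k h Q N -> sound_entries k Q N -> 0 <= level k ->
  (\sum_x \sum_b N x b <= change_point k)%N ->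
  sa * hz k - P k Q N s <= phase_regret k.
Proof.
move=> opt so v0 NM.
have [Q01 _] := opt.
have sa0 : 0 < sa by apply: lt_le_trans ltr01 _; apply: sa_ge1.
have v01 : 0 <= level k <= hz k by rewrite v0 level_le_hz.
have := potential_lower hA s v01 Q01 (so v0) NM sa0.
by rewrite /phase_regret; lra.
Qed.

Lemma level_phase_gt0 k : 0 <= level k -> (0 < k)%N.
Proof. by case: k => //; rewrite leNgt level0. Qed.

Lemma path_pot_change_ge0 h a o : within (rcons h (a, o)) ->
  kphase (rcons h (a, o)) = (kphase h).+1 -> 0 <= path_pot (rcons h (a, o)).
Proof.
move=> hF e; rewrite /path_pot; case: ifP => // v0; rewrite subr_ge0.
have opt := opt_now hF; have [Q01 _] := opt.
apply: potential_start => //; last exact: level_le_max opt v0.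
by move=> x b; exact: ncount_change.
Qed.

(* The potential just after the update following [h], before the change of phase
   that may come next. *)
Let post_pot h a o : R :=
  if 0 <= level (kphase h) then sa * hz (kphase h) -
    P (kphase h) (qtable (qrun (rcons h (a, o)))) (counts (qrun (rcons h (a, o))))
      (phi (rcons h (a, o)))
  else 0.

Let excess_post_pot h a o : within (rcons h (a, o)) ->
  (forall b, qval h (phi h) b <= qval h (phi h) a) ->
  excess h a o + path_pot h <= post_pot h a o.
Proof.
move=> hF gr; rewrite /path_pot /post_pot; case: ifP => [v0|/negbT].
  by have := learn_excess hF gr v0; lra.
rewrite -ltNge addr0 /excess => v0; have /andP[r0 _] := hr (phi h) a o.
have : level (kphase h) / hz (kphase h) <= 0.
  by rewrite ler_pdivrMr ?hz_gt0 // mul0r ltW.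
by lra.
Qed.

Let post_pot_le h a o : within (rcons h (a, o)) ->
  (forall b, qval h (phi h) b <= qval h (phi h) a) ->
  sound_entries (kphase h) (qval h) (ncount h) ->
  post_pot h a o <= phase_regret (kphase h).
Proof.
move=> hF gr sound; rewrite /post_pot.
case: ifP => [v0|_]; last exact: phase_regret_ge0.
apply: (potential_cost _ (opt_learn hF)) => //.
  exact: (sound_learn (o := o) gr (opt_now (within_prefix hF)) sound).
by rewrite sum_counts_qrun sum_ncount_lt ?level_phase_gt0.
Qed.

Let greedy_path_rcons h a o : greedy_path (rcons h (a, o)) ->
  greedy_path h /\ forall b, qval h (phi h) b <= qval h (phi h) a.
Proof.
move=> gp; split=> [g b o' w e|].
  by apply: (gp g b o' (rcons w (a, o))); rewrite e rcons_cat.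
by apply: (gp h a o [::]); rewrite cats0.
Qed.

Lemma path_excess h : within h -> greedy_path h ->
  sound_entries (kphase h) (qval h) (ncount h) /\
  path_sum excess h <= \sum_(j < kphase h) phase_regret j + path_pot h.
Proof.
elim/last_ind: h => [|h [a o] IH] hF gp.
  rewrite /sound_entries /path_pot kphase0 leNgt level0 big_ord0 addr0 path_sum_nil.
  by split.
have [gp' gr] := greedy_path_rcons gp; have hF' := within_prefix hF.
have [sound IHs] := IH hF' gp'; have le_pot := excess_post_pot hF gr.
rewrite path_sum_rcons.
have [e|[e _]] := kphase_rcons h (a, o).
  have Qe : qval (rcons h (a, o)) = qtable (qrun (rcons h (a, o))).
    apply/funext => s; apply/funext => b.
    by rewrite /qval qtable_qnow_rcons e subrr addr0.
  have Ne : ncount (rcons h (a, o)) = counts (qrun (rcons h (a, o))).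
    by apply/funext => s; apply/funext => b; exact: counts_qnow_rcons.
  rewrite /path_pot Qe Ne e; split.
    exact: (sound_learn (o := o) gr (opt_now hF') sound).
  by move: le_pot; rewrite /post_pot; lra.
split; first by move=> _ s b; rewrite ncount_change.
rewrite e big_ord_recr /=.
have := path_pot_change_ge0 hF e; have := post_pot_le hF gr sound.
by lra.
Qed.

(** Stopping before the refresh that follows the last interaction avoids charging for a phase in
    which no step has been made. *)
Lemma path_excess_le h a o : within (rcons h (a, o)) -> greedy_path (rcons h (a, o)) ->
  path_sum excess (rcons h (a, o)) <= \sum_(j < (kphase h).+1) phase_regret j.
Proof.
move=> hF gp; have [gp' gr] := greedy_path_rcons gp.
have [sound le] := path_excess (within_prefix hF) gp'.
rewrite path_sum_rcons big_ord_recr /=.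
have := excess_post_pot hF gr; have := post_pot_le hF gr sound.
by lra.
Qed.

End PathRegret.

(** * Expected regret *)

Lemma continuation_prob_cat (R : realType) (A O : finType)
    (rho : history A O -> A -> O -> R) pi h w1 w2 :
  continuation_prob rho pi h (w1 ++ w2) =
  continuation_prob rho pi h w1 * continuation_prob rho pi (h ++ w1) w2.
Proof.
elim: w1 h => [|[a o] w1 IH] h; first by rewrite cats0 mul1r.
by rewrite /= IH cat_rcons mulrA.
Qed.

Section ExpectedRegret.
Variables (R : realType) (A O S : finType).
Hypothesis hA : (0 < #|A|)%N.
Variables (rho : history A O -> A -> O -> R).
Hypothesis hrho : is_environment rho.
Variables (S0 : S) (f : S -> A -> O -> S) (r : S -> A -> O -> R).
Hypothesis hr : forall s a o, 0 <= r s a o <= 1.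

Implicit Types (h g w : history A O) (s : S) (a b : A) (o : O).
Local Notation phi := (aleatoric S0 f).
Local Notation Vs := (optimal_value rho S0 f r).
Local Notation Qs m := (optimal_action_value rho S0 f r (1 - m^-1)).
Local Notation hz := (hz R).
Local Notation qval := (qval S0 f r).
Local Notation sa := (sa R A S).
Local Notation agent := (qlearning_policy S0 f r).

Lemma qlearning_policyE h a :
  agent h a = (a \in greedy (qval h (phi h)))%:R / #|greedy (qval h (phi h))|%:R.
Proof. by rewrite -(current_qnow S0 f r h). Qed.

Lemma qlearning_policyP : policies agent.
Proof.
move=> h; split=> [a|]; first by rewrite qlearning_policyE divr_ge0.
under eq_bigr do rewrite qlearning_policyE.
rewrite -mulr_suml; set B := greedy _.
have B0 : (0 < #|B|)%N.
  apply/card_gt0P; exists (argmax hA (qval h (phi h))).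
  by rewrite inE; apply/forallP => b; exact: argmaxP.
have -> : \sum_a (a \in B)%:R = #|B|%:R :> R.
  by rewrite -natr_sum -sum1_card [in RHS]big_mkcond /=; congr _%:R;
    apply: eq_bigr => a _; case: (a \in B).
by rewrite mulfV // pnatr_eq0 -lt0n.
Qed.

Lemma greedy_path_qlearning w :
  continuation_prob rho agent [::] w != 0 -> greedy_path S0 f r w.
Proof.
move=> pw g a o w' e b; move: pw; rewrite e -cats1 -catA continuation_prob_cat /=.
rewrite qlearning_policyE mulf_eq0 negb_or => /andP[_].
rewrite mulf_eq0 negb_or => /andP[+ _]; rewrite mulf_eq0 negb_or => /andP[+ _].
rewrite mulf_eq0 negb_or => /andP[+ _]; rewrite pnatr_eq0 eqb0 negbK inE.
by move/forallP; apply.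
Qed.

Lemma path_sum_rewards (c : nat -> R) w :
  path_sum (fun h a o => c (size h) - r (phi h) a o) w =
  \sum_(i < size w) c i - \sum_(0 <= i < size w) (rewards S0 f r [::] w)`_i.
Proof.
have -> : \sum_(0 <= i < size w) (rewards S0 f r [::] w)`_i =
    path_sum (fun h => r (phi h)) w.
  by have := path_sum_cat_rewards S0 f r [::] w; rewrite path_sum_nil add0r => ->.
elim/last_ind: w => [|w [a o] IH]; first by rewrite !path_sum_nil big_ord0 subr0.
by rewrite !path_sum_rcons IH size_rcons big_ord_recr /=; ring.
Qed.

Variables (lam t D : R).
Hypothesis lam01 : 0 <= lam <= 1.
Hypothesis t0 : 0 <= t.
Hypothesis D0 : 0 <= D.
Hypothesis hV : forall m h, t <= m -> 1 <= m -> lam * m - t <= Vs m h.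
Hypothesis hD : forall m h g a, t <= m -> 1 <= m -> phi h = phi g ->
  Qs m h a <= Qs m g a + D.

Lemma path_rewards_ge w (T : nat) : size w = T -> (0 < T)%N -> greedy_path S0 f r w ->
  T%:R * (lam - D) - \sum_(j < (phase T).+1) phase_regret R A S j -
    (3 * t + 4 * Num.sqrt sa + path_sum (failure_cost rho S0 f r lam t) w) *
      \sum_(i < T) (hz (phase i.+1))^-1
  <= \sum_(0 <= i < T) (rewards S0 f r [::] w)`_i.
Proof.
move=> wT T0 gp; set F := path_sum (failure_cost _ _ _ _ _ _) w.
(* The slack is fixed here, from the failures of the whole path. As
   [level / hz = lam - D - (2 * t + E) / hz], it brings the third [t]. *)
pose E := t + 4 * Num.sqrt sa + F.
have F0 : 0 <= F by apply: path_sum_ge0 => *; rewrite mulr_ge0 ?hz_ge0.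
have hE : t + 4 * Num.sqrt sa <= E by rewrite lerDl.
have ex : path_sum (excess S0 f r lam t D E) w <= \sum_(j < (phase T).+1) phase_regret R A S j.
  case/lastP: w wT gp @F @E F0 hE => [|w [a o]]; first by move=> wT; rewrite -wT in T0.
  rewrite size_rcons => wT gp F E F0 hE.
  have := path_excess_le hA hrho hr lam01 t0 D0 hV hD hE (lexx E) gp.
  by rewrite /kphase wT.
have eE : excess S0 f r lam t D E =
    fun h a o => (lam - D - (3 * t + 4 * Num.sqrt sa + F) * (hz (phase (size h).+1))^-1)
       - r (phi h) a o.
  apply/funext => h; apply/funext => a; apply/funext => o; congr (_ - _).
  rewrite /level /slack /kphase /E; field.
  by rewrite gt_eqF ?hz_gt0.
move: ex; rewrite eE (path_sum_rewards (fun i => lam - D -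
  (3 * t + 4 * Num.sqrt sa + F) * (hz (phase i.+1))^-1)) wT.
rewrite sumrB sumr_const card_ord -mulr_sumr -mulr_natl.
by lra.
Qed.

(** Of the [3 * D], one comes from the slack and two from the comparison with all policies; the 2
    bounds the expected failure cost. *)
Lemma expected_regret_le (c : R) (T : nat) : (0 < T)%N -> c <= lam + 2 * D ->
  expectation rho agent [::] T (fun w =>
    \sum_(0 <= i < T) (c - (rewards S0 f r [::] w)`_i)) <=
  3 * D * T%:R + \sum_(j < (phase T).+1) phase_regret R A S j +
  (3 * t + 4 * Num.sqrt sa + 2) * \sum_(i < T) (hz (phase i.+1))^-1.
Proof.
move=> T0 cl; set W := \sum_(i < T) _; set G := \sum_(j < _) _.
have W0 : 0 <= W by apply: sumr_ge0 => i _; rewrite invr_ge0 hz_ge0.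
have T1 : 0 <= T%:R :> R by [].
pose cst := T%:R * (c - lam + D) + G + (3 * t + 4 * Num.sqrt sa) * W.
apply: (@le_trans _ _ (expectation rho agent [::] T (fun w =>
    cst + W * path_sum (failure_cost rho S0 f r lam t) w))).
  apply: expectation_le => //; first exact: qlearning_policyP.
  move=> w wT pw; have := path_rewards_ge wT T0 (greedy_path_qlearning pw).
  rewrite -/W -/G sumrB sumr_const_nat subn0 -mulr_natl /cst.
  by set X := \sum_(0 <= i < T) _; set F := path_sum _ _; lra.
rewrite expectationD expectationZ expectation_cst //; last exact: qlearning_policyP.
have := expectation_failure hA hrho hr lam01 t0 hV T qlearning_policyP.
set X := expectation _ _ _ _ _ => X2.
have : W * X <= W * 2 by rewrite ler_wpM2l.
have : T%:R * (c - lam + D) <= T%:R * (3 * D) by rewrite ler_wpM2l //; lra.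
by rewrite /cst; lra.
Qed.

End ExpectedRegret.

(** * Summing the bounds over the phases *)

Section Rates.
Variable R : realType.
Local Notation hz := (hz R).
Local Notation bo := (bo R).
Local Notation lg := (lg R).

Definition root5 (n : nat) : R := n%:R `^ (1 / 5).

Lemma root5_ge0 n : 0 <= root5 n. Proof. exact: powR_ge0. Qed.

Lemma root5E n : root5 n ^+ 5 = n%:R.
Proof. by rewrite -powR_mulrn ?powR_ge0 // /root5 -powRrM div1r mulVf // powRr1. Qed.

Lemma root5_4 n : n%:R `^ (4 / 5) = root5 n ^+ 4.
Proof. by rewrite -powR_mulrn ?powR_ge0 // /root5 -powRrM; congr powR; lra. Qed.

Lemma root5_ge1 n : (0 < n)%N -> 1 <= root5 n.
Proof.
move=> n0; rewrite -(@ler_pXn2r _ 5) ?nnegrE ?root5_ge0 // expr1n root5E.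
by rewrite ler1n.
Qed.

Lemma hz_le_root5 n : (0 < n)%N -> hz (phase n) <= root5 n.
Proof.
move=> n0; rewrite -(@ler_pXn2r _ 5) ?nnegrE ?root5_ge0 ?hz_ge0 // hz5 root5E.
by rewrite ler_nat; case/andP: (phaseP n0).
Qed.

(** With [b] and [a] the fifth roots of [n + 1] and [n], [b^5 - a^5 = 1] gives
    [b^4 - a^4 >= 4 / (5 b)]. From step 20 on, a phase at most doubles the time, and
    [(29 / 25)^5 >= 2] gives [b <= 29 / 25 * hz]; finally [29 / 25 * 5 / 4 = 29 / 20]. *)
Lemma inv_hz_le n : (20 <= n.+1)%N ->
  (hz (phase n.+1))^-1 <= 29 / 20 * (root5 n.+1 ^+ 4 - root5 n ^+ 4).
Proof.
move=> n20; have /andP[kn nk] := phaseP (ltn0Sn n).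
set k := phase n.+1 in kn nk *.
have k0 : (0 < k)%N by rewrite lt0n; apply: contraTneq n20 => k0; rewrite k0 in nk; rewrite -ltnNge.
have b1 := root5_ge1 (ltn0Sn n); have a0 := root5_ge0 n.
have b5 := root5E n.+1; have a5 := root5E n.
set b := root5 n.+1 in b1 b5 *; set a := root5 n in a0 a5 *.
have b0 : 0 < b by lra.
have h0 := hz_gt0 R k.
have bh : b <= 29 / 25 * hz k.
  have hh0 : 0 <= 29 / 25 * hz k by apply: mulr_ge0; [lra|exact: ltW].
  rewrite -(@ler_pXn2r _ 5) ?nnegrE ?hh0 ?(ltW b0) //.
  rewrite exprMn hz5 b5; apply: (@le_trans _ _ (2 * (change_point k)%:R)).
    by rewrite -natrM ler_nat -change_pointS // ltnW.
  by rewrite ler_wpM2r //; lra.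
have ab : a <= b by rewrite -(@ler_pXn2r _ 5) ?nnegrE ?(ltW b0) // a5 b5 ler_nat.
have ba : b ^+ 5 - a ^+ 5 = 1 by rewrite a5 b5 -natr1; ring.
have inv_le : (hz k)^-1 <= 29 / 25 * b^-1.
  rewrite -[leLHS]mul1r ler_pdivrMr // mulrAC ler_pdivlMr // mul1r; exact: bh.
apply: le_trans inv_le _.
have pow j : 0 <= b ^+ j - a ^+ j.
  by rewrite subr_ge0; apply: lerXn2r => //; rewrite nnegrE // ltW.
have : 0 <= (b - a) * ((b ^+ 4 - a ^+ 4) + (b ^+ 3 - a ^+ 3) * a +
    (b ^+ 2 - a ^+ 2) * a ^+ 2 + (b - a) * a ^+ 3).
  apply: mulr_ge0; first by rewrite subr_ge0.
  have mul j i : 0 <= (b ^+ j - a ^+ j) * a ^+ i by rewrite mulr_ge0 ?exprn_ge0.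
  have := pow 4; have := mul 3 1; have := mul 2 2; have := mul 1 3.
  by rewrite !expr1; lra.
have -> : (b - a) * ((b ^+ 4 - a ^+ 4) + (b ^+ 3 - a ^+ 3) * a +
    (b ^+ 2 - a ^+ 2) * a ^+ 2 + (b - a) * a ^+ 3) =
    5 * ((b ^+ 4 - a ^+ 4) * b) - 4 * (b ^+ 5 - a ^+ 5) by ring.
by rewrite ba ler_pdivrMr //; lra.
Qed.

Lemma sum_inv_hz (T : nat) :
  \sum_(i < T) (hz (phase i.+1))^-1 <= 29 / 20 * root5 T ^+ 4 + 19.
Proof.
suff : \sum_(i < T) (hz (phase i.+1))^-1 <= 29 / 20 * root5 T ^+ 4 + (minn T 19)%:R.
  by move/le_trans; apply; rewrite lerD2l ler_nat geq_minr.
elim: T => [|T IH].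
  by rewrite big_ord0 addr_ge0 // mulr_ge0 ?exprn_ge0 ?root5_ge0 //; lra.
rewrite big_ord_recr /=.
have [T19|T19] := ltnP T 19.
  have i1 : (hz (phase T.+1))^-1 <= 1 by rewrite invf_le1 ?hz_gt0 ?hz_ge1.
  have : root5 T ^+ 4 <= root5 T.+1 ^+ 4.
    rewrite lerXn2r ?nnegrE ?root5_ge0 //.
    by rewrite -(@ler_pXn2r _ 5) ?nnegrE ?root5_ge0 // !root5E ler_nat.
  move: IH; rewrite (minn_idPl (ltnW T19)) (minn_idPl T19) -natr1.
  by lra.
have := inv_hz_le (n := T) T19; move: IH.
by rewrite (minn_idPr T19) (minn_idPr (leqW T19)); lra.
Qed.

Lemma sum_hz_le K : \sum_(j < K.+1) hz j <= 8 * hz K.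
Proof.
elim: K => [|K IH].
  by rewrite big_ord_recr big_ord0 /= add0r; have := hz_ge0 R 0; lra.
rewrite big_ord_recr /=; have := hz_leS R K; move: IH.
by set X := \sum_(j < _) _; lra.
Qed.

(** A geometric sum: [(7 / 8)^4 <= 3 / 5] and [1 / (1 - 3 / 5) = 5 / 2]. *)
Lemma sum_hz4_le K : \sum_(j < K.+1) hz j ^+ 4 <= 5 / 2 * hz K ^+ 4.
Proof.
elim: K => [|K IH].
  rewrite big_ord_recr big_ord0 /= add0r.
  by have := exprn_ge0 4 (hz_ge0 R 0); lra.
rewrite big_ord_recr /=.
have : (8 / 7 * hz K) ^+ 4 <= hz K.+1 ^+ 4.
  by rewrite lerXn2r ?nnegrE ?hz_ge0 ?hz_leS // mulr_ge0 ?hz_ge0 //; lra.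
rewrite exprMn; move: IH.
have := exprn_ge0 4 (hz_ge0 R K).
by set X := \sum_(j < _) _; set u := hz K ^+ 4; set v := hz K.+1 ^+ 4; lra.
Qed.

Lemma bo_sqrt_change_point k :
  bo k * Num.sqrt (change_point k)%:R = 4 * hz k ^+ 4 * Num.sqrt (lg k).
Proof.
have l0 : 0 <= lg k by apply: le_trans (lg_ge R k); lra.
apply: (@pexpIrn _ 2); rewrite ?nnegrE //.
- by rewrite mulr_ge0 ?bo_ge0 ?sqrtr_ge0.
- by rewrite !mulr_ge0 ?exprn_ge0 ?hz_ge0 ?sqrtr_ge0.
by rewrite exprMn bo_sqr sqr_sqrtr // !exprMn sqr_sqrtr // -hz5; ring.
Qed.

Lemma phase_regret_le (A S : finType) k (L : R) : 1 <= sa R A S -> lg k <= L ->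
  phase_regret R A S k <= 3 * sa R A S * hz k + 20 * Num.sqrt (sa R A S * L) * hz k ^+ 4.
Proof.
move=> sa1 lL; have sa0 := le_trans ler01 sa1.
rewrite /phase_regret; apply: lerD.
  by rewrite ler_wpM2r ?hz_ge0 //; lra.
have -> : 5 * bo k * (Num.sqrt (sa R A S) * Num.sqrt (change_point k)%:R) =
    5 * Num.sqrt (sa R A S) * (bo k * Num.sqrt (change_point k)%:R) by ring.
rewrite bo_sqrt_change_point [Num.sqrt (_ * L)]sqrtrM //.
have : Num.sqrt (lg k) <= Num.sqrt L by exact: ler_wsqrtr.
set x := Num.sqrt (lg k); set y := Num.sqrt L => xy.
have -> : 5 * Num.sqrt (sa R A S) * (4 * hz k ^+ 4 * x) =
   20 * (Num.sqrt (sa R A S) * hz k ^+ 4) * x by ring.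
have -> : 20 * (Num.sqrt (sa R A S) * y) * hz k ^+ 4 =
   20 * (Num.sqrt (sa R A S) * hz k ^+ 4) * y by ring.
by rewrite ler_wpM2l // !mulr_ge0 ?sqrtr_ge0 ?exprn_ge0 ?hz_ge0.
Qed.

Lemma sum_phase_regret_le (A S : finType) (T : nat) : (0 < T)%N -> 1 <= sa R A S ->
  \sum_(j < (phase T).+1) phase_regret R A S j <=
  24 * sa R A S * root5 T + 50 * Num.sqrt (sa R A S * ln (2 * T%:R ^+ 2)) * root5 T ^+ 4.
Proof.
move=> T0 sa1; set L := ln _; have /andP[kT _] := phaseP T0.
have le_j (j : 'I_(phase T).+1) : true -> phase_regret R A S j <=
    3 * sa R A S * hz j + 20 * Num.sqrt (sa R A S * L) * hz j ^+ 4.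
  move=> _; apply: phase_regret_le => //; apply: lg_le; apply: leq_trans kT.
  by apply: change_point_leq; rewrite -ltnS.
apply: le_trans (ler_sum _ le_j) _; rewrite big_split /= -!mulr_sumr.
have hT := hz_le_root5 T0; have h4T : hz (phase T) ^+ 4 <= root5 T ^+ 4.
  by rewrite lerXn2r ?nnegrE ?hz_ge0 ?root5_ge0.
have s1 : \sum_(j < (phase T).+1) hz j <= 8 * root5 T.
  by apply: le_trans (sum_hz_le _) _; rewrite ler_pM2l.
have s2 : \sum_(j < (phase T).+1) hz j ^+ 4 <= 5 / 2 * root5 T ^+ 4.
  by apply: le_trans (sum_hz4_le _) _; rewrite ler_wpM2l //; lra.
apply: lerD.
  apply: (@le_trans _ _ (3 * sa R A S * (8 * root5 T))); last by lra.
  by rewrite ler_wpM2l //; lra.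
set q := Num.sqrt _.
apply: (@le_trans _ _ (20 * q * (5 / 2 * root5 T ^+ 4))); last by lra.
by rewrite ler_wpM2l // mulr_ge0 ?sqrtr_ge0.
Qed.

(** For such [T] the additive 19 of [sum_inv_hz] raises the factor [29 / 20] only to [3 / 2]. Then
    [t] gets the factor [9 / 2] and the square root at most [50 + 9]. *)
Lemma regret_rate (A S : finType) (T : nat) (t D : R) : (0 < T)%N -> 0 <= t -> 0 <= D ->
  1 <= sa R A S -> 60 <= root5 T ->
  3 * D * T%:R + \sum_(j < (phase T).+1) phase_regret R A S j +
  (3 * t + 4 * Num.sqrt (sa R A S) + 2) * \sum_(i < T) (hz (phase i.+1))^-1 <=
  (120 * Num.sqrt (sa R A S * ln (2 * T%:R ^+ 2)) + 5 * t) * root5 T ^+ 4 +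
  4 * D * T%:R + (54 * sa R A S + 18 * ln T%:R) * root5 T + 2 * t ^+ 5.
Proof.
move=> T0 t0 D0 sa1 z60; have W := sum_inv_hz T; have G := sum_phase_regret_le T0 sa1.
have T1 : 1 <= T%:R :> R by rewrite ler1n.
have T2 : 2 <= T%:R :> R.
  rewrite -(root5E T) exprS; have z1 := exprn_ege1 4 (root5_ge1 T0).
  by apply: le_trans (ler_peMr (root5_ge0 T) z1); lra.
have lnT : 0 <= ln T%:R :> R by exact: ln_ge0.
have L1 : 1 <= ln (2 * T%:R ^+ 2) :> R.
  apply: (@le_trans _ _ (ln (2 ^+ 3))).
    by rewrite lnXn //; have := ln2_ge R; rewrite -mulr_natl; lra.
  rewrite ler_ln ?posrE ?exprn_gt0 ?mulr_gt0 ?exprn_gt0 //; try lra.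
  by rewrite exprS ler_pM2l // lerXn2r ?nnegrE.
have sqL : Num.sqrt (sa R A S) <= Num.sqrt (sa R A S * ln (2 * T%:R ^+ 2)).
  by rewrite ler_wsqrtr // ler_peMr //; lra.
have sq1 : 1 <= Num.sqrt (sa R A S) by rewrite -(sqrtr1 R) ler_wsqrtr.
set q := Num.sqrt (_ * ln _) in G sqL *; set p := Num.sqrt _ in sqL sq1 *.
have z4 : 60 ^+ 4 <= root5 T ^+ 4 by rewrite lerXn2r ?nnegrE ?root5_ge0.
set z4' := root5 T ^+ 4 in W G z4 *; set z := root5 T in z60 G *.
set Ws := \sum_(i < T) _ in W *; set Gs := \sum_(j < _) _ in G *.
have W2 : Ws <= 3 / 2 * z4' by move: W z4; lra.
have e1 : (3 * t + 4 * p + 2) * Ws <= (3 * t + 4 * p + 2) * (3 / 2 * z4').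
  by rewrite ler_wpM2l //; lra.
have e2 : (3 * t + 4 * p + 2) * (3 / 2 * z4') <= (5 * t + 9 * q) * z4'.
  rewrite mulrA ler_wpM2r //; first by apply: le_trans z4; lra.
  by lra.
have e3 : 0 <= q * z4' by rewrite mulr_ge0 ?sqrtr_ge0 //; apply: le_trans z4; lra.
have e4 : 0 <= sa R A S * z by rewrite mulr_ge0 //; lra.
have e5 : 0 <= ln T%:R * z by rewrite mulr_ge0 //; lra.
have e6 : 0 <= D * T%:R by rewrite mulr_ge0 //; lra.
have e7 : 0 <= t ^+ 5 by exact: exprn_ge0.
by lra.
Qed.

End Rates.

(** * Averaging time and distortion as extended reals *)

Section AveragingTime.
Variables (R : realType) (A O S : finType).
Variables (rho : history A O -> A -> O -> R).
Variables (S0 : S) (f : S -> A -> O -> S) (r : S -> A -> O -> R).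
Implicit Types pi : history A O -> A -> R.

Lemma averaging_time_ge0 pi : (0 <= averaging_time rho S0 f r pi)%E.
Proof. by apply: le_ereal_inf_tmp => _ [x [x0 _] <-]; rewrite lee_fin. Qed.

Lemma averaging_time_bound pi (t : R) : averaging_time rho S0 f r pi = t%:E ->
  forall h n, (0 < n)%N ->
  `|average_reward rho S0 f r pi h n - gain rho S0 f r pi| <= t / n%:R.
Proof.
move=> tE h n n0; have n1 : 0 < n%:R :> R by rewrite ltr0n.
apply/ler_addgt0Pr => e e0.
have : ereal_inf [set tau%:E | tau in [set tau : R | 0 <= tau /\
    forall h (T : nat), (0 < T)%N ->
      `|average_reward rho S0 f r pi h T - gain rho S0 f r pi| <= tau / T%:R]] \is a fin_num.
  by rewrite -/(averaging_time rho S0 f r pi) tE.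
move=> /(lb_ereal_inf_adherent e0)[_ [x [x0 xP] <-]].
rewrite -/(averaging_time rho S0 f r pi) tE -EFinD lte_fin => xt.
apply: le_trans (xP h n n0) _; rewrite ler_pdivrMr // mulrDl divfK ?gt_eqF //.
have : e <= e * n%:R by rewrite ler_peMr ?(ltW e0) // ler1n.
by lra.
Qed.

Lemma distortion_le_sup (t D m : R) : sup_distortion rho S0 f r t%:E = D%:E ->
  t <= m -> 1 <= m -> distortion rho S0 f r m <= D.
Proof.
move=> DE tm m1; rewrite -lee_fin -DE; apply: ereal_sup_ubound; right.
by exists m.
Qed.

Lemma sup_distortion_ge0 t : (0 <= sup_distortion rho S0 f r t)%E.
Proof. by apply: ereal_sup_ubound; left. Qed.

End AveragingTime.

Lemma ge0_neqNy (R : numDomainType) (x : \bar R) : (0 <= x)%E -> x != -oo%E.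
Proof. by case: x. Qed.

(** * The bound for all [T] *)

Section Corollary.
Variables (R : realType) (A O S : finType).
Hypothesis hA : (0 < #|A|)%N.
Variables (rho : history A O -> A -> O -> R).
Hypothesis hrho : is_environment rho.
Variables (S0 : S) (f : S -> A -> O -> S) (r : S -> A -> O -> R).
Hypothesis hr : forall s a o, 0 <= r s a o <= 1.
Local Notation agent := (qlearning_policy S0 f r).
Local Notation gain := (gain rho S0 f r).
Local Notation sa := (sa R A S).

Lemma expected_regret_trivial pi (T : nat) : policies pi ->
  expectation rho agent [::] T (fun w =>
    \sum_(0 <= i < T) (gain pi - (rewards S0 f r [::] w)`_i)) <= T%:R.
Proof.
move=> hpi; have hq := qlearning_policyP hA S0 f r.
rewrite -[leRHS](expectation_cst hrho hq [::] T); apply: expectation_le => // w wT _.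
have /andP[_ g1] := gain_bound hrho S0 f hr hpi.
have -> : T%:R = \sum_(0 <= i < T) 1 :> R by rewrite sumr_const_nat subn0.
rewrite big_nat [leRHS]big_nat; apply: ler_sum => i _; rewrite lerBlDr.
suff : 0 <= (rewards S0 f r [::] w)`_i by lra.
elim: w {wT} ([::]) i => [|[a o] w IH] h i; first by rewrite nth_nil.
by case: i => [|i] /=; [case/andP: (hr (aleatoric S0 f h) a o)|exact: IH].
Qed.

Lemma regret_finite pit (t D : R) (T : nat) : (0 < T)%N ->
  aleatoric_policies S0 f pit ->
  gain pit = sup [set gain pi | pi in @aleatoric_policies R A O S S0 f] ->
  averaging_time rho S0 f r pit = t%:E ->
  sup_distortion rho S0 f r t%:E = D%:E ->
  (regret rho S0 f r agent T <=
    ((120 * Num.sqrt (sa * ln (2 * T%:R ^+ 2)) + 5 * t) * root5 R T ^+ 4 +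
     4 * D * T%:R + (54 * sa + 18 * ln T%:R) * root5 R T + 2 * t ^+ 5)%:E)%E.
Proof.
move=> T0 hpit hopt tE DE; apply: ge_ereal_sup => _ [pi hpi <-]; rewrite lee_fin.
have t0 : 0 <= t by rewrite -lee_fin -tE averaging_time_ge0.
have D0 : 0 <= D by rewrite -lee_fin -DE sup_distortion_ge0.
have sa1 : 1 <= sa by apply: sa_ge1.
have T1 : 1 <= T%:R :> R by rewrite ler1n.
have [z60|z60] := leP 60 (root5 R T).
  have ht := averaging_time_bound tE.
  have lam01 : 0 <= gain pit <= 1 by apply: gain_bound => //; case: hpit.
  have hDm m : t <= m -> 1 <= m -> distortion rho S0 f r m <= D.
    exact: distortion_le_sup.
  have hV m h : t <= m -> 1 <= m -> gain pit * m - t <= optimal_value rho S0 f r m h.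
    by move=> _ m1; apply: optimal_value_ge_averaging => //; case: hpit.
  have hD m h g a : t <= m -> 1 <= m -> aleatoric S0 f h = aleatoric S0 f g ->
      optimal_action_value rho S0 f r (1 - m^-1) h a <=
      optimal_action_value rho S0 f r (1 - m^-1) g a + D.
    move=> tm m1 hg; apply: le_trans (optimal_action_value_distortion hA hrho hr a m1 hg) _.
    by rewrite lerD2l hDm.
  have gle : gain pi <= gain pit + 2 * D.
    apply: (gain_le_aleatoric hA hrho hr t0 hDm hpi) => pi' hpi'; rewrite hopt.
    apply: ub_le_sup; last by exists pi'.
    by exists 1 => _ [p [hp _] <-]; case/andP: (gain_bound hrho S0 f hr hp).
  apply: le_trans (expected_regret_le hA hrho hr lam01 t0 D0 hV hD T0 gle) _.
  exact: regret_rate.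
(* For [T < 60^5] the trivial bound suffices: [T <= 60 * T^(4/5)], and the square root multiplied by
   120 is at least [1 / 2]. *)
apply: le_trans (expected_regret_trivial T hpi) _.
have z0 := root5_ge0 R T; have z4 : 0 <= root5 R T ^+ 4 by exact: exprn_ge0.
have L1 : 1 / 4 <= ln (2 * T%:R ^+ 2) :> R.
  apply: (@le_trans _ _ (ln 2)); first by have := ln2_ge R; lra.
  rewrite ler_ln ?posrE ?mulr_gt0 ?exprn_gt0 //; try lra.
  by rewrite ler_peMr // exprn_ege1.
have q2 : 1 / 2 <= Num.sqrt (sa * ln (2 * T%:R ^+ 2)).
  have -> : 1 / 2 = Num.sqrt ((1 / 2) ^+ 2) :> R by rewrite sqrtr_sqr ger0_norm //; lra.
  rewrite ler_wsqrtr //; apply: (@le_trans _ _ (1 * (1 / 4))); first lra.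
  by apply: ler_pM => //; lra.
have Tz : T%:R <= 60 * root5 R T ^+ 4.
  by rewrite -{1}(root5E R T) exprS ler_wpM2r // ltW.
set q := Num.sqrt _ in q2 *; set z := root5 R T in z0 z4 Tz *.
have : 60 * z ^+ 4 <= 120 * q * z ^+ 4 by rewrite ler_wpM2r //; lra.
have : 0 <= t * z ^+ 4 by rewrite mulr_ge0.
have : 0 <= D * T%:R by rewrite mulr_ge0 //; lra.
have : 0 <= (54 * sa + 18 * ln T%:R) * z.
  by rewrite mulr_ge0 // addr_ge0 // mulr_ge0 ?ln_ge0 //; lra.
have : 0 <= t ^+ 5 by exact: exprn_ge0.
by move: Tz; set x := z ^+ 4; set y := t ^+ 5; lra.
Qed.

End Corollary.

Theorem corollary7 (R : realType) (A O S : finType)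
    (hA : (0 < #|A|)%N) (hO : (0 < #|O|)%N)
    (rho : history A O -> A -> O -> R) (hrho : is_environment rho)
    (S0 : S) (f : S -> A -> O -> S) (r : S -> A -> O -> R)
    (hr : forall s a o, 0 <= r s a o <= 1)
    (pit : history A O -> A -> R)
    (hpit : aleatoric_policies S0 f pit)
    (hopt : gain rho S0 f r pit =
            sup [set gain rho S0 f r pi | pi in @aleatoric_policies R A O S S0 f])
    (T : nat) (hT : (1 <= T)%N) :
  let SA : R := #|S|%:R * #|A|%:R in
  let tau : \bar R := averaging_time rho S0 f r pit in
  (regret rho S0 f r (qlearning_policy S0 f r) T <=
     ((120 * Num.sqrt (SA * ln (2 * T%:R ^+ 2)))%:E + 5%:E * tau)
       * (T%:R `^ (4 / 5))%:E
     + 4%:E * sup_distortion rho S0 f r tau * T%:R%:E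
     + ((54 * SA + 18 * ln T%:R) * T%:R `^ (1 / 5))%:E
     + 2%:E * tau ^+ 5)%E.
Proof.
have T0 : 0 < T%:R :> R by rewrite ltr0n.
set SA := #|S|%:R * #|A|%:R; set tau := averaging_time _ _ _ _ _; cbv zeta.
have := averaging_time_ge0 rho S0 f r pit; rewrite -/tau.
have := sup_distortion_ge0 rho S0 f r tau.
have rest : (0 <= ((54 * SA + 18 * ln T%:R) * T%:R `^ (1 / 5))%:E)%E.
  rewrite lee_fin mulr_ge0 ?powR_ge0 // addr_ge0 // mulr_ge0 ?mulr_ge0 // ln_ge0 //.
  by rewrite ler1n.
have pow0 : 0 < T%:R `^ (4 / 5) :> R by exact: powR_gt0.
case tE : tau => [t| |] // sd0 t0; last first.
  (* An infinite averaging time makes the right side [+oo], all other summands being nonnegative; an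
     infinite distortion is treated alike below. *)
  rewrite [(5%:E * +oo)%E]gt0_muley ?lte_fin // addey // gt0_mulye ?lte_fin //.
  rewrite !addye ?leey ?ge0_neqNy // mule_ge0 ?expe_ge0 ?lee_fin //.
  by rewrite mule_ge0 ?lee_fin.
have tow : (0 <= 2%:E * t%:E ^+ 5)%E by rewrite mule_ge0 ?expe_ge0 ?lee_fin.
case DE : (sup_distortion _ _ _ _ _) sd0 => [D| |] // D0; last first.
  rewrite gt0_muley ?lte_fin // gt0_mulye ?lte_fin // addey //.
  by rewrite !addye ?leey ?ge0_neqNy.
have := regret_finite hA hrho hr hT hpit hopt tE DE.
move/le_trans; apply; rewrite root5_4 -/(root5 R T).
rewrite -EFin_expe -!(EFinM, EFinD).
exact: lexx.
Qed.
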